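(* Let $G$ be a non-elementary GBS group with non-trivial center $Z$, and let $\kappa,\varepsilon$ be the associated integers. Let $k$ and $n$ be positive integers. (1) If the first Betti number of $G$ is $1$, there exists an element $\Phi\in\mathrm{Out}(\mathbb{F}_n)$ of order $k$ such that $G\simeq G_\Phi$ if and only if $(k,n-1)=(\kappa,\varepsilon)$. (2) If the first Betti number of $G$ is at least $2$, there exists an element $\Phi\in\mathrm{Out}(\mathbb{F}_n)$ of order $k$ such that $G\simeq G_\Phi$ if and only if $(k,n-1)$ is an integral multiple of $(\kappa,\varepsilon)$.
   Context: A GBS group (generalized Baumslag-Solitar group) is the fundamental group of a finite graph of groups all of whose vertex and edge groups are infinite cyclic. It is non-elementary if it is not isomorphic to $\mathbb{Z}$, $\mathbb{Z}^2$, or the Klein bottle group. For a non-elementary GBS group $G$ with non-trivial center $Z$: $\kappa$ is the least common multiple of the orders of the torsion elements of $G/Z$; $\varepsilon+1$ is the smallest rank of a free subgroup of finite index of $G/Z$ (which is virtually free). $\mathbb{F}_n$ is the free group of rank $n$. For $\Phi\in\mathrm{Out}(\mathbb{F}_n)$, $G_\Phi$ is the mapping torus $G_\alpha=\langle \mathbb{F}_n,t\mid t^{-1}gt=\alpha(g)\ (g\in\mathbb{F}_n)\rangle$ of any $\alpha\in\mathrm{Aut}(\mathbb{F}_n)$ representing $\Phi$ (well defined up to isomorphism). *)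

(* Defs.v *)
From HB Require Import structures.
From mathcomp Require Import all_boot ssralg ssrint generic_quotient.
From mathcomp Require Import boolp.

Set Implicit Arguments.
Unset Strict Implicit.
Unset Printing Implicit Defensive.

Local Open Scope group_scope.
Local Open Scope quotient_scope.

Definition isomorphic (G H : groupType) : Prop :=
  exists f : {multiplicative G -> H}, bijective f.

Definition has_order (G : groupType) (x : G) (d : nat) : Prop :=
  [/\ 0 < d, x ^+ d = 1 & forall j, 0 < j < d -> x ^+ j <> 1].

Definition expgz (G : groupType) (x : G) (m : int) : G :=
  match m with Posz p => x ^+ p | Negz p => x ^- p.+1 end.

Record normal_subgroup (G : groupType) := NormalSubgroup {
  in_normal :> G -> Prop;
  normal1 : in_normal 1;
  normal_div : forall x y, in_normal x -> in_normal y -> in_normal (x / y);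
  normalJ : forall x y, in_normal x -> in_normal (x ^ y)
}.

Section NormalTheory.
Variables (G : groupType) (N : normal_subgroup G).
Implicit Types x y z : G.

Lemma normalV x : N x -> N x^-1.
Proof. by move=> Nx; rewrite -[x^-1]mul1g; apply: normal_div => //; apply: normal1. Qed.

Lemma normalM x y : N x -> N y -> N (x * y).
Proof. by move=> Nx Ny; rewrite -[y]invgK; apply/normal_div/normalV. Qed.

Definition coset_rel : rel G := fun x y => `[< N (x^-1 * y) >].

Lemma coset_rel_refl : reflexive coset_rel.
Proof. by move=> x; apply/asboolP; rewrite mulVg; apply: normal1. Qed.

Lemma coset_rel_sym : symmetric coset_rel.
Proof.
by move=> x y; apply/asboolP/asboolP => /normalV; rewrite invgM invgK.
Qed.

Lemma coset_rel_trans : transitive coset_rel.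
Proof.
move=> y x z /asboolP Nxy /asboolP Nyz; apply/asboolP.
have -> : x^-1 * z = (x^-1 * y) * (y^-1 * z) by rewrite mulgA mulgK.
exact: normalM.
Qed.

Canonical coset_equiv :=
  EquivRel coset_rel coset_rel_refl coset_rel_sym coset_rel_trans.

Definition quotient_group := {eq_quot coset_equiv}.
HB.instance Definition _ := Choice.on quotient_group.
HB.instance Definition _ := EqQuotient.on quotient_group.

Definition coset (x : G) : quotient_group := \pi_quotient_group x.

Lemma coset_eqP x y : coset x = coset y <-> N (x^-1 * y).
Proof. by split=> [/eqmodP/asboolP | /asboolP Nxy] //; apply/eqmodP. Qed.

Lemma reprK (u : quotient_group) : coset (repr u) = u.
Proof. by rewrite /coset reprK. Qed.

Definition quotient_mul (u v : quotient_group) := coset (repr u * repr v).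
Definition quotient_inv (u : quotient_group) := coset (repr u)^-1.

Lemma coset_mul x y : quotient_mul (coset x) (coset y) = coset (x * y).
Proof.
apply/coset_eqP; set a := repr _; set b := repr _.
have /coset_eqP Na : coset a = coset x by apply: reprK.
have /coset_eqP Nb : coset b = coset y by apply: reprK.
have -> : (a * b)^-1 * (x * y) = (a^-1 * x) ^ b * (b^-1 * y).
  by rewrite invgM /conjg !mulgA mulgK.
by apply: normalM => //; apply: normalJ.
Qed.

Lemma coset_inv x : quotient_inv (coset x) = coset x^-1.
Proof.
apply/coset_eqP; set a := repr _.
have /coset_eqP Na : coset a = coset x by apply: reprK.
have -> : a^-1^-1 * x^-1 = ((a^-1 * x) ^ a^-1)^-1.
  by rewrite /conjg !invgK mulgA mulVKg invgM invgK.
by apply/normalV/normalJ.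
Qed.

Lemma quotient_mulA : associative quotient_mul.
Proof.
by move=> u v w; rewrite -(reprK u) -(reprK v) -(reprK w) !coset_mul mulgA.
Qed.

Lemma quotient_mul1 : left_id (coset 1) quotient_mul.
Proof. by move=> u; rewrite -(reprK u) coset_mul mul1g. Qed.

Lemma quotient_1mul : right_id (coset 1) quotient_mul.
Proof. by move=> u; rewrite -(reprK u) coset_mul mulg1. Qed.

Lemma quotient_mulV : left_inverse (coset 1) quotient_inv quotient_mul.
Proof. by move=> u; rewrite -(reprK u) coset_inv coset_mul mulVg. Qed.

Lemma quotient_Vmul : right_inverse (coset 1) quotient_inv quotient_mul.
Proof. by move=> u; rewrite -(reprK u) coset_inv coset_mul mulgV. Qed.

HB.instance Definition _ := isGroup.Build quotient_group
  quotient_mulA quotient_mul1 quotient_1mul quotient_mulV quotient_Vmul.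

End NormalTheory.

Section NormalClosure.
Variables (G : groupType) (S : G -> Prop).

Definition in_normal_closure (x : G) : Prop :=
  forall N : normal_subgroup G, (forall y, S y -> N y) -> N x.

Lemma normal_closure1 : in_normal_closure 1.
Proof. by move=> N _; apply: normal1. Qed.

Lemma normal_closure_div x y :
  in_normal_closure x -> in_normal_closure y -> in_normal_closure (x / y).
Proof. by move=> Nx Ny N SN; apply: normal_div; [apply: Nx | apply: Ny]. Qed.

Lemma normal_closureJ x y : in_normal_closure x -> in_normal_closure (x ^ y).
Proof. by move=> Nx N SN; apply/normalJ/Nx. Qed.

Definition normal_closure :=
  NormalSubgroup normal_closure1 normal_closure_div normal_closureJ.

End NormalClosure.

Section Center.
Variable G : groupType.

Definition in_center (z : G) : Prop := forall x, commute z x.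

Lemma center1 : in_center 1.
Proof. by move=> x; apply/commute_sym/commute1. Qed.

Lemma center_div x y : in_center x -> in_center y -> in_center (x / y).
Proof.
by move=> Zx Zy z; apply/commute_sym/commuteM; [|apply: commuteV];
  apply: commute_sym.
Qed.

Lemma centerJ x y : in_center x -> in_center (x ^ y).
Proof. by move=> Zx; rewrite /conjg Zx mulgA mulVg mul1g. Qed.

Definition center := NormalSubgroup center1 center_div centerJ.

End Center.

(* The set of commutators is invariant under conjugation, so its normal
   closure is the subgroup it generates. *)
Definition commutator_subgroup (G : groupType) : normal_subgroup G :=
  normal_closure (fun x : G => exists y z, x = [~ y, z]).

Definition abelianization (G : groupType) : groupType :=
  quotient_group (commutator_subgroup G).

Section FreeGroup.
Variable X : choiceType.

(* The letter (x, true) stands for x and (x, false) for x^-1. *)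
Let word := seq (X * bool).
Implicit Types s t : word.

Inductive freely_equal : word -> word -> Prop :=
| freely_refl s : freely_equal s s
| freely_sym s t : freely_equal s t -> freely_equal t s
| freely_trans s t u : freely_equal s t -> freely_equal t u -> freely_equal s u
| freely_cancel s t x b : freely_equal (s ++ (x, b) :: (x, ~~ b) :: t) (s ++ t).

Definition word_inv (s : word) : word := rev [seq (l.1, ~~ l.2) | l <- s].

Lemma freely_ctx a b s t :
  freely_equal s t -> freely_equal (a ++ s ++ b) (a ++ t ++ b).
Proof.
elim=> {s t} [s | s t _ /freely_sym | s t u _ st _ tu | s t x c] //.
- exact: freely_refl.
- exact: freely_trans st tu.
by rewrite -!catA !(catA a); apply: freely_cancel.
Qed.

Lemma freely_cat s s' t t' :
  freely_equal s s' -> freely_equal t t' -> freely_equal (s ++ t) (s' ++ t').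
Proof.
move=> /(freely_ctx [::] t) /= ss' /(freely_ctx s' [::]).
by rewrite !cats0; apply: freely_trans.
Qed.

Lemma word_inv_cat s t : word_inv (s ++ t) = word_inv t ++ word_inv s.
Proof. by rewrite /word_inv map_cat rev_cat. Qed.

Lemma freely_inv s t : freely_equal s t -> freely_equal (word_inv s) (word_inv t).
Proof.
elim=> {s t} [s | s t _ /freely_sym | s t u _ st _ tu | s t x c] //.
- exact: freely_refl.
- exact: freely_trans st tu.
rewrite word_inv_cat -(cat1s (x, c)) -(cat1s (x, ~~ c)) catA !word_inv_cat.
by rewrite -!catA /word_inv /= negbK; apply: freely_cancel.
Qed.

Lemma freely_mulV s : freely_equal (s ++ word_inv s) [::].
Proof.
elim/last_ind: s => [|s [x b] IHs]; first exact: freely_refl.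
rewrite -cats1 word_inv_cat -catA /=.
exact: freely_trans (freely_cancel _ _ _ _) IHs.
Qed.

Lemma word_invK : involutive word_inv.
Proof.
move=> s; rewrite /word_inv map_rev revK -map_comp -[RHS]map_id.
by apply: eq_map => -[x b] /=; rewrite negbK.
Qed.

Lemma freely_Vmul s : freely_equal (word_inv s ++ s) [::].
Proof. by have := freely_mulV (word_inv s); rewrite word_invK. Qed.

Definition freely_equalb : rel word := fun s t => `[< freely_equal s t >].

Lemma freely_equalb_refl : reflexive freely_equalb.
Proof. by move=> s; apply/asboolP/freely_refl. Qed.

Lemma freely_equalb_sym : symmetric freely_equalb.
Proof. by move=> s t; apply/asboolP/asboolP => /freely_sym. Qed.

Lemma freely_equalb_trans : transitive freely_equalb.
Proof.
by move=> t s u /asboolP st /asboolP tu; apply/asboolP/(freely_trans st).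
Qed.

Canonical freely_equiv :=
  EquivRel freely_equalb freely_equalb_refl freely_equalb_sym freely_equalb_trans.

Definition free_group := {eq_quot freely_equiv}.
HB.instance Definition _ := Choice.on free_group.
HB.instance Definition _ := EqQuotient.on free_group.

Definition of_word (s : word) : free_group := \pi_free_group s.

Lemma of_wordP s t : of_word s = of_word t <-> freely_equal s t.
Proof. by split=> [/eqmodP/asboolP | /asboolP st] //; apply/eqmodP. Qed.

Lemma repr_wordK (u : free_group) : of_word (repr u) = u.
Proof. by rewrite /of_word generic_quotient.reprK. Qed.

Definition free_mul (u v : free_group) := of_word (repr u ++ repr v).
Definition free_inv (u : free_group) := of_word (word_inv (repr u)).

Lemma of_word_cat s t : free_mul (of_word s) (of_word t) = of_word (s ++ t).
Proof. by apply/of_wordP/freely_cat; apply/of_wordP; rewrite repr_wordK. Qed.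

Lemma of_word_inv s : free_inv (of_word s) = of_word (word_inv s).
Proof. by apply/of_wordP/freely_inv; apply/of_wordP; rewrite repr_wordK. Qed.

Lemma free_mulA : associative free_mul.
Proof.
move=> u v w; rewrite -(repr_wordK u) -(repr_wordK v) -(repr_wordK w).
by rewrite !of_word_cat catA.
Qed.

Lemma free_mul1 : left_id (of_word [::]) free_mul.
Proof. by move=> u; rewrite -(repr_wordK u) of_word_cat. Qed.

Lemma free_1mul : right_id (of_word [::]) free_mul.
Proof. by move=> u; rewrite -(repr_wordK u) of_word_cat cats0. Qed.

Lemma free_mulV : left_inverse (of_word [::]) free_inv free_mul.
Proof.
move=> u; rewrite -(repr_wordK u) of_word_inv of_word_cat.
by apply/of_wordP/freely_Vmul.
Qed.

Lemma free_Vmul : right_inverse (of_word [::]) free_inv free_mul.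
Proof.
move=> u; rewrite -(repr_wordK u) of_word_inv of_word_cat.
by apply/of_wordP/freely_mulV.
Qed.

HB.instance Definition _ := isGroup.Build free_group
  free_mulA free_mul1 free_1mul free_mulV free_Vmul.

Definition free_gen (x : X) : free_group := of_word [:: (x, true)].

End FreeGroup.

Definition free_of_rank (n : nat) : groupType := free_group 'I_n.

(* R u v is read as the defining relation u = v. *)
Definition presented (X : choiceType)
    (R : free_group X -> free_group X -> Prop) : groupType :=
  quotient_group (normal_closure (fun r => exists u v, R u v /\ r = u / v)).

Section Automorphisms.
Variable H : groupType.

Definition is_automorphism (f : H -> H) : Prop :=
  {morph f : x y / x * y} /\ bijective f.

Definition automorphism := {f : H -> H | `[< is_automorphism f >]}.
HB.instance Definition _ := Choice.on automorphism.

Definition aut_fun (a : automorphism) : H -> H := val a.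
Coercion aut_fun : automorphism >-> Funclass.

Lemma aut_ext (a b : automorphism) : a =1 b -> a = b.
Proof. by move=> eq_ab; apply/val_inj/funext. Qed.

Lemma autM (a : automorphism) : {morph a : x y / x * y}.
Proof. by have /asboolP[] := valP a. Qed.

Lemma autV (a : automorphism) x : a x^-1 = (a x)^-1.
Proof.
have a1 : a 1 = 1 by apply: (mulgI (a 1)); rewrite -autM !mulg1.
by apply/esym/mulg1_eq; rewrite -autM mulgV.
Qed.

Lemma autJ (a : automorphism) x y : a (x ^ y) = a x ^ a y.
Proof. by rewrite /conjg !autM autV. Qed.

Lemma aut_bij (a : automorphism) : bijective a.
Proof. by have /asboolP[] := valP a. Qed.

Lemma id_is_automorphism : `[< is_automorphism id >].
Proof. by apply/asboolP; split=> //; exists id. Qed.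

Definition aut_id : automorphism := exist _ id id_is_automorphism.

Lemma comp_is_automorphism (a b : automorphism) : `[< is_automorphism (a \o b) >].
Proof.
apply/asboolP; split=> [x y|]; first by rewrite /= !autM.
exact: bij_comp (aut_bij a) (aut_bij b).
Qed.

Definition aut_comp (a b : automorphism) : automorphism :=
  exist _ (a \o b) (comp_is_automorphism a b).

Lemma inv_exists (a : automorphism) : exists b, cancel a b /\ cancel b a.
Proof. by have [b aK bK] := aut_bij a; exists b. Qed.

Definition inv_fun (a : automorphism) : H -> H := projT1 (cid (inv_exists a)).

Lemma inv_funK (a : automorphism) : cancel a (inv_fun a).
Proof. by rewrite /inv_fun; case: cid => b []. Qed.

Lemma inv_funVK (a : automorphism) : cancel (inv_fun a) a.
Proof. by rewrite /inv_fun; case: cid => b []. Qed.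

Lemma inv_is_automorphism (a : automorphism) : `[< is_automorphism (inv_fun a) >].
Proof.
apply/asboolP; split=> [x y|]; last by exists a; [apply: inv_funVK | apply: inv_funK].
by apply: (can_inj (inv_funK a)); rewrite autM !inv_funVK.
Qed.

Definition aut_inv (a : automorphism) : automorphism :=
  exist _ (inv_fun a) (inv_is_automorphism a).

Lemma aut_compA : associative aut_comp.
Proof. by move=> a b c; apply: aut_ext. Qed.

Lemma aut_comp1 : left_id aut_id aut_comp.
Proof. by move=> a; apply: aut_ext. Qed.

Lemma aut_1comp : right_id aut_id aut_comp.
Proof. by move=> a; apply: aut_ext. Qed.

Lemma aut_compV : left_inverse aut_id aut_inv aut_comp.
Proof. by move=> a; apply: aut_ext => x; apply: inv_funK. Qed.

Lemma aut_Vcomp : right_inverse aut_id aut_inv aut_comp.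
Proof. by move=> a; apply: aut_ext => x; apply: inv_funVK. Qed.

HB.instance Definition _ := isGroup.Build automorphism
  aut_compA aut_comp1 aut_1comp aut_compV aut_Vcomp.

Definition is_inner (a : automorphism) : Prop := exists g, forall x, a x = x ^ g.

Lemma inner1 : is_inner 1.
Proof. by exists 1 => x; rewrite conjg1. Qed.

Lemma inner_div (a b : automorphism) : is_inner a -> is_inner b -> is_inner (a / b).
Proof.
move=> [g ag] [h bh]; exists (h^-1 * g) => x.
have bVh : aut_inv b x = x ^ h^-1.
  by apply: (can_inj (inv_funK b)); rewrite inv_funVK bh conjgKV.
by rewrite conjgM -bVh -ag.
Qed.

Lemma innerJ (a b : automorphism) : is_inner a -> is_inner (a ^ b).
Proof.
move=> [g ag]; exists (aut_inv b g) => x.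
have -> : aut_fun (a ^ b) x = aut_inv b (a (b x)) by [].
by apply: (can_inj (inv_funK b)); rewrite inv_funVK ag autJ inv_funVK.
Qed.

Definition inner := NormalSubgroup inner1 inner_div innerJ.

Definition outer_automorphism : groupType := quotient_group inner.

Inductive mapping_torus_rel (a : automorphism) :
    free_group (option H) -> free_group (option H) -> Prop :=
| torus_fiber g h : mapping_torus_rel a
    (free_gen (Some g) * free_gen (Some h)) (free_gen (Some (g * h)))
| torus_monodromy g : mapping_torus_rel a
    (free_gen (Some g) ^ free_gen None) (free_gen (Some (a g))).

(* The generator None is the stable letter t; recall that x ^ t is
   t^-1 * (x * t). *)
Definition mapping_torus (a : automorphism) : groupType :=
  presented (mapping_torus_rel a).

End Automorphisms.

(* Up to isomorphism this does not depend on the representative: if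
   b = a composed with conjugation by g, replace t by t * g. *)
Definition outer_mapping_torus (H : groupType) (Phi : outer_automorphism H) :
  groupType := mapping_torus (repr Phi).

(* Each geometric edge e carries an arbitrary orientation from edge_src e to
   edge_tgt e; loops and multiple edges are allowed. *)
Record graph_of_groups := GraphOfGroups {
  vertex : finType;
  edge : finType;
  edge_src : edge -> vertex;
  edge_tgt : edge -> vertex;
  vertex_group : vertex -> groupType;
  edge_group : edge -> groupType;
  src_map : forall e, {multiplicative edge_group e -> vertex_group (edge_src e)};
  tgt_map : forall e, {multiplicative edge_group e -> vertex_group (edge_tgt e)};
  src_map_inj : forall e, injective (src_map e);
  tgt_map_inj : forall e, injective (tgt_map e)
}.

Section FundamentalGroup.
Variable A : graph_of_groups.

Definition adjacent (T : {set edge A}) : rel (vertex A) := fun u v =>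
  [exists e in T, ((edge_src e == u) && (edge_tgt e == v))
               || ((edge_src e == v) && (edge_tgt e == u))].

(* The existence of a spanning tree forces the graph to be connected and
   non-empty. *)
Definition spanning_tree (T : {set edge A}) : Prop :=
  (forall u v, connect (adjacent T) u v) /\ #|T|.+1 = #|vertex A|.

Definition pi1_gen : choiceType := ({v : vertex A & vertex_group v} + edge A)%type.

Definition vgen (v : vertex A) (x : vertex_group v) : free_group pi1_gen :=
  free_gen (inl (Tagged (fun v => vertex_group v) x) : pi1_gen).
Definition egen (e : edge A) : free_group pi1_gen := free_gen (inr e : pi1_gen).

Inductive pi1_rel (T : {set edge A}) :
    free_group pi1_gen -> free_group pi1_gen -> Prop :=
| pi1_vertex v (x y : vertex_group v) :
    pi1_rel T (vgen x * vgen y) (vgen (x * y))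
| pi1_edge e (c : edge_group e) :
    pi1_rel T (egen e * vgen (tgt_map e c) * (egen e)^-1) (vgen (src_map e c))
| pi1_tree e : e \in T -> pi1_rel T (egen e) 1.

Definition pi1 (T : {set edge A}) : groupType := presented (pi1_rel T).

End FundamentalGroup.

(* The additive group of integers, written multiplicatively. *)
Definition Zgroup : Type := int.
HB.instance Definition _ := Choice.on Zgroup.
HB.instance Definition _ := isGroup.Build Zgroup
  (@GRing.addrA int) (@GRing.add0r int) (@GRing.addr0 int)
  (@GRing.addNr int) (@GRing.addrN int).

Definition infinite_cyclic (G : groupType) : Prop := isomorphic G Zgroup.

Definition is_GBS (G : groupType) : Prop :=
  exists (A : graph_of_groups) (T : {set edge A}),
    [/\ forall v : vertex A, infinite_cyclic (vertex_group v),
        forall e : edge A, infinite_cyclic (edge_group e),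
        spanning_tree T
      & isomorphic G (pi1 T)].

(* < a, t | t a t^-1 = a^-1 > with a = true and t = false. *)
Definition klein_bottle_group : groupType :=
  presented (fun u v : free_group bool =>
    u = free_gen true ^ (free_gen false)^-1 /\ v = (free_gen true)^-1).

Definition elementary (G : groupType) : Prop :=
  [\/ isomorphic G Zgroup, isomorphic G (Zgroup * Zgroup)%type
    | isomorphic G klein_bottle_group].

(* The least common multiple is taken with respect to divisibility: it would be
   0 if the orders of torsion elements were unbounded. *)
Definition is_torsion_lcm (Q : groupType) (m : nat) : Prop :=
  forall d, (m %| d)%N <-> (forall (x : Q) o, has_order x o -> (o %| d)%N).

Definition finite_index (Q : groupType) (H : Q -> Prop) : Prop :=
  exists s : seq Q, forall x, exists2 y, y \in s & H (y^-1 * x).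

Definition has_free_finite_index (Q : groupType) (r : nat) : Prop :=
  exists f : {multiplicative free_of_rank r -> Q},
    injective f /\ finite_index (fun x => exists w, f w = x).

Definition is_kappa (G : groupType) (kappa : nat) : Prop :=
  is_torsion_lcm (quotient_group (center G)) kappa.

Definition is_epsilon (G : groupType) (epsilon : nat) : Prop :=
  has_free_finite_index (quotient_group (center G)) epsilon.+1 /\
  forall r, has_free_finite_index (quotient_group (center G)) r ->
    (epsilon.+1 <= r)%N.

Definition independent (A : groupType) (r : nat) (g : 'I_r -> A) : Prop :=
  forall m : 'I_r -> int, \prod_(i < r) expgz (g i) (m i) = 1 ->
    forall i, m i = 0%R.

(* The torsion-free rank of H_1(G, Z). *)
Definition first_betti (G : groupType) (b : nat) : Prop :=
  (exists g : 'I_b -> abelianization G, independent g) /\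
  forall r (g : 'I_r -> abelianization G), independent g -> (r <= b)%N.

(* Main.v *)
(** A GBS group [G] acts on its Bass-Serre tree, so a homomorphism
    [lam : G -> Z] that is non-zero on the vertex groups has a free kernel, the
    fundamental group of the finite quotient graph.  Such a [lam] exists
    because the modulus of [G] is trivial: were some stable letter to have
    modulus different from 1, Britton's lemma applied to a non-trivial central
    element would make [G] a solvable Baumslag-Solitar group, whose centre is
    trivial unless [G] is a Klein bottle group.  Let [z] generate the centre.
    If [lam] is onto with kernel free of rank [n] and [lam z = k], then [G] is
    the mapping torus of some [Phi] of order [k], and conversely.  The kernel
    embeds in [G/Z] with index [k], so comparing Euler characteristics gives
    [(n - 1) kappa = k epsilon].  Prescribing [lam] on the vertex groups realizes
    [k = m kappa] for any [m], as long as [lam] is onto; this holds for [m = 1],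
    and for every [m] when the graph is not a tree, by sending a stable letter
    to 1.  First Betti number 1 leaves no choice for [lam]. *)

Require Import Defs.
From HB Require Import structures.
From mathcomp Require Import all_boot order ssralg ssrnum ssrint rat intdiv generic_quotient.
From mathcomp Require Import boolp ring zify.

Set Implicit Arguments.
Unset Strict Implicit.
Unset Printing Implicit Defensive.

Import Order.TTheory GRing.Theory Num.Theory.
Local Open Scope group_scope.

Local Open Scope int_scope.
Local Open Scope group_scope.

(** No tree is acted upon. Freeness of the kernel of [lam] comes from two explicit mutually inverse
    maps: edges of the quotient graph outside a spanning tree go to loops in [G], and an action of
    [G] on Z x L, with L free on those edges, reads the letters back. The same device, letting a
    group given by generators and relations act on its expected normal forms, yields reduced words
    in free groups, injectivity of the fibre of a mapping torus, and Britton's lemma. The modulus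
    becomes visible in an affine action on the rationals, where vertex generators translate and
    stable letters scale. Euler characteristics are replaced by a count of cocycles with two values,
    which avoids intersecting two free subgroups. For [m = 1], surjectivity comes from fractions in
    lowest terms: if [a_v ^ n_v = z ^ i_v] and kappa is the lcm of the [n_v], then the heights
    [kappa * i_v / n_v] and the height kappa of [z] have no common divisor. As kappa also divides
    the index of every free subgroup of finite index of G/Z, the smallest rank [epsilon + 1] is
    attained at index kappa. *)

Definition hom_of (G H : groupType) (f : G -> H) (fM : {morph f : x y / x * y}) :
    {multiplicative G -> H} :=
  let fHB := isMultiplicative.Build G H f fM in
  HB.pack_for {multiplicative G -> H} f fHB.

Lemma hom_ofE (G H : groupType) (f : G -> H) (fM : {morph f : x y / x * y}) x :
  hom_of fM x = f x.
Proof. by []. Qed.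

(** * Integer powers, homomorphisms, quotients and presentations *)

Section IntegerPowers.
Variable G : groupType.
Implicit Types (x y : G) (m n : int).

Lemma expgz1 x : expgz x 1%R = x. Proof. by []. Qed.
Lemma expgz0 x : expgz x 0%R = 1. Proof. by []. Qed.

Lemma PoszSr (k : nat) : k.+1%:Z = (k%:Z + 1)%R.
Proof. by rewrite -addn1 PoszD. Qed.

Lemma expgz_succ x m : expgz x (m + 1)%R = expgz x m * x.
Proof.
case: m => n; first by rewrite -PoszSr /= expgSr.
case: n => [|n]; first by rewrite /= mulVg.
have -> : (Negz n.+1 + 1)%R = Negz n by rewrite !NegzE [n.+2%:Z]PoszSr opprD subrK.
by rewrite /= [x ^+ n.+2]expgS invgM mulgVK.
Qed.

Lemma expgz_pred x m : expgz x (m - 1)%R = expgz x m * x^-1.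
Proof. by rewrite -[in RHS](subrK 1%R m) expgz_succ mulgK. Qed.

Lemma expgzD x m n : expgz x (m + n)%R = expgz x m * expgz x n.
Proof.
elim: n => [|n IHn|n IHn]; first by rewrite addr0 mulg1.
  by rewrite PoszSr addrA !expgz_succ IHn mulgA.
by rewrite PoszSr opprD addrA !expgz_pred IHn mulgA.
Qed.

Lemma expgzN x m : expgz x (- m)%R = (expgz x m)^-1.
Proof. by apply/esym/mulg1_eq; rewrite -expgzD subrr. Qed.

Lemma expgzM x m n : expgz x (m * n)%R = expgz (expgz x m) n.
Proof.
elim: n => [|n IHn|n IHn]; first by rewrite mulr0.
  by rewrite PoszSr mulrDr mulr1 !expgzD IHn.
by rewrite PoszSr opprD mulrDr mulrN1 !expgzD IHn !expgzN.
Qed.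

Lemma expgz1n m : expgz (1 : G) m = 1.
Proof. by case: m => n /=; rewrite expg1n ?invg1. Qed.

Lemma commuteXz x y m : commute x y -> commute x (expgz y m).
Proof. by case: m => n xy; [apply: commuteX | apply/commuteV/commuteX]. Qed.

Lemma commute_expgz x m n : commute (expgz x m) (expgz x n).
Proof. by rewrite /commute -!expgzD addrC. Qed.

Lemma expgzMn x y m : commute x y -> expgz (x * y) m = expgz x m * expgz y m.
Proof.
case: m => n xy; rewrite /= expgMn // invgM -!expVgn.
by apply: commuteX2; apply/commute_sym/commuteV/commute_sym/commuteV/commute_sym.
Qed.

Lemma expgzJ x y m : expgz (x ^ y) m = expgz x m ^ y.
Proof. by case: m => n /=; rewrite ?conjVg conjXg. Qed.

End IntegerPowers.

Section Homomorphisms.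
Variables (G H : groupType) (f : {multiplicative G -> H}).

Lemma homM x y : f (x * y) = f x * f y. Proof. exact: gmulfM. Qed.

Lemma hom1 : f 1 = 1.
Proof. by apply: (mulgI (f 1)); rewrite -homM !mulg1. Qed.

Lemma homV x : f x^-1 = (f x)^-1.
Proof. by apply/esym/mulg1_eq; rewrite -homM mulgV hom1. Qed.

Lemma homF x y : f (x / y) = f x / f y.
Proof. by rewrite homM homV. Qed.

Lemma homJ x y : f (x ^ y) = f x ^ f y.
Proof. by rewrite /conjg !homM homV. Qed.

Lemma homXn x n : f (x ^+ n) = f x ^+ n.
Proof. by elim: n => [|n IHn]; rewrite ?hom1 // !expgS homM IHn. Qed.

Lemma homXz x m : f (expgz x m) = expgz (f x) m.
Proof. by case: m => n /=; rewrite ?homV homXn. Qed.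

Lemma hom_inj : (forall x, f x = 1 -> x = 1) -> injective f.
Proof. by move=> fI x y xy; apply/divg1_eq/fI; rewrite homF xy mulgV. Qed.

End Homomorphisms.

(** Maps to Z are bare functions into [int], written additively, rather than morphisms into
    [Zgroup], so that ring arithmetic applies to heights. *)
Definition zhom (G : groupType) (lam : G -> int) : Prop :=
  {morph lam : x y / x * y >-> (x + y)%R}.

Section IntegerMorphism.
Variables (G : groupType) (lam : G -> int).
Hypothesis lamM : zhom lam.

Lemma zhom1 : lam 1 = 0%R.
Proof. by apply: (addrI (lam 1)); rewrite -lamM mulg1 addr0. Qed.

Lemma zhomV x : lam x^-1 = (- lam x)%R.
Proof. by apply: (addrI (lam x)); rewrite -lamM mulgV zhom1 subrr. Qed.

Lemma zhomXn x n : lam (x ^+ n) = (n%:Z * lam x)%R.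
Proof.
elim: n => [|n IHn]; first by rewrite zhom1 mul0r.
by rewrite expgS lamM IHn PoszSr mulrDl mul1r addrC.
Qed.

Lemma zhomXz x m : lam (expgz x m) = (m * lam x)%R.
Proof. by case: m => n /=; rewrite ?zhomV zhomXn ?NegzE ?mulNr. Qed.

Lemma zhomJ x y : lam (x ^ y) = lam x.
Proof. by rewrite /conjg !lamM zhomV addrC addrK. Qed.

End IntegerMorphism.

Section Quotient.
Variables (G : groupType) (N : normal_subgroup G).

Lemma cosetM : {morph coset N : x y / x * y}.
Proof. by move=> x y; rewrite -coset_mul. Qed.

Lemma coset1P x : coset N x = 1 <-> N x.
Proof.
have -> : (coset N x = 1) = (1 = coset N x) by apply/propext; split.
by rewrite [1]/(coset N 1) coset_eqP invg1 mul1g.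
Qed.

HB.instance Definition _ := isMultiplicative.Build G (quotient_group N) (coset N) cosetM.

Lemma coset_surj (u : quotient_group N) : exists x, u = coset N x.
Proof. by exists (repr u); rewrite Defs.reprK. Qed.

Lemma quotient_lift (L : groupType) (f : {multiplicative G -> L}) :
  (forall x, N x -> f x = 1) ->
  exists F : {multiplicative quotient_group N -> L}, forall x, F (coset N x) = f x.
Proof.
move=> fN; pose F (u : quotient_group N) := f (repr u).
have FE x : F (coset N x) = f x.
  have /coset_eqP/fN : coset N (repr (coset N x)) = coset N x by rewrite Defs.reprK.
  by rewrite homM homV => /mulg1_eq; rewrite invgK.
have FM : {morph F : x y / x * y}.
  move=> u v; have [x ->] := coset_surj u; have [y ->] := coset_surj v.
  by rewrite -homM !FE homM.
by exists (hom_of FM) => x; rewrite hom_ofE FE.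
Qed.

End Quotient.

Lemma kernel_normal (G L : groupType) (f : {multiplicative G -> L}) :
  exists N : normal_subgroup G, forall x, N x <-> f x = 1.
Proof.
have K1 : f 1 = 1 by rewrite hom1.
have KF x y : f x = 1 -> f y = 1 -> f (x / y) = 1.
  by move=> fx fy; rewrite homF fx fy divg1.
have KJ x y : f x = 1 -> f (x ^ y) = 1 by move=> fx; rewrite homJ fx conj1g.
by exists (NormalSubgroup K1 KF KJ).
Qed.

Section FreeGroups.
Variable X : choiceType.
Local Notation F := (free_group X).

Lemma of_wordM (s t : seq (X * bool)) : of_word (s ++ t) = of_word s * of_word t :> F.
Proof. by rewrite -of_word_cat. Qed.

Lemma of_wordV (s : seq (X * bool)) : of_word (word_inv s) = (of_word s)^-1 :> F.
Proof. by rewrite -of_word_inv. Qed.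

Lemma of_word_cons x b (s : seq (X * bool)) :
  of_word ((x, b) :: s) = (if b then free_gen x else (free_gen x)^-1) * of_word s :> F.
Proof. by rewrite -cat1s of_wordM; case: b => //; rewrite /free_gen -of_wordV. Qed.

Lemma free_ind (P : F -> Prop) :
  P 1 -> (forall x u, P u -> P (free_gen x * u)) ->
  (forall x u, P u -> P ((free_gen x)^-1 * u)) -> forall u, P u.
Proof.
move=> P1 Pg PV u; rewrite -[u]repr_wordK; elim: (repr u) => [|[x b] s IHs] //.
by rewrite of_word_cons; case: b; [apply: Pg | apply: PV].
Qed.

Lemma free_lift (L : groupType) (f : X -> L) :
  exists g : {multiplicative F -> L}, forall x, g (free_gen x) = f x.
Proof.
pose letter (l : X * bool) := if l.2 then f l.1 else (f l.1)^-1.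
pose ev (s : seq (X * bool)) := \prod_(l <- s) letter l.
have ev_eq s t : freely_equal s t -> ev s = ev t.
  elim=> {s t} // [s t u _ -> _ -> //|s t x b].
  rewrite /ev !big_cat /=; congr (_ * _); rewrite !big_cons /letter /= mulgA.
  by case: b; rewrite /= ?mulgV ?mulVg mul1g.
have evE s : ev (repr (of_word s : F)) = ev s.
  by apply/ev_eq/of_wordP; rewrite repr_wordK.
have gM : {morph (fun u : F => ev (repr u)) : u v / u * v}.
  by move=> u v; rewrite evE /ev big_cat.
exists (hom_of gM) => x; rewrite hom_ofE evE /ev big_cons big_nil mulg1 //.
Qed.

End FreeGroups.

Lemma free_hom_ext (X : choiceType) (L : groupType)
    (f g : {multiplicative free_group X -> L}) :
  (forall x, f (free_gen x) = g (free_gen x)) -> f =1 g.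
Proof.
move=> fg; elim/free_ind => [|x u IHu|x u IHu]; first by rewrite !hom1.
  by rewrite !homM fg IHu.
by rewrite !homM !homV fg IHu.
Qed.

Section Presented.
Variables (X : choiceType) (R : free_group X -> free_group X -> Prop).

Definition pgen (x : X) : presented R := coset _ (free_gen x).

Definition pcoset (u : free_group X) : presented R := coset _ u.
HB.instance Definition _ :=
  isMultiplicative.Build (free_group X) (presented R) pcoset (cosetM _).

Lemma pcosetE x : pcoset (free_gen x) = pgen x. Proof. by []. Qed.

Lemma presented_rel u v : R u v -> pcoset u = pcoset v.
Proof.
move=> Ruv; apply: divg1_eq; rewrite -homF.
by apply/coset1P => N; apply; exists u, v.
Qed.

Lemma presented_ind (P : presented R -> Prop) :
  P 1 -> (forall x u, P u -> P (pgen x * u)) ->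
  (forall x u, P u -> P ((pgen x)^-1 * u)) -> forall u, P u.
Proof.
move=> P1 Pg PV u; have [w ->] := coset_surj u; rewrite -/(pcoset w).
elim/free_ind: w => [|x w IHw|x w IHw]; first by rewrite hom1.
  by rewrite homM; apply: Pg.
by rewrite homM homV; apply: PV.
Qed.

Lemma presented_lift (L : groupType) (f : {multiplicative free_group X -> L}) :
  (forall u v, R u v -> f u = f v) ->
  exists F : {multiplicative presented R -> L}, forall u, F (pcoset u) = f u.
Proof.
move=> fR; apply: quotient_lift => x Nx.
have [N NP] := kernel_normal f; apply/NP/Nx => _ [u [v [Ruv ->]]].
by apply/NP; rewrite homF (fR _ _ Ruv) mulgV.
Qed.

End Presented.

(** * The group of permutations of a type *)

Section Permutations.
Variable X : Type.

(** Target of the homomorphisms that turn a presented group into a group of transformations: it is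
    enough to give permutations for the generators and check the relations. The inverse is stored so
    that it can be computed with. *)
Record perm_of := Perm {
  pfun :> X -> X;
  pinv : X -> X;
  pfunK : cancel pfun pinv;
  pinvK : cancel pinv pfun
}.

HB.instance Definition _ := gen_eqMixin perm_of.
HB.instance Definition _ := gen_choiceMixin perm_of.

Lemma perm_ext (a b : perm_of) : a =1 b -> a = b.
Proof.
case: a b => [f f' fK f'K] [g g' gK g'K] /= /funext fg; case: _ / fg in gK g'K *.
have f'g' : f' = g' by apply/funext => x; rewrite -{1}[x]g'K fK.
by case: _ / f'g' in gK g'K *; congr Perm; apply: Prop_irrelevance.
Qed.

Definition perm_id : perm_of := @Perm id id (fun=> erefl) (fun=> erefl).

Lemma perm_comp_subproof (a b : perm_of) : cancel (a \o b) (pinv b \o pinv a).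
Proof. by move=> x /=; rewrite !pfunK. Qed.
Lemma perm_comp_subproof2 (a b : perm_of) : cancel (pinv b \o pinv a) (a \o b).
Proof. by move=> x /=; rewrite !pinvK. Qed.

Definition perm_comp (a b : perm_of) : perm_of :=
  Perm (@perm_comp_subproof a b) (@perm_comp_subproof2 a b).
Definition perm_inv (a : perm_of) : perm_of := Perm (@pinvK a) (@pfunK a).

Lemma perm_compA : associative perm_comp.
Proof. by move=> a b c; apply: perm_ext. Qed.
Lemma perm_comp1 : left_id perm_id perm_comp.
Proof. by move=> a; apply: perm_ext. Qed.
Lemma perm_1comp : right_id perm_id perm_comp.
Proof. by move=> a; apply: perm_ext. Qed.
Lemma perm_compV : left_inverse perm_id perm_inv perm_comp.
Proof. by move=> a; apply: perm_ext => x /=; rewrite pfunK. Qed.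
Lemma perm_Vcomp : right_inverse perm_id perm_inv perm_comp.
Proof. by move=> a; apply: perm_ext => x /=; rewrite pinvK. Qed.

HB.instance Definition _ := isGroup.Build perm_of
  perm_compA perm_comp1 perm_1comp perm_compV perm_Vcomp.

Lemma permM (a b : perm_of) x : (a * b) x = a (b x). Proof. by []. Qed.
Lemma perm1 x : (1 : perm_of) x = x. Proof. by []. Qed.
Lemma permVE (a : perm_of) x : a^-1 x = pinv a x. Proof. by []. Qed.
Lemma permKV (a : perm_of) x : a (a^-1 x) = x. Proof. exact: pinvK. Qed.
Lemma permVK (a : perm_of) x : a^-1 (a x) = x. Proof. exact: pfunK. Qed.

End Permutations.

(** * Free groups *)

Section ReducedWords.
Variable X : choiceType.
Implicit Types (l m : X * bool) (w : seq (X * bool)).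
Local Notation F := (free_group X).

Definition linv l := (l.1, ~~ l.2).

Lemma linvK : involutive linv.
Proof. by case=> x b; rewrite /linv /= negbK. Qed.

Definition noncancel l m := m != linv l.

Lemma noncancel_sym l m : noncancel l m = noncancel m l.
Proof. by rewrite /noncancel eq_sym (inv_eq linvK). Qed.

Definition reduced w := sorted noncancel w.

Definition cons_letter l w :=
  if w is m :: w' then if m == linv l then w' else l :: w else [:: l].

Lemma reduced_cons_letter l w : reduced w -> reduced (cons_letter l w).
Proof.
case: w => [|m w] //= wP; case: ifP => [_|/negbT nc]; first exact: path_sorted wP.
by rewrite /= /noncancel nc.
Qed.

Lemma cons_letterK l w : reduced w -> cons_letter (linv l) (cons_letter l w) = w.
Proof.
case: w => [|m w] /=; first by rewrite linvK eqxx.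
case: (m =P linv l) => [-> | _ _]; last by rewrite /= linvK eqxx.
by case: w => [|m' w] //= /andP[]; rewrite /noncancel linvK => /negPf->.
Qed.

Definition reduced_word := {w : seq (X * bool) | reduced w}.

Definition letter_act l (w : reduced_word) : reduced_word :=
  exist _ (cons_letter l (val w)) (reduced_cons_letter l (valP w)).

Lemma letter_actK l : cancel (letter_act l) (letter_act (linv l)).
Proof. by move=> w; apply: val_inj; apply: cons_letterK (valP w). Qed.

Lemma letter_actVK l : cancel (letter_act (linv l)) (letter_act l).
Proof. by move=> w; have := letter_actK (linv l) w; rewrite linvK. Qed.

(** Van der Waerden's trick: the letters permute the reduced words by [cons_letter], so the free
    group acts on them, and the normal form of [u] is the image of the empty word. *)
Lemma exists_normal_form : exists nf : F -> seq (X * bool),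
  (forall w, reduced w -> nf (of_word w) = w) /\
  (forall u, reduced (nf u) /\ of_word (nf u) = u).
Proof.
pose act x : perm_of reduced_word := Perm (@letter_actK (x, true)) (@letter_actVK (x, true)).
have [f fE] := free_lift act; pose e : reduced_word := exist _ [::] isT.
have fl l (w : reduced_word) : val (f (of_word [:: l]) w) = cons_letter l (val w).
  case: l => x []; first by rewrite (fE x : f (of_word [:: (x, true)]) = _).
  by rewrite of_word_cons mulg1 homV fE.
exists (fun u => val (f u e)); split=> [|u].
  elim=> [|l w IHw] wP; first by rewrite (hom1 f : f (of_word [::]) = 1).
  rewrite -cat1s of_wordM homM permM fl IHw; last exact: path_sorted wP.
  by case: w wP {IHw} => [|m w] //= /andP[/negPf->].
split; first exact: valP.
have flw l (w : reduced_word) :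
    of_word (val (f (of_word [:: l]) w)) = of_word [:: l] * of_word (val w) :> F.
  rewrite fl; case: (val w) => [|m w'] /=; first by rewrite mulg1.
  case: eqP => [->|_]; last by rewrite -of_wordM.
  by rewrite -of_wordM; case: l => y []; rewrite !of_word_cons /= mulgA ?mulgV ?mulVg mul1g.
have genE x : free_gen x = of_word [:: (x, true)] :> F by [].
have genVE x : (free_gen x)^-1 = of_word [:: (x, false)] :> F by rewrite of_word_cons mulg1.
elim/free_ind: u => [|x u IHu|x u IHu]; first by rewrite hom1.
  by rewrite homM permM genE flw IHu.
by rewrite homM permM genVE flw IHu.
Qed.

Lemma of_word_reduced_inj w w' :
  reduced w -> reduced w' -> of_word w = of_word w' :> F -> w = w'.
Proof.
by have [nf [nfE _]] := exists_normal_form => wP w'P /(congr1 nf); rewrite !nfE.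
Qed.

Lemma exists_reduced (u : F) : exists2 w, reduced w & u = of_word w.
Proof. by have [nf [_ /(_ u)[? <-]]] := exists_normal_form; exists (nf u). Qed.

Lemma free_gen_neq1 x : free_gen x <> 1 :> F.
Proof. by move=> /(@of_word_reduced_inj [:: (x, true)] [::] isT isT). Qed.

Lemma of_word1V l : of_word [:: linv l] = (of_word [:: l])^-1 :> F.
Proof. by rewrite -of_wordV. Qed.

(** If [z] had a non-empty reduced word, a letter [m] different from its first letter and cancelling
    at neither end would make [m z] and [z m] two reduced words with different first letters. The
    second generator leaves room for such an [m], whose sign avoids the last letter. *)
Lemma free_center1 (x y : X) (z : F) : x <> y -> (forall u, commute z u) -> z = 1.
Proof.
move=> xy zC; have [[|l w] lwP zE] := exists_reduced z; first by rewrite zE.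
suff [m [lm lm' ml]] : exists m, [/\ m != l, m != linv l & m != linv (last l w)].
  have e : of_word (m :: l :: w) = of_word (rcons (l :: w) m) :> F.
    by rewrite -cat1s -cats1 !of_wordM -zE zC.
  have [ml' _] : m :: l :: w = rcons (l :: w) m.
    apply: of_word_reduced_inj e; first by rewrite /= noncancel_sym /noncancel lm'.
    by rewrite /= rcons_path /noncancel ml andbT.
  by rewrite ml' eqxx in lm.
have [v vl] : exists v, v != l.1.
  by case: (eqVneq x l.1) => [<-|]; [exists y; apply/eqP => /esym | exists x].
pose b := (v, true) == linv (last l w).
exists (v, ~~ b); split; rewrite ?/b.
- by apply: contra_neq vl => <-.
- by apply: contra_neq vl => /(congr1 fst).
by case E: ((v, true) == _); [rewrite -(eqP E) xpair_eqE andbF | rewrite E].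
Qed.

(** Either the first and last letters cancel, and conjugation gives a shorter torsion word, or the
    word is cyclically reduced and its powers are reduced by mere concatenation. *)
Lemma free_torsion_free k (u : F) : 0 < k -> u ^+ k = 1 -> u = 1.
Proof.
move=> k_gt0; have [w wP ->] := exists_reduced u.
have [n] := ubnP (size w); elim: n w wP => // n IHn [|l w] //= lwP lt_n uk.
case: (eqVneq l (linv (last l w))) => [lE | ncl].
  case/lastP: w lwP lt_n uk lE => [|w m] lwP lt_n uk.
    by case: (l) => a [] /= [].
  rewrite last_rcons => lE; rewrite size_rcons in lt_n.
  have wP : reduced w.
    by move: lwP; rewrite /= rcons_path => /andP[/path_sorted].
  have wE : of_word (l :: rcons w m) = of_word w ^ (of_word [:: m]) :> F.
    rewrite -cat1s -cats1 !of_wordM lE of_word1V //.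
  have w1 : of_word w = 1 :> F.
    apply: IHn => //; first by move: lt_n; rewrite ltnS => /ltnW.
    by apply/eqP; rewrite -(conjg_eq1 _ (of_word [:: m])) conjXg -wE uk.
  by rewrite wE w1 conj1g.
have fP i : reduced (flatten (nseq i.+1 (l :: w))).
  elim: i => [|i IHi]; first by rewrite /= cats0.
  by rewrite /= cat_path lwP /= /noncancel {1}ncl.
have fE i : of_word (flatten (nseq i (l :: w))) = of_word (l :: w) ^+ i :> F.
  by elim: i => [|i IHi] //; rewrite expgS -IHi -of_wordM.
move: uk; rewrite -(prednK k_gt0) -fE => /(of_word_reduced_inj (fP _) (isT : reduced [::])).
by [].
Qed.

End ReducedWords.

Lemma free_group_rank (X : finType) :
  exists f : {multiplicative free_of_rank #|X| -> free_group X}, bijective f.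
Proof.
have [f fE] := free_lift (fun i : 'I_#|X| => free_gen (enum_val i)).
have [g gE] := free_lift (fun x : X => free_gen (enum_rank x)).
exists f; exists g.
  apply: (free_hom_ext (f := g \o f) (g := idfun)) => i.
  by rewrite /= fE gE enum_valK.
apply: (free_hom_ext (f := f \o g) (g := idfun)) => i.
by rewrite /= gE fE enum_rankK.
Qed.

Lemma free_rank0 (u : free_of_rank 0) : u = 1.
Proof. by elim/free_ind: u => // -[]. Qed.

Lemma free_rank1 (u : free_of_rank 1) : exists m, u = expgz (free_gen ord0) m.
Proof.
elim/free_ind: u => [|x u [m ->]|x u [m ->]]; first by exists 0%R.
  by exists (1 + m)%R; rewrite expgzD expgz1 ord1.
by exists (-1 + m)%R; rewrite expgzD ord1.
Qed.

Lemma torsion_free_expgz (G : groupType) (x : G) (m : int) :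
  (forall k, 0 < k -> x ^+ k = 1 -> x = 1) -> expgz x m = 1 -> m = 0%R \/ x = 1.
Proof.
move=> tf; case: m => [[|n]|n]; [by left | by move=> /tf; right; auto |].
by move=> /eqP; rewrite /= invg_eq1 => /eqP/tf; right; auto.
Qed.

Lemma free_rank_center1 r (z : free_of_rank r) :
  1 < r -> (forall u, commute z u) -> z = 1.
Proof.
case: r z => [|[|r]] z // _; apply: (@free_center1 _ ord0 (lift ord0 ord0)).
by move=> /(congr1 val).
Qed.

(** * Mapping tori and fibrations over Z *)

Lemma inj_surj_bijective (A B : Type) (f : A -> B) :
  injective f -> (forall y, exists x, f x = y) -> bijective f.
Proof.
move=> f_inj f_surj; have [g gE] := choice f_surj.
by exists g => // x; apply: f_inj; rewrite gE.
Qed.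

Lemma isomorphic_sym (G H : groupType) : isomorphic G H -> isomorphic H G.
Proof.
move=> [f [g fK gK]].
have gM : {morph g : x y / x * y}.
  by move=> x y; rewrite -{1}[x]gK -{1}[y]gK -homM fK.
by exists (hom_of gM); exists f.
Qed.

Lemma isomorphic_of_hom (G H : groupType) (f : {multiplicative G -> H}) :
  (forall x, f x = 1 -> x = 1) -> (forall y, exists x, f x = y) -> isomorphic G H.
Proof.
by move=> f1 f_surj; exists f; apply: inj_surj_bijective => //; apply: hom_inj.
Qed.

(** A short exact sequence from the free group of rank [r] through [G] to Z, with [psi] the
    inclusion of the fibre and [lam] the height. *)
Definition fibered (G : groupType) (r : nat) (lam : G -> int)
    (psi : {multiplicative free_of_rank r -> G}) : Prop :=
  [/\ zhom lam, exists t, lam t = 1%R, injective psi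
    & forall x, lam x = 0%R <-> exists w, psi w = x].

Lemma zhom_surj (G : groupType) (lam : G -> int) t (m : int) :
  zhom lam -> lam t = 1%R -> lam (expgz t m) = m.
Proof. by move=> lamM lt; rewrite zhomXz // lt mulr1. Qed.

Lemma fibered_conj (G : groupType) r lam (psi : {multiplicative free_of_rank r -> G}) w x :
  fibered lam psi -> exists w', psi w' = psi w ^ x.
Proof.
by case=> lamM _ _ ker; apply/ker; rewrite zhomJ //; apply/ker; exists w.
Qed.

Lemma fibered_torsion_free (G : groupType) r lam
    (psi : {multiplicative free_of_rank r -> G}) k (x : G) :
  fibered lam psi -> 0 < k -> x ^+ k = 1 -> x = 1.
Proof.
case=> lamM _ psi_inj ker k_gt0 xk.
have /ker[w wx] : lam x = 0%R.
  have /eqP := zhomXn lamM x k; rewrite xk zhom1 // eq_sym mulf_eq0 => /orP[] /eqP //.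
  by case: k k_gt0 {xk}.
suff w1 : w = 1 by rewrite -wx w1 hom1.
by apply: (free_torsion_free k_gt0); apply: psi_inj; rewrite homXn wx xk hom1.
Qed.

Lemma fibered0_elementary (G : groupType) lam
    (psi : {multiplicative free_of_rank 0 -> G}) : fibered lam psi -> elementary G.
Proof.
case=> lamM [t lt] psi_inj ker; apply: Or31.
have lamM' : {morph (lam : G -> Zgroup) : x y / x * y} by move=> x y; apply: lamM.
apply: (isomorphic_of_hom (f := hom_of lamM')) => [x /ker[w <-]|m].
  by rewrite [w]free_rank0 hom1.
by exists (expgz t m); apply: zhom_surj.
Qed.

Section FiberRankOne.
Variables (G : groupType) (lam : G -> int) (psi : {multiplicative free_of_rank 1 -> G}).
Variable t : G.
Hypotheses (fib : fibered lam psi) (lt : lam t = 1%R).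

Let c := psi (free_gen ord0).

Let lamM : zhom lam. Proof. by case: fib. Qed.

Let lamc : lam c = 0%R.
Proof. by case: fib => _ _ _ ker; apply/ker; exists (free_gen ord0). Qed.

Let kerc x : lam x = 0%R -> exists m, x = expgz c m.
Proof.
case: fib => _ _ _ ker /ker[w <-]; have [m ->] := free_rank1 w.
by exists m; rewrite homXz.
Qed.

Let c_inj m n : expgz c m = expgz c n -> m = n.
Proof.
move=> cmn; apply/eqP; rewrite -subr_eq0; apply/eqP.
have /torsion_free_expgz[] // : expgz c (m - n)%R = 1.
- by rewrite expgzD expgzN cmn mulgV.
- by move=> k; apply: fibered_torsion_free fib.
case: fib => _ _ psi_inj _ c1; case: (@free_gen_neq1 _ (ord0 : 'I_1)).
by apply: psi_inj; rewrite -/c c1 hom1.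
Qed.

Let ctE x : exists i j, x = expgz c i * expgz t j.
Proof.
have /kerc[i xE] : lam (x * expgz t (- lam x)%R) = 0%R.
  by rewrite lamM zhom_surj // subrr.
by exists i, (lam x); rewrite -xE expgzN mulgVK.
Qed.

Let ct1 i j : expgz c i * expgz t j = 1 -> i = 0%R /\ j = 0%R.
Proof.
move=> ct; have j0 : j = 0%R.
  by have := congr1 lam ct; rewrite lamM !zhomXz // lamc lt mulr0 add0r mulr1 zhom1.
by split=> //; apply: c_inj; rewrite [RHS]expgz0 -ct j0 expgz0 mulg1.
Qed.

(** The kernel is infinite cyclic, generated by [c], and conjugation by [t] acts on it through a
    unit of Z: 1 gives Z^2 and -1 the Klein bottle group. *)
Lemma fibered1_elementary : elementary G.
Proof.
have [e cte] : exists e, c ^ t = expgz c e by apply: kerc; rewrite zhomJ.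
have [e' cte'] : exists e, c ^ t^-1 = expgz c e by apply: kerc; rewrite zhomJ.
have /eqP : (e * e')%R = 1%R.
  by apply: c_inj; rewrite mulrC expgzM -cte' expgzJ -cte -conjgM mulgV conjg1.
rewrite mulrC => ee'; have : e \is a GRing.unit by apply/unitrPr; exists e'; rewrite mulrC; apply/eqP.
rewrite -[_ \is a _]/((e == 1%R) || (e == -1)%R) => /orP[]/eqP e1; rewrite {}e1 in cte.
- apply: Or32; apply: isomorphic_sym.
  have ct : commute c t by rewrite /commute conjgC cte.
  pose f (u : (Zgroup * Zgroup)%type) := expgz c u.1 * expgz t u.2.
  have fM : {morph f : u v / u * v}.
    case=> i j [i' j']; rewrite /f /=.
    rewrite (expgzD c i i') (expgzD t j j') -!mulgA; congr (_ * _); rewrite !mulgA.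
    by congr (_ * _); apply/commuteXz/commute_sym/commuteXz.
  apply: (isomorphic_of_hom (f := hom_of fM)) => [[i j]|x].
    by move=> /ct1[/= -> ->].
  by have [i [j ->]] := ctE x; exists (i, j).
apply: Or33; apply: isomorphic_sym.
have [F FE] := free_lift (fun b : bool => if b then c else t).
have [] := @presented_lift _ (fun u v : free_group bool =>
    u = free_gen true ^ (free_gen false)^-1 /\ v = (free_gen true)^-1) _ F.
  move=> _ _ [-> ->]; rewrite homJ !homV !FE.
  by apply: (conjg_inj t); rewrite conjgKV conjVg cte /= expg1 invgK.
move=> f fE; pose a : klein_bottle_group := pgen _ true; pose s : klein_bottle_group := pgen _ false.
have fa : f a = c by rewrite [a]/(pcoset _ _) fE FE.
have fs : f s = t by rewrite [s]/(pcoset _ _) fE FE.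
have asV : a ^ s^-1 = a^-1.
  by rewrite /a /s -!pcosetE -!homV -homJ; apply: presented_rel.
have as_ : a ^ s = a^-1.
  by apply: (conjg_inj s^-1); rewrite conjgK conjVg asV invgK.
(* Elements of the presented group are brought to the form [a^i s^j]; their images [c^i t^j] are
   trivial only for [i = j = 0], which makes [f] injective. *)
have kE (u : klein_bottle_group) : exists i j, u = expgz a i * expgz s j.
  elim/presented_ind: u => [|b u [i [j ->]]|b u [i [j ->]]].
  - by exists 0%R, 0%R; rewrite mulg1.
  - case: b; [exists (1 + i)%R, j | exists (- i)%R, (1 + j)%R]; rewrite !expgzD.
      by rewrite expgz1 mulgA.
    rewrite expgz1 !mulgA; congr (_ * _); rewrite -/s conjgCV -expgzJ asV.
    by congr (_ * _); rewrite expgzN -[a^-1]/(expgz a (-1)) -expgzM mulN1r expgzN.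
  case: b; [exists (-1 + i)%R, j | exists (- i)%R, (-1 + j)%R]; rewrite !expgzD.
    by rewrite mulgA.
  rewrite !mulgA; congr (_ * _); rewrite -/s conjgCV invgK -expgzJ as_.
  by congr (_ * _); rewrite expgzN -[a^-1]/(expgz a (-1)) -expgzM mulN1r expgzN.
apply: (isomorphic_of_hom (f := f)) => [u|x].
  by have [i [j ->]] := kE u; rewrite homM !homXz fa fs => /ct1[-> ->]; rewrite mulg1.
have [i [j ->]] := ctE x; exists (expgz a i * expgz s j).
by rewrite homM !homXz fa fs.
Qed.

End FiberRankOne.

Lemma fibered_rank_gt1 (G : groupType) r lam (psi : {multiplicative free_of_rank r -> G}) :
  fibered lam psi -> ~ elementary G -> 1 < r.
Proof.
case: r psi => [|[|r]] psi fib // nel; case: nel; first exact: fibered0_elementary fib.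
by case: (fib) => _ [t lt] _ _; apply: fibered1_elementary fib lt.
Qed.

Section MappingTorus.
Variables (H : groupType) (a : automorphism H).
Local Notation M := (mapping_torus a).

Definition torus_fiber_gen (g : H) : M := pgen _ (Some g).
Definition torus_stable : M := pgen _ None.

Lemma torus_fiberM : {morph torus_fiber_gen : g h / g * h}.
Proof.
move=> g h; rewrite /torus_fiber_gen -!pcosetE -homM; apply/esym/presented_rel.
by constructor.
Qed.

Definition torus_iota : {multiplicative H -> M} := hom_of torus_fiberM.

Lemma torus_iotaE g : torus_iota g = pgen _ (Some g). Proof. by []. Qed.

Lemma torus_conj g : torus_iota g ^ torus_stable = torus_iota (a g).
Proof.
rewrite !torus_iotaE /torus_stable -!pcosetE -homJ; apply: presented_rel.
by constructor.
Qed.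

Lemma autXz_conj (G : groupType) (psi : {multiplicative H -> G}) t (b : automorphism H) :
  (forall g, psi g ^ t = psi (b g)) ->
  forall m g, psi g ^ expgz t m = psi (aut_fun (expgz b m) g).
Proof.
move=> psit; elim=> [|n IHn|n IHn] g; first by rewrite conjg1.
  rewrite PoszSr addrC !expgzD expgz1 -[aut_fun (_ * _) g]/(b _).
  rewrite -psit -IHn -conjgM; congr (_ ^ _).
  exact/commuteXz/commute_refl.
rewrite PoszSr opprD addrC !expgzD -[aut_fun (_ * _) g]/(aut_inv b _).
have psitV h : psi h ^ t^-1 = psi (aut_inv b h).
  by apply: (conjg_inj t); rewrite conjgKV psit [b _]inv_funVK.
rewrite -psitV -IHn -conjgM; congr (_ ^ _).
exact: (commute_expgz t (-1)%R).
Qed.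

Lemma torus_ind (P : M -> Prop) :
  P 1 -> (forall g u, P u -> P (torus_iota g * u)) ->
  (forall u, P u -> P (torus_stable * u)) ->
  (forall u, P u -> P (torus_stable^-1 * u)) -> forall u, P u.
Proof.
move=> P1 Pg Pt PtV; elim/presented_ind=> // -[g|] u; [exact: Pg|exact: Pt| |exact: PtV].
by rewrite -torus_iotaE -homV; apply: Pg.
Qed.

Lemma torus_height : exists tau : M -> int,
  [/\ zhom tau, forall g, tau (torus_iota g) = 0%R & tau torus_stable = 1%R].
Proof.
have [F FE] := free_lift (fun x : option H => (if x is Some _ then 0%R else 1%R) : Zgroup).
have [] := @presented_lift _ (mapping_torus_rel a) _ F.
  move=> _ _ [g h|g]; first by rewrite homM !FE; apply: add0r.
  by rewrite homJ !FE.
move=> f fE; exists f; split=> [x y|g|]; first exact: (homM f x y).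
  by rewrite torus_iotaE [pgen _ _]/(pcoset _ _) fE FE.
by rewrite [torus_stable]/(pcoset _ _) fE FE.
Qed.

(* The torus acts on H x Z as on its elements t^i g. *)
Lemma torus_iota_inj : injective torus_iota.
Proof.
pose fib g (u : H * int) := (aut_fun (expgz a u.2) g * u.1, u.2).
have fibK g : cancel (fib g) (fib g^-1).
  by case=> x i; rewrite /fib /= autV mulKg.
have fibVK g : cancel (fib g^-1) (fib g) by move=> u; rewrite -{1}[g]invgK fibK.
pose shift m (u : H * int) := (u.1, (u.2 + m)%R).
have shiftK m : cancel (shift m) (shift (- m)%R).
  by case=> x i; rewrite /shift /= addrK.
have shiftVK m : cancel (shift (- m)%R) (shift m).
  by move=> u; rewrite -{1}[m]opprK shiftK.
have [F FE] := free_lift (fun x : option H => if x is Some g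
  then Perm (fibK g) (fibVK g) else Perm (shiftK 1%R) (shiftVK 1%R)).
have [] := @presented_lift _ (mapping_torus_rel a) _ F.
  move=> _ _ [g h|g].
    rewrite homM !FE; apply: perm_ext => -[x i].
    by rewrite permM /= /fib /= autM mulgA.
  rewrite homJ !FE; apply: perm_ext => -[x i].
  rewrite /conjg !permM permVE /= /fib /shift /= addrK; congr (_ * _, _).
  by rewrite expgzD expgz1.
move=> f fE; apply: hom_inj => g /(congr1 f); rewrite hom1 torus_iotaE.
rewrite -[pgen _ _]/(pcoset _ _) fE FE => /(congr1 (fun p : perm_of _ => p (1, 0%R))).
by rewrite perm1 /= /fib /= mulg1 => -[].
Qed.

Lemma torus_decomp u : exists m g, u = expgz torus_stable m * torus_iota g.
Proof.
elim/torus_ind: u => [|h u [m [g ->]]|u [m [g ->]]|u [m [g ->]]].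
- by exists 0%R, 1; rewrite hom1 mulg1.
- exists m, (aut_fun (expgz a m) h * g); rewrite homM -(autXz_conj torus_conj) mulgA.
  by rewrite [RHS]mulgA -conjgC.
- by exists (1 + m)%R, g; rewrite expgzD expgz1 mulgA.
by exists (-1 + m)%R, g; rewrite expgzD mulgA.
Qed.

End MappingTorus.

Lemma torus_fibered n (a : automorphism (free_of_rank n)) :
  exists tau : mapping_torus a -> int,
    fibered tau (torus_iota a) /\ tau (torus_stable a) = 1%R.
Proof.
have [tau [tauM tau_iota tau_t]] := torus_height a; exists tau; split=> //.
split=> [//||| x]; first by exists (torus_stable a).
  exact: torus_iota_inj.
split=> [x0|[w <-]]; last exact: tau_iota.
have [m [g xE]] := torus_decomp x; exists g.
by move: x0; rewrite xE tauM tau_iota addr0 zhom_surj // => ->; rewrite mul1g.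
Qed.

(** In both groups an element is a power of the stable letter times an element of the fibre, and the
    height reads off the power; so the natural map from the torus is bijective. *)
Lemma fibered_torus (G : groupType) n lam (psi : {multiplicative free_of_rank n -> G})
    (a : automorphism (free_of_rank n)) t :
  fibered lam psi -> lam t = 1%R -> (forall w, psi w ^ t = psi (a w)) ->
  isomorphic G (mapping_torus a).
Proof.
move=> [lamM _ psi_inj ker] lt psit; apply: isomorphic_sym.
have [F FE] := free_lift (fun x => if x is Some w then psi w else t).
have [] := @presented_lift _ (mapping_torus_rel a) _ F.
  by move=> _ _ [g h|g]; rewrite ?homJ ?homM !FE ?homM ?psit.
move=> f fE.
have f_iota w : f (torus_iota a w) = psi w.
  by rewrite torus_iotaE -[pgen _ _]/(pcoset _ _) fE FE.
have f_t : f (torus_stable a) = t by rewrite [torus_stable a]/(pcoset _ _) fE FE.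
apply: (isomorphic_of_hom (f := f)) => [u|x].
  have [m [g ->]] := torus_decomp u; rewrite homM homXz f_t f_iota => fu.
  have m0 : m = 0%R.
    have := congr1 lam fu; rewrite lamM zhomXz // lt mulr1 zhom1 //.
    by have -> : lam (psi g) = 0%R by [apply/ker; exists g]; rewrite addr0.
  move: fu; rewrite m0 !mul1g => fu.
  by have -> : g = 1 by [apply: psi_inj; rewrite fu hom1]; rewrite hom1.
have /ker[w wE] : lam (expgz t (- lam x)%R * x) = 0%R.
  by rewrite lamM zhom_surj // addNr.
exists (expgz (torus_stable a) (lam x) * torus_iota a w).
by rewrite homM homXz f_t f_iota wE expgzN mulVKg.
Qed.

Lemma commute_conj (G : groupType) (x y z : G) : commute x y -> commute (x ^ z) (y ^ z).
Proof. by move=> xy; rewrite /commute -!conjMg xy. Qed.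

Lemma conj_commute (G : groupType) (x y : G) : commute x y <-> x ^ y = x.
Proof.
by split=> [xy | xy]; [rewrite /conjg xy mulKg | rewrite /commute conjgC xy].
Qed.

Lemma centerXz (G : groupType) (z : G) m : in_center z -> in_center (expgz z m).
Proof. by move=> zC x; apply/commute_sym/commuteXz/commute_sym/zC. Qed.

Lemma centerM (G : groupType) (y z : G) : in_center y -> in_center z -> in_center (y * z).
Proof.
by move=> yC zC x; apply/commute_sym/commuteM; apply/commute_sym; [apply: yC | apply: zC].
Qed.

(** * The centre of a fibred group and the order of its monodromy *)

Section FiberedCenter.
Variables (G : groupType) (r : nat) (lam : G -> int).
Variable psi : {multiplicative free_of_rank r -> G}.
Hypotheses (fib : fibered lam psi) (r_gt1 : 1 < r).

Let lamM : zhom lam. Proof. by case: fib. Qed.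

Lemma fibered_centralizer1 y :
  lam y = 0%R -> (forall w, commute y (psi w)) -> y = 1.
Proof.
case: fib => _ _ psi_inj ker /ker[v <-] vC.
rewrite (free_rank_center1 (z := v) r_gt1) ?hom1 // => u.
by apply: psi_inj; rewrite !homM vC.
Qed.

Lemma fibered_center_inj y : in_center y -> lam y = 0%R -> y = 1.
Proof. by move=> yC y0; apply: fibered_centralizer1 => // w; apply: yC. Qed.

(** For every [x], the element [y^-1 * y ^ x] has height 0 and still centralizes the fibre, which is
    normal and has trivial centre; so it is 1. *)
Lemma fibered_centralizer y : (forall w, commute y (psi w)) -> in_center y.
Proof.
move=> yC x; apply/conj_commute; suff : y^-1 * y ^ x = 1 by move/mulg1_eq; rewrite invgK.
apply: fibered_centralizer1 => [|w]; first by rewrite lamM zhomV // zhomJ // addNr.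
apply/commute_sym/commuteM; first exact/commuteV/commute_sym/yC.
have [w' w'E] := fibered_conj w x^-1 fib.
by apply/commute_sym; rewrite -[psi w](conjgKV x) -w'E; apply/commute_conj/yC.
Qed.

(** The height is injective on the centre, which is therefore generated by a central element of
    least positive height. *)
Lemma fibered_center_cyclic :
  (exists z : G, in_center z /\ z <> 1) ->
  exists (z : G) (k : nat), [/\ in_center z, 0 < k, lam z = k%:Z
    & forall y, in_center y -> exists i, y = expgz z i].
Proof.
move=> [z0 [z0C z01]].
pose P k := (0 < k) && `[< exists2 z, in_center z & lam z = k%:Z >].
have exP : exists k, P k.
  have l0 : lam z0 != 0%R by apply/eqP => /(fibered_center_inj z0C).
  exists `|lam z0|%N; rewrite /P absz_gt0 l0; apply/asboolP.
  have zV := zhomV lamM z0; case zE: (lam z0) => [n|n]; first by exists z0.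
  by exists (z0^-1); [apply: (@centerXz _ _ (-1)) | rewrite zV zE NegzE opprK].
have [k /andP[k_gt0 /asboolP[z zC zk]] kmin] := ex_minnP exP.
exists z, k; split=> // y yC; exists (lam y %/ k)%Z.
set q := (_ %/ _)%Z; apply: divg1_eq; rewrite -expgzN.
have wC : in_center (y * expgz z (- q)%R) by apply: centerM => //; apply: centerXz.
apply: fibered_center_inj => //.
have kn0 : k%:Z != 0%R by rewrite -lt0n.
have le : lam (y * expgz z (- q)%R) = (lam y %% k)%Z.
  rewrite lamM zhomXz // zk mulNr; apply/eqP; rewrite subr_eq addrC.
  by rewrite -divz_eq.
rewrite le; have := modz_ge0 (lam y) kn0; have := ltz_pmod (lam y) (d := k%:Z).
case: (_ %% _)%Z le => // -[|j] // le /(_ k_gt0) lt_jk _.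
suff : k <= j.+1 by rewrite leqNgt -ltz_nat lt_jk.
by apply: kmin; apply/asboolP; exists (y * expgz z (- q)%R).
Qed.

(** On the fibre [a ^+ j] is conjugation by [t ^+ j]. It is conjugation by [g] exactly when
    [t ^+ j / psi g] centralizes the fibre, that is, when this element of height [j] is central.
    Hence the order of the outer class is the least positive height of a central element. *)
Lemma inner_power_center (a : automorphism (free_of_rank r)) t j :
  lam t = 1%R -> (forall w, psi w ^ t = psi (a w)) ->
  is_inner (a ^+ j) <-> exists2 y, in_center y & lam y = j%:Z.
Proof.
move=> lt psit; have := autXz_conj psit j; rewrite [expgz _ _]/(t ^+ j) [expgz _ _]/(a ^+ j).
case: fib => _ _ psi_inj ker psitj; split=> [[g gE] | [y yC yj]].
  exists (t ^+ j / psi g); last first.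
    have lg : lam (psi g) = 0%R by apply/ker; exists g.
    by rewrite lamM zhomV // lg zhomXn // lt mulr1 addr0.
  apply: fibered_centralizer => w; apply/commute_sym/conj_commute.
  by rewrite conjgM psitj gE homJ conjgK.
have /ker[g gE] : lam (y^-1 * t ^+ j) = 0%R.
  by rewrite lamM zhomV // yj zhomXn // lt mulr1 addNr.
exists g => w; apply: psi_inj; rewrite -psitj homJ gE conjgM.
by congr (_ ^ _); apply/esym/conj_commute/commute_sym/commute_sym/commuteV/commute_sym/yC.
Qed.

End FiberedCenter.

(** Height and fibre of the torus are transported to [G]. The last two clauses say that the heights
    of central elements are exactly the multiples of [k], which is what the order of [Phi] means by
    [inner_power_center]. *)
Lemma outer_torus_fibered (G : groupType) n k (Phi : outer_automorphism (free_of_rank n)) :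
  ~ elementary G -> has_order Phi k -> isomorphic G (outer_mapping_torus Phi) ->
  exists lam (psi : {multiplicative free_of_rank n -> G}),
    [/\ fibered lam psi, exists2 y, in_center y & lam y = k%:Z
      & forall y, in_center y -> (k%:Z %| lam y)%Z].
Proof.
move=> nel [k_gt0 Phik kmin] /isomorphic_sym[g [f gK fK]].
pose a : automorphism (free_of_rank n) := repr Phi.
have [tau [[tauM _ iota_inj ker] tau_t]] := torus_fibered a.
have fM : {morph f : x y / x * y}.
  by move=> x y; rewrite -{1}[x]fK -{1}[y]fK -homM gK.
pose lam x := tau (f x); pose psi := [the {multiplicative _ -> _} of g \o torus_iota a].
have lamM : zhom lam by move=> x y; rewrite /lam fM tauM.
have gt : lam (g (torus_stable a)) = 1%R by rewrite /lam gK.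
have fib : fibered lam psi.
  split=> //; first by exists (g (torus_stable a)).
    exact: inj_comp (can_inj gK) iota_inj.
  move=> x; rewrite /lam ker; split=> -[w wE]; exists w; first by rewrite -[LHS]/(g (torus_iota a w)) wE fK.
  by rewrite -wE -[psi w]/(g (torus_iota a w)) gK.
have n_gt1 := fibered_rank_gt1 fib nel.
have psit w : psi w ^ g (torus_stable a) = psi (a w).
  by rewrite -[psi (a w)]/(g (torus_iota a (a w))) -torus_conj homJ.
have Phi_inner j : Phi ^+ j = 1 <-> exists2 y, in_center y & lam y = j%:Z.
  rewrite -(inner_power_center fib n_gt1 j gt psit) -[Phi]Defs.reprK -/a.
  by rewrite -(homXn (coset (inner _))); apply: (coset1P (inner _)).
exists lam, psi; split=> //; first exact/Phi_inner.
have [y0 y0C y0k] := (Phi_inner k).1 Phik.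
move=> y yC; have kn0 : k%:Z != 0%R by rewrite -lt0n.
(* The height of [y'] is the remainder of [lam y] modulo [k]; if it were not 0, it would be a
   smaller exponent killing [Phi]. *)
pose y' := y * expgz y0 (- (lam y %/ k)%Z)%R.
have y'C : in_center y' by apply: centerM => //; apply: centerXz.
have le : lam y' = (lam y %% k)%Z.
  rewrite lamM zhomXz // y0k mulNr; apply/eqP; rewrite subr_eq addrC.
  by rewrite -divz_eq.
have := modz_ge0 (lam y) kn0; have := ltz_pmod (lam y) (d := k%:Z) k_gt0.
case E: (lam y %% k)%Z le => [[|j]|] // le lt_jk _; first exact/dvdz_mod0P.
by case: (kmin j.+1) => //; apply/Phi_inner; exists y'.
Qed.

Lemma fibered_outer_torus (G : groupType) n lam
    (psi : {multiplicative free_of_rank n -> G}) z k :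
  fibered lam psi -> 1 < n -> in_center z -> 0 < k -> lam z = k%:Z ->
  (forall y, in_center y -> exists i, y = expgz z i) ->
  exists Phi : outer_automorphism (free_of_rank n),
    has_order Phi k /\ isomorphic G (outer_mapping_torus Phi).
Proof.
move=> fib n_gt1 zC k_gt0 zk zgen; have [lamM [t lt] psi_inj ker] := fib.
have [a0 a0E] := choice (fun w => fibered_conj w t fib).
have [b0 b0E] := choice (fun w => fibered_conj w t^-1 fib).
have a0_aut : `[< is_automorphism a0 >].
  apply/asboolP; split=> [u v|].
    by apply: psi_inj; rewrite homM !a0E -conjMg homM.
  by exists b0 => w; apply: psi_inj; rewrite ?(a0E, b0E) ?conjgK ?conjgKV.
pose a : automorphism (free_of_rank n) := exist _ a0 a0_aut.
pose Phi : outer_automorphism (free_of_rank n) := coset (inner _) a.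
(* The mapping torus of [Phi] is built from the chosen representative [b], which may differ from
   conjugation by [t] by an inner automorphism. Replacing [t] by [t / psi (b g)] absorbs the
   difference without changing the height. *)
pose b : automorphism (free_of_rank n) := repr Phi.
have /coset_eqP[g gE] : coset (inner _) b = coset (inner _) a by apply: Defs.reprK.
have bE w : psi w ^ (t / psi (b g)) = psi (b w).
  rewrite conjgM -a0E -homV -homJ; congr (psi _).
  have -> : a0 w = b (w ^ g) by rewrite -gE; apply/esym/inv_funVK.
  by rewrite autJ conjgK.
have lt' : lam (t / psi (b g)) = 1%R.
  have lg : lam (psi (b g)) = 0%R by apply/ker; exists (b g).
  by rewrite lamM zhomV // lg lt addr0.
exists Phi; split; last exact: fibered_torus fib lt' bE.
have Phi_inner j : Phi ^+ j = 1 <-> exists2 y, in_center y & lam y = j%:Z.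
  rewrite -(inner_power_center fib n_gt1 j lt' bE) -[Phi]Defs.reprK -/b.
  by rewrite -(homXn (coset (inner _))); apply: (coset1P (inner _)).
split=> //; first by apply/Phi_inner; exists z.
move=> j /andP[j_gt0 lt_jk] /Phi_inner[y /zgen[i ->]].
rewrite zhomXz // zk => ik; have : (k %| j)%N.
  by have := dvdz_mull i (dvdzz k%:Z); rewrite ik.
by move=> /(dvdn_leq j_gt0); rewrite leqNgt lt_jk.
Qed.

(** * Free subgroups of finite index *)

Local Close Scope int_scope.

Definition transversal (Q : groupType) r (f : {multiplicative free_of_rank r -> Q})
    d (s : 'I_d -> Q) : Prop :=
  (forall x, exists i w, x = s i * f w) /\
  (forall i j w, s i * f w = s j -> i = j).

Definition free_of_index (Q : groupType) (r d : nat) : Prop :=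
  exists (f : {multiplicative free_of_rank r -> Q}) (s : 'I_d -> Q),
    injective f /\ transversal f s.

Lemma finite_index_transversal (Q : groupType) r
    (f : {multiplicative free_of_rank r -> Q}) :
  finite_index (fun x => exists w, f w = x) -> exists d (s : 'I_d -> Q), transversal f s.
Proof.
move=> [l lP]; pose P x y := `[< exists w, f w = y^-1 * x >].
have Peq x y z : P x y -> P x z = P y z.
  move=> /asboolP[w wE]; apply/asboolP/asboolP => -[v vE].
    by exists (v / w); rewrite homF wE vE invgM invgK -mulgA mulVKg.
  by exists (v * w); rewrite homM wE vE mulgA mulgK.
(* The first element of [l] lying in the coset of [x], hence dependent on the coset only. *)
pose rep x := nth 1 l (find (P x) l).
have rep_has x : has (P x) l.
  by have [y ly [w wE]] := lP x; apply/hasP; exists y => //; apply/asboolP; exists w.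
have rep_l x : rep x \in l by rewrite mem_nth // -has_find.
have repP x : P x (rep x) by apply: nth_find.
have rep_eq x y : P x y -> rep x = rep y.
  by move=> Pxy; rewrite /rep; congr (nth _ _ _); apply: eq_find => z; apply: Peq.
have repK x : rep (rep x) = rep x by apply/esym/rep_eq.
pose l' := undup (map rep l); exists (size l'), (fun i : 'I__ => l'`_i).
have l'_rep x : x \in l' -> rep x = x.
  by rewrite mem_undup => /mapP[y _ ->].
split=> [x | i j w ijw].
  have xl' : rep x \in l' by rewrite mem_undup; apply/mapP; exists (rep x).
  have lt_i : index (rep x) l' < size l' by rewrite index_mem.
  exists (Ordinal lt_i); have /asboolP[w wE] := repP x; exists w.
  by rewrite /= nth_index // wE mulVKg.
apply/val_inj/eqP; rewrite -(nth_uniq 1 (ltn_ord i) (ltn_ord j)) ?undup_uniq //.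
rewrite -(l'_rep _ (mem_nth _ (ltn_ord i))) -(l'_rep _ (mem_nth _ (ltn_ord j))).
apply/eqP/rep_eq/asboolP; exists w^-1; rewrite -ijw invgM -mulgA mulVg mulg1.
by rewrite homV.
Qed.

Lemma free_of_index_ex (Q : groupType) r :
  has_free_finite_index Q r -> exists d, free_of_index Q r d.
Proof.
move=> [f [f_inj /finite_index_transversal[d [s sP]]]].
by exists d, f, s.
Qed.

(** Conjugating the free subgroup by [s ord0] and translating the representatives makes the base
    coset the subgroup itself, as the cocycle count requires. *)
Lemma free_of_index_normalized (Q : groupType) r d :
  free_of_index Q r d -> exists d', d = d'.+1 /\
  exists (f : {multiplicative free_of_rank r -> Q}) (s : 'I_d'.+1 -> Q),
    [/\ injective f, transversal f s & s ord0 = 1].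
Proof.
move=> [f [s [f_inj [s_all s_uniq]]]].
case: d s s_all s_uniq => [|d] s s_all s_uniq; first by have [[]] := s_all 1.
exists d; split=> //; have gM : {morph (fun w => f w ^ (s ord0)^-1) : u v / u * v}.
  by move=> u v; rewrite homM conjMg.
exists (hom_of gM), (fun i => s i / s ord0); split; last exact: mulgV.
  by move=> u v /conjg_inj/f_inj.
split=> [x | i j w].
  have [i [w wE]] := s_all (x * s ord0); exists i, w.
  by rewrite hom_ofE /conjg invgK !mulgA mulgVK -wE mulgK.
rewrite hom_ofE /conjg invgK !mulgA mulgVK => /mulIg; exact: s_uniq.
Qed.

Section CosetAction.
Variables (Q : groupType) (r d : nat) (f : {multiplicative free_of_rank r -> Q}).
Variable s : 'I_d -> Q.
Hypotheses (f_inj : injective f) (sP : transversal f s).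

Lemma transversal_inj i j u v : s i * f u = s j * f v -> i = j /\ u = v.
Proof.
move=> e; have ij : i = j.
  by case: sP => _ s_uniq; apply: (s_uniq i j (u / v)); rewrite homF mulgA e mulgK.
by split=> //; move: e; rewrite ij => /mulgI/f_inj.
Qed.

(** Here [a] is the permutation action on left cosets and [eta] records the remaining factor in the
    free subgroup; their composition rules follow from uniqueness of the decomposition. *)
Lemma coset_action : exists (a : Q -> 'I_d -> 'I_d) (eta : Q -> 'I_d -> free_of_rank r),
  [/\ forall g i, g * s i = s (a g i) * f (eta g i),
      forall i, a 1 i = i,
      forall g h i, a (g * h) i = a g (a h i)
    & forall g h i, eta (g * h) i = eta g (a h i) * eta h i].
Proof.
have ex (p : Q * 'I_d) : exists q : 'I_d * free_of_rank r, p.1 * s p.2 = s q.1 * f q.2.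
  by have [s_all _] := sP; have [i [w ->]] := s_all (p.1 * s p.2); exists (i, w).
have [q qE] := choice ex; pose a g i := (q (g, i)).1; pose eta g i := (q (g, i)).2.
have aE g i : g * s i = s (a g i) * f (eta g i) by apply: (qE (g, i)).
have aM g h i : a (g * h) i = a g (a h i) /\ eta (g * h) i = eta g (a h i) * eta h i.
  by apply: transversal_inj; rewrite -aE -mulgA aE mulgA aE -mulgA -homM.
exists a, eta; split=> // [i|g h i|g h i]; [|by case: (aM g h i)..].
have [] // : a 1 i = i /\ eta 1 i = 1.
by apply: transversal_inj; rewrite -aE mul1g hom1 mulg1.
Qed.

(* The element acts freely on the cosets, their stabilisers being torsion-free. *)
Lemma torsion_order_dvd_index (x : Q) o : has_order x o -> (o %| d)%N.
Proof.
move=> [o_gt0 xo xmin]; have [a [eta [aE a1 aM _]]] := coset_action.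
have a_inj : injective (a x).
  by apply: (can_inj (g := a x^-1)) => i; rewrite -aM mulVg a1.
have aX n i : iter n (a x) i = a (x ^+ n) i.
  by elim: n => [|n IHn]; rewrite ?a1 //= IHn -aM expgS.
(* If [x ^+ n] fixes a coset, a conjugate of it lies in the free subgroup, where torsion is
   trivial. *)
have free n i : a (x ^+ n) i = i -> (o %| n)%N.
  move=> ain; have e := aE (x ^+ n) i; rewrite ain in e.
  have eta1 : eta (x ^+ n) i = 1.
    apply: (free_torsion_free o_gt0); apply: f_inj; rewrite homXn hom1.
    have -> : f (eta (x ^+ n) i) = (x ^+ n) ^ s i by rewrite /conjg e mulKg.
    by rewrite -conjXg -expgnA mulnC expgnA xo expg1n conj1g.
  have xn : x ^+ n = 1 by apply: (mulIg (s i)); rewrite e eta1 hom1 mulg1 mul1g.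
  move: xn; rewrite {1}(divn_eq n o) expgnDr mulnC expgnA xo expg1n mul1g => xn.
  rewrite /dvdn -leqn0 leqNgt; apply/negP => n_gt0.
  by apply: (xmin (n %% o)%N) => //; rewrite n_gt0 ltn_mod.
have orderE i : order (a x) i = o.
  have le_oo : o <= order (a x) i.
    apply: dvdn_leq; first exact: order_gt0.
    by apply: (free _ i); rewrite -aX iter_order.
  apply/eqP; rewrite eqn_leq le_oo andbT leqNgt; apply/negP => lt_oo.
  have := orbit_uniq (a x) i; rewrite /orbit => U.
  have := nth_uniq i (s := traject (a x) i (order (a x) i)) (i := 0) (j := o).
  rewrite size_traject order_gt0 lt_oo U => /(_ isT isT isT).
  by rewrite !nth_traject ?order_gt0 // [iter o _ _]aX xo a1 eqxx => /esym/eqP o0; rewrite -o0 in o_gt0.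
have <- : #|'I_d| = d by rewrite card_ord.
rewrite -(@fcard_order_set _ _ a_inj o predT) ?dvdn_mull //.
by apply/subsetP => i _; rewrite inE orderE.
Qed.

End CosetAction.

(** * Counting cocycles to compare ranks and indices *)

Section Cocycles.
Variables (Q : groupType) (Y : Type) (act : Q -> Y -> Y).

(** One-cocycles of [Q] with coefficients in the functions from [Y] to the field with two
    elements. *)
Definition is_cocycle (c : Q -> Y -> bool) : Prop :=
  forall g h y, c (g * h) y = c g (act h y) (+) c h y.

Definition cocycle_type := {c : Q -> Y -> bool | `[< is_cocycle c >]}.

End Cocycles.

Definition prod_act (Q : groupType) (Y1 Y2 : Type) (a1 : Q -> Y1 -> Y1)
    (a2 : Q -> Y2 -> Y2) g (p : Y1 * Y2) := (a1 g p.1, a2 g p.2).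

Lemma cocycle_swap (Q : groupType) (Y1 Y2 : Type) (a1 : Q -> Y1 -> Y1)
    (a2 : Q -> Y2 -> Y2) :
  exists sw : cocycle_type (prod_act a1 a2) -> cocycle_type (prod_act a2 a1),
    bijective sw.
Proof.
have swP Z1 Z2 (b1 : Q -> Z1 -> Z1) (b2 : Q -> Z2 -> Z2)
    (c : cocycle_type (prod_act b1 b2)) :
    `[< is_cocycle (prod_act b2 b1) (fun g p => val c g (p.2, p.1)) >].
  by apply/asboolP => g h [z2 z1]; have /asboolP -> := valP c.
pose sw Z1 Z2 b1 b2 c : cocycle_type (prod_act b2 b1) :=
  exist (fun c' => `[< is_cocycle _ c' >]) _ (swP Z1 Z2 b1 b2 c).
exists (@sw Y1 Y2 a1 a2); exists (@sw Y2 Y1 a2 a1).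
  by move=> c; apply: val_inj; apply/funext => g; apply/funext => -[].
by move=> c; apply: val_inj; apply/funext => g; apply/funext => -[].
Qed.

Lemma cocycle1 (Q : groupType) Y (act : Q -> Y -> Y) c y :
  is_cocycle act c -> act 1 y = y -> c 1 y = false.
Proof. by move=> cP a1; have := cP 1 1 y; rewrite mulg1 a1 addbb. Qed.

(** A cocycle amounts to a lift of the action to [X * bool] commuting with the flip of the second
    component; for a free group such a lift may be prescribed arbitrarily on the generators. *)
Lemma free_cocycle r (X : Type) (A : free_of_rank r -> perm_of X) (alpha : 'I_r -> X -> bool) :
  {morph A : u v / u * v} ->
  exists u, is_cocycle (fun w => A w) u /\ forall k x, u (free_gen k) x = alpha k x.
Proof.
move=> AM; pose B k (p : X * bool) := (A (free_gen k) p.1, p.2 (+) alpha k p.1).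
pose B' k (p : X * bool) :=
  (pinv (A (free_gen k)) p.1, p.2 (+) alpha k (pinv (A (free_gen k)) p.1)).
have BK k : cancel (B k) (B' k).
  by case=> x e; rewrite /B /B' /= pfunK -addbA addbb addbF.
have B'K k : cancel (B' k) (B k).
  by case=> x e; rewrite /B /B' /= pinvK -addbA addbb addbF.
have [F FE] := free_lift (fun k => Perm (BK k) (B'K k)).
have FP w : forall x e, F w (x, e) = (A w x, e (+) (F w (x, false)).2).
  have A1 : A 1 = 1 by apply: (mulgI (A 1)); rewrite -AM !mulg1.
  have AV u : A u^-1 = (A u)^-1 by apply/esym/mulg1_eq; rewrite -AM mulgV.
  elim/free_ind: w => [|k w IHw|k w IHw] x e.
  - by rewrite hom1 A1 !perm1 addbF.
  - by rewrite homM AM !permM IHw [F w (x, false)]IHw FE /= /B /= addbA.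
  by rewrite homM AM !permM IHw [F w (x, false)]IHw homV FE AV !permVE /= /B' /= addbA.
exists (fun w x => (F w (x, false)).2); split=> [g h x | k x].
  rewrite homM permM; have := FP h x false; case: (F h (x, false)) => x' e [->].
  by rewrite [in LHS]FP /= addbC.
by rewrite FE.
Qed.

Section CocycleCount.
Variables (Q : groupType) (r d : nat) (f : {multiplicative free_of_rank r -> Q}).
Variable s : 'I_d.+1 -> Q.
Hypotheses (f_inj : injective f) (sP : transversal f s) (s0 : s ord0 = 1).
Variables (a : Q -> 'I_d.+1 -> 'I_d.+1) (eta : Q -> 'I_d.+1 -> free_of_rank r).
Hypothesis aE : forall g i, g * s i = s (a g i) * f (eta g i).
Variables (X : finType) (A : Q -> X -> X).
Hypotheses (A1 : forall x, A 1 x = x) (AM : forall g h x, A (g * h) x = A g (A h x)).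

Let I := 'I_d.+1.
Let act : Q -> I * X -> I * X := prod_act a A.

(** The free parameters of a cocycle on [I * X]: its values over the base point [ord0], at the [r]
    generators of the free subgroup and at the [d] representatives other than [s ord0]. *)
Definition cocycle_data := ({ffun 'I_r * X -> bool} * {ffun 'I_d * X -> bool})%type.

Definition cocycle_restr (c : cocycle_type act) : cocycle_data :=
  ([ffun p => val c (f (free_gen p.1)) (ord0, p.2)],
   [ffun p => val c (s (lift ord0 p.1)) (ord0, p.2)]).

Let aP g i j w : g * s i = s j * f w -> a g i = j /\ eta g i = w.
Proof. by rewrite aE => /(transversal_inj f_inj sP). Qed.

Let a_f w : a (f w) ord0 = ord0 /\ eta (f w) ord0 = w.
Proof. by apply: aP; rewrite s0 mulg1 mul1g. Qed.

Let a_s i : a (s i) ord0 = i /\ eta (s i) ord0 = 1.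
Proof. by apply: aP; rewrite s0 mulg1 hom1 mulg1. Qed.

Let AV g x : A g^-1 (A g x) = x. Proof. by rewrite -AM mulVg A1. Qed.
Let AVK g x : A g (A g^-1 x) = x. Proof. by rewrite -AM mulgV A1. Qed.

(** The data determine the cocycle over the base point on the free subgroup and on the
    representatives; the identity [g * s i = s (a g i) * f (eta g i)] then gives its value at every
    [(i, x)]. *)
Lemma cocycle_restr_inj : injective cocycle_restr.
Proof.
move=> c c' /= [/ffunP e1 /ffunP e2]; apply: val_inj.
have /asboolP := valP c; have /asboolP := valP c'; move: e1 e2.
rewrite /=; move: (val c) (val c') => {c c'} c c' e1 e2 c'P cP.
have act1 x : act 1 (ord0, x) = (ord0, x).
  by rewrite /act /prod_act /= A1; have [] := a_f 1; rewrite hom1 => ->.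
have ef w x : c (f w) (ord0, x) = c' (f w) (ord0, x).
  elim/free_ind: w x => [|k w IHw|k w IHw] x.
  - by rewrite hom1 (cocycle1 cP) // (cocycle1 c'P).
  - rewrite homM cP c'P IHw; congr (_ (+) _); rewrite /act /prod_act /= (a_f w).1.
    by have := e1 (k, A (f w) x); rewrite !ffunE.
  rewrite homM cP c'P IHw; congr (_ (+) _); rewrite /act /prod_act /= (a_f w).1.
  set y := A (f w) x; have e y' : c (f (free_gen k)) (ord0, y') = c' (f (free_gen k)) (ord0, y').
    by have := e1 (k, y'); rewrite !ffunE.
  have kV (b : Q -> I * X -> bool) : is_cocycle act b ->
      b (f (free_gen k)^-1) (ord0, y) = b (f (free_gen k)) (ord0, A (f (free_gen k)^-1) y).
    move=> bP; have := bP (f (free_gen k)) (f (free_gen k)^-1) (ord0, y).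
    rewrite -homM mulgV hom1 (cocycle1 bP) // /act /prod_act /= (a_f _).1 => /esym/eqP.
    by rewrite -negb_add /addb; case: (b _ _); case: (b _ _).
  by rewrite !kV // e.
have es i x : c (s i) (ord0, x) = c' (s i) (ord0, x).
  case: (unliftP ord0 i) => [j ->|->]; last by rewrite s0 -(hom1 f) ef.
  by have := e2 (j, x); rewrite !ffunE.
apply/funext => g; apply/funext => -[i x].
have h (b : Q -> I * X -> bool) : is_cocycle act b -> b g (i, x) =
    b (s (a g i) * f (eta g i)) (ord0, A (s i)^-1 x) (+) b (s i) (ord0, A (s i)^-1 x).
  move=> bP; rewrite -aE bP -addbA addbb addbF /act /prod_act /= AVK.
  by rewrite (a_s i).1.
by rewrite !h // cP c'P !ef !es /act /prod_act /= (a_f _).1 es.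
Qed.

Lemma cocycle_restr_surj y : exists c, cocycle_restr c = y.
Proof.
case: y => al be.
have Abij g : cancel (A g) (A g^-1) by move=> x; apply: AV.
have AbijV g : cancel (A g^-1) (A g) by move=> x; apply: AVK.
pose Ap w : perm_of X := Perm (Abij (f w)) (AbijV (f w)).
have ApM : {morph Ap : u v / u * v}.
  by move=> u v; apply: perm_ext => x; rewrite permM /= homM AM.
have [u [uP uE]] := free_cocycle (fun k x => al (k, x)) ApM.
pose b i x := if unlift ord0 i is Some j then be (j, x) else false.
(* The formula is forced by the cocycle rule on [g * s i = s (a g i) * f (eta g i)]: [b] prescribes
   the values at the representatives and [u] those on the free subgroup. *)
pose c g (p : I * X) := let y := A (s p.1)^-1 p.2 in
  b (a g p.1) (A (f (eta g p.1)) y) (+) u (eta g p.1) y (+) b p.1 y.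
have a_mul g h i : a (g * h) i = a g (a h i) /\ eta (g * h) i = eta g (a h i) * eta h i.
  by apply: aP; rewrite -mulgA aE mulgA aE -mulgA -homM.
have cP : is_cocycle act c.
  move=> g h [i x]; rewrite /c /act /prod_act /=; set y := A _ x.
  have [-> ->] := a_mul g h i; rewrite homM AM uP /=.
  have -> : A (s (a h i))^-1 (A h x) = A (f (eta h i)) y.
    by rewrite /y -!AM; congr (A _ x); apply: (mulgI (s (a h i))); rewrite mulVKg mulgA -aE mulgK.
  set b1 := b _ _; set b2 := b _ _; set b3 := b _ _; set u1 := u _ _; set u2 := u _ _.
  by case: b1 b2 b3 u1 u2 => [] [] [] [] [].
have c_type : `[< is_cocycle act c >] by apply/asboolP.
have u1 x : u 1 x = false.
  by apply: (cocycle1 uP); rewrite /= hom1 A1.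
exists (exist _ c c_type); congr pair; apply/ffunP => -[k x]; rewrite ffunE /c /=.
  rewrite (a_f _).1 (a_f _).2 uE s0 -(hom1 f) -homV invg1 hom1 A1.
  by rewrite /b unlift_none addFb addbF.
rewrite (a_s _).1 (a_s _).2 u1 s0 invg1 hom1 !A1.
by rewrite /b unlift_none liftK !addbF.
Qed.

Lemma cocycle_restr_bij : bijective cocycle_restr.
Proof.
have [g gE] := choice cocycle_restr_surj; exists g => // c.
by apply: cocycle_restr_inj; rewrite gE.
Qed.

Lemma card_cocycle_data : #|{: cocycle_data}| = (2 ^ ((r + d) * #|X|))%N.
Proof. by rewrite card_prod !card_ffun !card_prod !card_ord card_bool -expnD mulnDl. Qed.

End CocycleCount.

(* Both sides count the F_2-valued cocycles on the product of the two coset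
   spaces, in the spirit of Shapiro's lemma. *)
Theorem free_index_rank (Q : groupType) r1 d1 r2 d2 :
  free_of_index Q r1 d1 -> free_of_index Q r2 d2 ->
  (r1 * d2 + d1 = r2 * d1 + d2)%N.
Proof.
move=> /free_of_index_normalized[{}d1 [-> [f1 [s1 [f1_inj s1P s10]]]]].
move=> /free_of_index_normalized[{}d2 [-> [f2 [s2 [f2_inj s2P s20]]]]].
have [a1 [eta1 [a1E a11 a1M _]]] := coset_action f1_inj s1P.
have [a2 [eta2 [a2E a21 a2M _]]] := coset_action f2_inj s2P.
have b12 := cocycle_restr_bij f1_inj s1P s10 a1E a21 a2M.
have b21 := cocycle_restr_bij f2_inj s2P s20 a2E a11 a1M.
have [sw sw_bij] := cocycle_swap a1 a2; have [g12 g12K g12VK] := b12.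
have := bij_eq_card (bij_comp b21 (bij_comp sw_bij (Bijective g12VK g12K))).
(* The indices are now [d1.+1] and [d2.+1], so the equality of exponents is
   [(r1 + d1) * d2.+1 = (r2 + d2) * d1.+1]. *)
rewrite !card_cocycle_data => /eqP; rewrite eqn_exp2l // !card_ord => /eqP.
nia.
Qed.

(** * Presentations of GBS groups *)

Section Trees.
Variables (V E : finType) (src tgt : E -> V) (v0 : V).

Definition crosses (S : {set V}) e := (src e \in S) != (tgt e \in S).

(** Growing a tree by one crossing edge at a time allows recursion along its edges, which
    connectedness with an edge count does not. Both ends are added because either may be the new
    vertex. *)
Inductive tree_on : {set V} -> {set E} -> Prop :=
| tree_root : tree_on [set v0] set0
| tree_add (S : {set V}) (T : {set E}) e : tree_on S T -> crosses S e ->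
    tree_on (src e |: (tgt e |: S)) (e |: T).

Lemma tree_ends S T : tree_on S T -> forall e, e \in T -> src e \in S /\ tgt e \in S.
Proof.
elim=> {S T} [e|S T e _ IHT _ e']; first by rewrite in_set0.
rewrite !inE => /orP[/eqP->|/IHT[-> ->]]; first by rewrite !eqxx /= orbT.
by rewrite !orbT.
Qed.

Lemma tree_has_root S T : tree_on S T -> v0 \in S.
Proof. by elim=> {S T} [|S T e _ IHT _]; rewrite !inE // IHT !orbT. Qed.

Lemma tree_card S T : tree_on S T -> #|S| = #|T|.+1.
Proof.
elim=> {S T} [|S T e TP IHT cr]; first by rewrite cards1 cards0.
have eT : e \notin T.
  by apply: contraL cr => /(tree_ends TP)[]; rewrite /crosses => -> ->; rewrite eqxx.
rewrite [in RHS]cardsU1 eT add1n -IHT; move: cr; rewrite /crosses.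
case: (boolP (src e \in S)) => sS; case: (boolP (tgt e \in S)) => // tS _.
  by rewrite cardsU1 !inE sS orbT /= cardsU1 tS.
by rewrite cardsU1 !inE (negPf sS) orbF (setUidPr _) ?sub1set //; case: eqP sS => // ->; rewrite tS.
Qed.

Lemma tree_prop S T (P : V -> Prop) : tree_on S T -> P v0 ->
  (forall e, e \in T -> P (src e) <-> P (tgt e)) -> forall v, v \in S -> P v.
Proof.
move=> TP P0; elim: TP => {S T} [_ v|S T e TP IHT cr PT]; first by rewrite inE => /eqP->.
have {}IHT v : v \in S -> P v.
  by apply: IHT => e' e'T; apply: PT; rewrite inE e'T orbT.
have [Pst Pts] : P (src e) <-> P (tgt e) by apply: PT; rewrite !inE eqxx.
move=> v; rewrite !inE => /or3P[/eqP->|/eqP->|/IHT//]; move: cr; rewrite /crosses.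
  by case: (boolP (src e \in S)) => [/IHT//|_]; case: (boolP (tgt e \in S)) => [/IHT/Pts|].
by case: (boolP (tgt e \in S)) => [/IHT//|_]; case: (boolP (src e \in S)) => [/IHT/Pst|].
Qed.

(** Each new edge determines the value at its new end, through [f e] if this end is the target and
    through [f' e] if it is the source. *)
Lemma tree_potential (Y : Type) (f f' : E -> Y -> Y) (y0 : Y) S T :
  (forall e, cancel (f' e) (f e)) -> tree_on S T ->
  exists g : V -> Y, g v0 = y0 /\ forall e, e \in T -> g (tgt e) = f e (g (src e)).
Proof.
move=> fK; elim=> {S T} [|S T e TP [g [g0 gT]] cr].
  by exists (fun=> y0); split=> // e; rewrite in_set0.
have := cr; rewrite /crosses.
case: (boolP (src e \in S)) => sS; case: (boolP (tgt e \in S)) => // tS _.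
  have nt v : v \in S -> (v == tgt e) = false.
    by move=> vS; apply: contraNF tS => /eqP<-.
  exists [eta g with tgt e |-> f e (g (src e))]; split=> [|e'] /=.
    by rewrite nt // (tree_has_root TP).
  rewrite !inE => /orP[/eqP->|e'T]; first by rewrite eqxx nt.
  by have [s't t't] := tree_ends TP e'T; rewrite !nt // gT.
have ns v : v \in S -> (v == src e) = false.
  by move=> vS; apply: contraNF sS => /eqP<-.
exists [eta g with src e |-> f' e (g (tgt e))]; split=> [|e'] /=.
  by rewrite ns // (tree_has_root TP).
rewrite !inE => /orP[/eqP->|e'T]; first by rewrite eqxx ns // fK.
by have [s't t't] := tree_ends TP e'T; rewrite !ns // gT.
Qed.

Lemma tree_exists (D : {set E}) :
  (forall S : {set V}, v0 \in S -> S != setT -> exists2 e, e \in D & crosses S e) ->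
  exists2 T : {set E}, T \subset D & tree_on setT T.
Proof.
move=> cross.
have step n : n < #|V| -> exists S T, [/\ tree_on S T, T \subset D & #|S| = n.+1].
  elim: n => [_|n IHn lt_nV].
    by exists [set v0], set0; rewrite sub0set cards1; split=> //; apply: tree_root.
  have [S [T [TP TD cS]]] := IHn (ltnW lt_nV).
  have [|e eD cr] := cross S (tree_has_root TP).
    by apply: contraTneq lt_nV => S_T; rewrite -cardsT -S_T cS ltnn.
  have T'P := tree_add TP cr; exists (src e |: (tgt e |: S)), (e |: T).
  split=> //; first by rewrite subUset sub1set eD.
  have eT : e \notin T.
    by apply: contraL cr => /(tree_ends TP)[]; rewrite /crosses => -> ->; rewrite eqxx.
  by rewrite (tree_card T'P) cardsU1 eT -cS (tree_card TP).
have V_gt0 : 0 < #|V| by apply/card_gt0P; exists v0.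
have [|S [T [TP TD cS]]] := step #|V|.-1; first by rewrite prednK.
exists T => //; suff <- : S = setT by [].
by apply/eqP; rewrite eqEcard subsetT cardsT cS (prednK V_gt0) leqnn.
Qed.

End Trees.

(** Connectedness lets a tree grow inside [T] until it meets all vertices, and the edge count then
    forces it to exhaust [T]. *)
Lemma spanning_tree_on (A : graph_of_groups) (T : {set edge A}) :
  spanning_tree T -> exists v0, tree_on (@edge_src A) (@edge_tgt A) v0 setT T.
Proof.
move=> [conn cT].
have [v0 _] : exists v0 : vertex A, v0 \in predT by apply/card_gt0P; rewrite -cT.
exists v0; have [|T' T'T T'P] := @tree_exists _ _ (@edge_src A) (@edge_tgt A) v0 T.
  move=> S v0S /eqP S_T; apply: contrapT => ncross; apply: S_T.
  apply/setP => v; rewrite inE -(@closed_connect _ (adjacent T) (mem S) _ v0 v) //.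
  move=> x y /existsP[e /andP[eT exy]]; apply/eqP/negPn/negP => nxy.
  apply: ncross; exists e => //; rewrite /crosses.
  by case/orP: exy => /andP[/eqP-> /eqP->]; rewrite // eq_sym.
suff <- : T' = T by [].
by apply/eqP; rewrite eqEcard T'T -ltnS cT -cardsT (tree_card T'P) /=.
Qed.

(* The generators of the edges outside [D] are killed: this removes these edges
   from the graph, which yields the base group of an HNN decomposition. *)
Section GBSPresentation.
Variables (V E : finType) (src tgt : E -> V) (p q : E -> int) (T D : {set E}).

Definition gbs_rel (L : groupType) (x : V -> L) (y : E -> L) : Prop :=
  [/\ forall e, e \in D -> y e * expgz (x (tgt e)) (q e) = expgz (x (src e)) (p e) * y e,
      forall e, e \in T -> y e = 1
    & forall e, e \notin D -> y e = 1].

(** The presentation is encoded by its universal property and generation instead of a fixed model,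
    so that it passes through isomorphisms. *)
Record gbs_group (G : groupType) (a : V -> G) (t : E -> G) : Prop := GbsGroup {
  gbsP : gbs_rel a t;
  gbs_lift : forall (L : groupType) (x : V -> L) (y : E -> L), gbs_rel x y ->
    exists f : {multiplicative G -> L}, (forall v, f (a v) = x v) /\ forall e, f (t e) = y e;
  gbs_ind : forall P : G -> Prop, P 1 ->
    (forall v u, P u -> P (a v * u)) -> (forall v u, P u -> P ((a v)^-1 * u)) ->
    (forall e u, P u -> P (t e * u)) -> (forall e u, P u -> P ((t e)^-1 * u)) ->
    forall u, P u
}.

Lemma gbs_group_ex : exists (G : groupType) (a : V -> G) (t : E -> G), gbs_group a t.
Proof.
pose X : choiceType := (V + E)%type.
pose av v : free_group X := free_gen (inl v : X).
pose te e : free_group X := free_gen (inr e : X).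
pose R (u v : free_group X) := [\/ exists e, [/\ e \in D, u = te e * expgz (av (tgt e)) (q e)
    & v = expgz (av (src e)) (p e) * te e],
  exists e, [/\ e \in T, u = te e & v = 1] | exists e, [/\ e \notin D, u = te e & v = 1]].
exists (presented R), (fun v => pgen R (inl v)), (fun e => pgen R (inr e)); split.
- split=> e eD; rewrite -!pcosetE -?homXz -?homM -?(hom1 (pcoset R)); apply: presented_rel.
  + by apply: Or31; exists e.
  + by apply: Or32; exists e.
  by apply: Or33; exists e.
- move=> L x y [y1 y2 y3].
  have [F FE] := free_lift (fun z : X => match z with inl v => x v | inr e => y e end).
  have [] := @presented_lift _ R _ F.
    move=> u v [] [e [eD -> ->]]; rewrite ?homM ?homXz ?hom1 !FE.
    + exact: y1.
    + exact: y2.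
    exact: y3.
  move=> f fE; exists f; split=> z.
    by rewrite -pcosetE fE FE.
  by rewrite -pcosetE fE FE.
move=> P P1 Pa PaV Pt PtV; elim/presented_ind => // -[z|z] u Pu.
- exact: Pa.
- exact: Pt.
- exact: PaV.
exact: PtV.
Qed.

End GBSPresentation.

Lemma gbs_group_iso (V E : finType) (src tgt : E -> V) p q T D (G H : groupType)
    (f : {multiplicative G -> H}) (a : V -> G) (t : E -> G) :
  bijective f -> gbs_group src tgt p q T D a t ->
  gbs_group src tgt p q T D (f \o a) (f \o t).
Proof.
move=> [g fK gK] [[r1 r2 r3] lift ind]; have gM : {morph g : x y / x * y}.
  by move=> x y; rewrite -{1}[x]gK -{1}[y]gK -homM fK.
split.
- split=> e eD /=; [by rewrite -!homXz -!homM r1 | by rewrite r2 ?hom1 | by rewrite r3 ?hom1].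
- move=> L x y /lift[h [hv he]]; exists [the {multiplicative _ -> _} of h \o hom_of gM].
  by split=> z /=; rewrite fK.
move=> P P1 Pa PaV Pt PtV u; rewrite -[u]gK; elim/ind: (g u) => [|v w|v w|e w|e w].
- by rewrite hom1.
- by rewrite homM; apply: Pa.
- by rewrite homM homV; apply: PaV.
- by rewrite homM; apply: Pt.
by rewrite homM homV; apply: PtV.
Qed.

Lemma infinite_cyclicP (G : groupType) : infinite_cyclic G ->
  exists (c : G) (l : G -> int), [/\ zhom l, forall x, x = expgz c (l x),
    l c = 1%R & injective l].
Proof.
move=> [f [g fK gK]]; pose l x : int := f x.
have lM : zhom l by move=> x y; apply: (homM f x y).
have lg m : l (g m) = m by apply: gK.
exists (g (1%R : int)), l; split=> // [x|x y]; last exact: (can_inj fK).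
by apply: (can_inj fK); rewrite -/(l _) -/(l _) zhomXz // lg mulr1.
Qed.

(** A generator is chosen in every vertex and edge group; [p e] and [q e] are the exponents of the
    edge generator at the source and at the target, non-zero because the edge maps are injective. *)
Theorem GBS_presentation (G : groupType) : is_GBS G ->
  exists (V E : finType) (src tgt : E -> V) (p q : E -> int) (T : {set E}) (v0 : V)
    (a : V -> G) (t : E -> G),
    [/\ gbs_group src tgt p q T setT a t,
        tree_on src tgt v0 setT T
      & forall e, p e <> 0%R /\ q e <> 0%R].
Proof.
move=> [A [T [Vc Ec /spanning_tree_on[v0 TP] /isomorphic_sym[f f_bij]]]].
pose Vd v := cid (infinite_cyclicP (Vc v)); pose c v : vertex_group v := projT1 (Vd v).
have /(_ _)/cid cl v := projT2 (Vd v); pose l v : vertex_group v -> int := projT1 (cl v).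
have lP v : [/\ zhom (l v), forall x, x = expgz (c v) (l v x), l v (c v) = 1%R
    & injective (l v)] := projT2 (cl v).
pose Ed e := cid (infinite_cyclicP (Ec e)); pose d e : edge_group e := projT1 (Ed e).
have dP e : (forall x, exists m, x = expgz (d e) m) /\ d e <> 1.
  have [m [mM mE m1 m_inj]] := projT2 (Ed e); split=> [x|]; first by exists (m x); apply: mE.
  by move=> d1; move: m1; rewrite -/(d e) d1 zhom1.
pose p e := l _ (src_map e (d e)); pose q e := l _ (tgt_map e (d e)).
have l1 v : l v 1 = 0%R by have [lM _ _ _] := lP v; apply: zhom1.
have lc v m : l v (expgz (c v) m) = m.
  by have [lM _ lc _] := lP v; rewrite zhomXz // lc mulr1.
have lE v x : expgz (c v) (l v x) = x by have [_ <- _ _] := lP v.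
have dnz v (x : vertex_group v) : x <> 1 -> l v x <> 0%R.
  by have [_ _ _ li] := lP v; move=> x1; rewrite -(l1 v) => /li.
pose a v : pi1 T := pgen _ (inl (Tagged (fun v => vertex_group v) (c v)) : pi1_gen A).
pose t e : pi1 T := pgen _ (inr e : pi1_gen A).
pose vg v (x : vertex_group v) : pi1 T := pcoset _ (vgen x).
have vgM v : {morph @vg v : x y / x * y}.
  by move=> x y; rewrite /vg -homM; apply/esym/presented_rel; constructor.
have vgE v x : vg v x = expgz (a v) (l v x).
  by rewrite -{1}[x]lE; apply: (homXz (hom_of (@vgM v))).
exists (vertex A), (edge A), (@edge_src A), (@edge_tgt A), p, q, T, v0, (f \o a), (f \o t).
split=> //; last first.
  by move=> e; split; apply: dnz; have [_ d1] := dP e => e1; apply: d1;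
    [apply: (@src_map_inj _ e) | apply: (@tgt_map_inj _ e)]; rewrite e1 hom1.
apply: gbs_group_iso => //; split.
- split=> [e _|e eT|e]; last by rewrite inE.
    have := presented_rel (pi1_edge T (d e)); rewrite !homM homV => e1.
    by apply: (mulIg (t e)^-1); rewrite mulgK -!vgE.
  by rewrite /t -pcosetE -(hom1 (pcoset _)); apply: presented_rel; constructor.
- move=> L x y [y1 y2 _].
  have [F FE] := free_lift (fun z : pi1_gen A =>
    match z with inl u => expgz (x (tag u)) (l _ (tagged u)) | inr e => y e end).
  have Fv v (z : vertex_group v) : F (vgen z) = expgz (x v) (l v z) by rewrite FE.
  have [] := @presented_lift _ (pi1_rel T) _ F.
    move=> _ _ [v z z'|e z|e eT].
    + by have [lM _ _ _] := lP v; rewrite homM !Fv lM expgzD.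
    (* An element of the edge group is a power of its generator, so its relation follows from the
       single one kept in [gbs_rel]. *)
    + have [/(_ z)[m ->] _] := dP e; rewrite !homM homV !Fv /egen FE !homXz.
      have lX v (u : vertex_group v) : l v (expgz u m) = (l v u * m)%R.
        by have [lM _ _ _] := lP v; rewrite zhomXz // mulrC.
      rewrite !lX !expgzM -/(p e) -/(q e).
      have := y1 e (in_setT e); set u := expgz (x (_ e)) _; set w := expgz (x _) _ => e1.
      have -> : w = u ^ (y e)^-1 by rewrite /conjg invgK mulgA e1 mulgK.
      by rewrite expgzJ /conjg invgK mulgA.
    by rewrite FE hom1 y2.
  move=> g gE; exists g; split=> z.
    by rewrite /a -pcosetE gE FE /= -{1}[c z]expgz1 lc.
  by rewrite /t -pcosetE gE FE.
move=> P P1 Pa PaV Pt PtV.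
have Pz v m u : P u -> P (expgz (a v) m * u).
  move=> Pu; elim: m => [|m IHm|m IHm]; first by rewrite mul1g.
    by rewrite PoszSr addrC expgzD -mulgA; apply: Pa.
  by rewrite PoszSr opprD addrC expgzD -mulgA; apply: PaV.
elim/presented_ind => // -[[v x]|e] u Pu; rewrite -?/(t e).
- by rewrite -[pgen _ _]/(vg v x) vgE; apply: Pz.
- exact: Pt.
- by rewrite -[pgen _ _]/(vg v x) vgE -expgzN; apply: Pz.
exact: PtV.
Qed.

(** * Britton's lemma *)

Section CyclicCosets.
Variables (H : groupType) (u : H).
Hypothesis u_inf : forall m, expgz u m = 1 -> m = 0%R.

Lemma cyclic_coset_rep : exists (rep : H -> H) (ex : H -> int),
  [/\ forall h, h = rep h * expgz u (ex h),
      forall h m, rep (h * expgz u m) = rep h,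
      forall h m, ex (h * expgz u m) = (ex h + m)%R
    & rep 1 = 1].
Proof.
pose P h := [pred x : H | `[< exists i, x = h * expgz u i >]].
have PP h i : P (h * expgz u i) =1 P h.
  move=> x; apply/asboolP/asboolP => -[j ->].
    by exists (i + j)%R; rewrite expgzD mulgA.
  by exists (- i + j)%R; rewrite -mulgA -expgzD addNKr.
have Ph h : P h h by apply/asboolP; exists 0%R; rewrite mulg1.
(* [choose] returns the same element for all members of a coset; the coset of 1 is singled out to be
   represented by 1. *)
pose rep h := if P 1 h then 1 else choose (P h) h.
have repM h m : rep (h * expgz u m) = rep h.
  rewrite /rep; have -> : P 1 (h * expgz u m) = P 1 h.
    apply/asboolP/asboolP => -[i]; rewrite mul1g => hE.
      by exists (i - m)%R; rewrite mul1g expgzD -hE expgzN mulgK.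
    by exists (i + m)%R; rewrite mul1g expgzD -hE.
  case: ifP => // _; rewrite (eq_choose (PP h m)); apply: choose_id => //.
  by apply/asboolP; exists m.
have repE h : exists i, h = rep h * expgz u i.
  rewrite /rep; case: ifP => [/asboolP|_] //.
  have /asboolP[i ->] := chooseP (Ph h); exists (- i)%R.
  by rewrite -mulgA -expgzD subrr mulg1.
have [ex exE] := choice repE; exists rep, ex; split=> //.
  move=> h m; apply/eqP; rewrite -subr_eq0; apply/eqP/u_inf.
  have := exE (h * expgz u m); rewrite repM {1}(exE h) -mulgA => /mulgI e.
  by rewrite expgzD expgzN -e -expgzD mulgV.
by rewrite /rep Ph.
Qed.

End CyclicCosets.

(** The HNN extension of [H] with stable letter [s] and relation [s d s^-1 = c], given by its
    universal property and generation. *)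
Record hnn_group (H : groupType) (c d : H) (G : groupType)
    (j : {multiplicative H -> G}) (s : G) : Prop := HnnGroup {
  hnnP : s * j d = j c * s;
  hnn_lift : forall (L : groupType) (f : {multiplicative H -> L}) (y : L),
    y * f d = f c * y ->
    exists F : {multiplicative G -> L}, (forall h, F (j h) = f h) /\ F s = y;
  hnn_ind : forall P : G -> Prop, P 1 -> (forall h u, P u -> P (j h * u)) ->
    (forall u, P u -> P (s * u)) -> (forall u, P u -> P (s^-1 * u)) -> forall u, P u
}.

Section Britton.
Variables (H : groupType) (c d : H).
Hypotheses (c_inf : forall m, expgz c m = 1 -> m = 0%R).
Hypotheses (d_inf : forall m, expgz d m = 1 -> m = 0%R).

(* The letter (h, true) stands for h s and (h, false) for h s^-1. *)
Let letter := (H * bool)%type.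
(** As [c^i s = s d^i], the factor before [s] matters modulo powers of [c] on its right, and the
    factor before [s^-1] modulo powers of [d]. *)
Let base (b : bool) := if b then c else d.

Variables (rep : bool -> H -> H) (ex : bool -> H -> int).
Hypotheses (repE : forall b h, h = rep b h * expgz (base b) (ex b h))
  (repM : forall b h m, rep b (h * expgz (base b) m) = rep b h)
  (exM : forall b h m, ex b (h * expgz (base b) m) = (ex b h + m)%R)
  (rep1 : forall b, rep b 1 = 1).

Let base_inf b m : expgz (base b) m = 1 -> m = 0%R.
Proof. by case: b; [apply: c_inf | apply: d_inf]. Qed.

Let ex_rep b h : rep b h = h -> ex b h = 0%R.
Proof. by move=> e; apply: (@base_inf b); apply: (mulgI (rep b h)); rewrite -repE mulg1. Qed.

Let rep_base b m : rep b (expgz (base b) m) = 1.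
Proof. by rewrite -[expgz _ _]mul1g repM. Qed.

Let ex_base b m : ex b (expgz (base b) m) = m.
Proof. by rewrite -[expgz _ _]mul1g exM ex_rep ?add0r. Qed.

Let rep1_eq b m g : rep b g = g -> rep b (expgz (base b) m * g) = 1 -> g = 1.
Proof.
move=> gb e; have := repE b (expgz (base b) m * g); rewrite e mul1g => /esym e1.
have gE : g = expgz (base b) (- m + ex b (expgz (base b) m * g))%R.
  by rewrite expgzD e1 expgzN mulKg.
by rewrite -gb gE rep_base.
Qed.

(** Excludes pinches: a trivial representative between opposite powers of [s]. *)
Definition britton_ok (l m : letter) := ~~ ((m.1 == 1) && (m.2 == ~~ l.2)).
Definition britton_nf (w : seq letter) :=
  sorted britton_ok w && all (fun l => rep l.2 l.1 == l.1) w.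

(** Left multiplication by [h]: at each letter the representative is renormalized, and the leftover
    power of [base b] crosses the stable letter to become the same power of [base (~~ b)]. The
    second component is what comes out at the end of the word. *)
Fixpoint pass (h : H) (w : seq letter) : seq letter * H :=
  if w is (g, b) :: w' then
    let: (w2, k) := pass (expgz (base (~~ b)) (ex b (h * g))) w' in
    ((rep b (h * g), b) :: w2, k)
  else ([::], h).

Lemma passM h1 h2 w : pass (h1 * h2) w =
  ((pass h1 (pass h2 w).1).1, (pass h1 (pass h2 w).1).2 * (pass h2 w).2).
Proof.
elim: w h1 h2 => [|[g b] w IHw] h1 h2 //=.
have e : h1 * h2 * g = h1 * rep b (h2 * g) * expgz (base b) (ex b (h2 * g)).
  by rewrite -!mulgA -repE.
rewrite {}e repM exM expgzD IHw.
by case: (pass _ w) => w2 k2 /=; case: (pass _ w2) => w1 k1.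
Qed.

Lemma pass1 w : britton_nf w -> pass 1 w = (w, 1).
Proof.
elim: w => [|[g b] w IHw] //= /andP[sw /andP[/eqP gb aw]].
rewrite mul1g gb ex_rep // expgz0 IHw //.
by apply/andP; split; first exact: path_sorted sw.
Qed.

Lemma pass_head h g b w : pass h ((g, b) :: w) =
  ((rep b (h * g), b) :: (pass (expgz (base (~~ b)) (ex b (h * g))) w).1,
   (pass (expgz (base (~~ b)) (ex b (h * g))) w).2).
Proof. by rewrite /=; case: (pass _ w). Qed.

(** No pinch can appear: if a representative [g] becomes trivial after multiplication by a power of
    [base b], it was in the trivial coset and hence already 1. *)
Lemma pass_path l m w : path britton_ok l w ->
  all (fun l => rep l.2 l.1 == l.1) w ->
  forall g, path britton_ok (g, l.2) (pass (expgz (base (~~ l.2)) m) w).1.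
Proof.
elim: w l m => [|[g b] w IHw] [g0 b0] m // /andP[ok pw] /andP[/eqP gb aw] g1.
rewrite pass_head [path _ _ _]/= (IHw (g, b)) // andbT.
move: ok; rewrite /britton_ok /=; apply: contra => /andP[/eqP e /eqP bE].
by rewrite bE eqxx andbT; apply/eqP; move: e; rewrite -bE; apply: rep1_eq.
Qed.

Let repK b h : rep b (rep b h) = rep b h.
Proof. by rewrite [in RHS](repE b h) repM. Qed.

Lemma pass_all h w : all (fun l => rep l.2 l.1 == l.1) (pass h w).1.
Proof.
elim: w h => [|[g b] w IHw] h //; rewrite pass_head /= IHw andbT.
by rewrite repK.
Qed.

Lemma pass_nf h w : britton_nf w -> britton_nf (pass h w).1.
Proof.
case: w => [|[g b] w] //; rewrite /britton_nf pass_all andbT => /andP[sw /andP[_ aw]].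
by rewrite pass_head /=; apply: (pass_path (l := (g, b))).
Qed.

Definition push b (w : seq letter) : seq letter :=
  if w is (g, b') :: w' then if (g == 1) && (b' == ~~ b) then w' else (1, b) :: w
  else [:: (1, b)].

Lemma push_nf b w : britton_nf w -> britton_nf (push b w).
Proof.
rewrite /britton_nf; case: w => [|[g b'] w] /=; first by rewrite rep1 eqxx.
case: ifP => [_ | nc]; first by case/andP=> /path_sorted-> /andP[].
by rewrite /= rep1 eqxx /= => /andP[-> ->]; rewrite /britton_ok /= nc.
Qed.

Lemma pushK b w : britton_nf w -> push (~~ b) (push b w) = w.
Proof.
case: w => [|[g b'] w] /=; first by rewrite negbK !eqxx.
case: (boolP (_ && _)) => [/andP[/eqP-> /eqP->] | _]; last by rewrite /= negbK !eqxx.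
case: w => [|[g' b''] w] //; rewrite /britton_nf /= /britton_ok /= => /andP[/andP[/negPf-> _] _].
by [].
Qed.

(** The defining relation [s d = c s] on normal forms; the delicate case is the cancellation of [s]
    against a leading [s^-1]. *)
Lemma push_pass w : britton_nf w ->
  pass c (push true w) = (push true (pass d w).1, (pass d w).2).
Proof.
have rc : rep true c = 1 := rep_base true 1%R.
have rd : rep false d = 1 := rep_base false 1%R.
have ec : ex true c = 1%R := ex_base true 1%R.
have ed : ex false d = 1%R := ex_base false 1%R.
case: w => [|[g b] w] nf; first by rewrite /= mulg1 rc ec.
rewrite [push true _ in LHS]/=; case: (boolP (_ && _)) => [/andP[/eqP-> /eqP->] | nc].
  by rewrite pass_head /= mulg1 rd ed eqxx /=; case: (pass c w).
rewrite pass_head mulg1 rc ec expgz1 pass_head /=; case: ifP => // /andP[/eqP e /eqP bE].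
case/negP: nc; rewrite bE eqxx andbT; apply/eqP.
have /andP[_ /andP[/eqP gb _]] := nf; rewrite /= bE in e gb.
exact: (@rep1_eq false 1%R).
Qed.

(** A normal form of an element of [G]: the reduced word together with the last factor, in [H]. *)
Definition britton_state := ({w : seq letter | britton_nf w} * H)%type.

Definition fiber_act h (x : britton_state) : britton_state :=
  (exist _ (pass h (val x.1)).1 (pass_nf h (valP x.1)), (pass h (val x.1)).2 * x.2).

Definition stable_act b (x : britton_state) : britton_state :=
  (exist _ (push b (val x.1)) (push_nf b (valP x.1)), x.2).

Lemma fiber_actM h1 h2 x : fiber_act (h1 * h2) x = fiber_act h1 (fiber_act h2 x).
Proof.
by case: x => w k; congr pair; [apply: val_inj|]; rewrite /= passM ?mulgA.
Qed.

Lemma fiber_act1 x : fiber_act 1 x = x.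
Proof.
by case: x => w k; congr pair; [apply: val_inj|]; rewrite /= pass1 ?mul1g // (valP w).
Qed.

Lemma stable_actK b : cancel (stable_act b) (stable_act (~~ b)).
Proof. by case=> w k; congr pair; apply: val_inj; rewrite /= pushK // (valP w). Qed.

Variables (G : groupType) (j : {multiplicative H -> G}) (s : G).
Hypothesis hnn : hnn_group c d j s.

Let ev (x : britton_state) : G :=
  foldr (fun (l : letter) y => j l.1 * (if l.2 then s else s^-1) * y) (j x.2) (val x.1).

Let ev_fiber h x : ev (fiber_act h x) = j h * ev x.
Proof.
have hs := hnnP hnn; have sd : j d ^ s^-1 = j c by rewrite /conjg invgK mulgA hs mulgK.
have sc : j c ^ s = j d by rewrite -sd conjgKV.
have key b m : (if b then s else s^-1) * expgz (j (base (~~ b))) m =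
    expgz (j (base b)) m * (if b then s else s^-1).
  by case: b; rewrite [RHS]conjgC -expgzJ /= ?sc ?sd.
case: x => [[w wP] k]; rewrite /ev /=; clear wP.
elim: w h => [|[g b] w IHw] h; first by rewrite homM.
rewrite pass_head /= IHw !mulgA -[j h * j g]homM {3}(repE b (h * g)) homM !homXz.
by rewrite -!mulgA; congr (_ * _); rewrite !mulgA key.
Qed.

Let ev_stable b x : ev (stable_act b x) = (if b then s else s^-1) * ev x.
Proof.
case: x => [[[|[g b'] w] wP] k]; rewrite /ev /=; first by rewrite hom1 mul1g.
case: (boolP (_ && _)) => [/andP[/eqP-> /eqP->] | _]; last by rewrite /= hom1 mul1g.
by rewrite hom1 mul1g mulgA; case: b; rewrite /= ?mulgV ?mulVg mul1g.
Qed.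

(** The normal form of [z] is compared with those of its products. If it has a first letter, right
    multiplication by [H] leaves that letter alone, so left multiplication does too, which forces
    [H] to be cyclic. If it has none, [z] lies in [H] and commuting with [s] gives the first
    alternative. *)
Lemma britton_center z : in_center z ->
  [\/ exists i, z = j (expgz c i) /\ z = j (expgz d i),
      forall h, exists i, h = expgz c i | forall h, exists i, h = expgz d i].
Proof.
move=> zC.
have fK h : cancel (fiber_act h) (fiber_act h^-1).
  by move=> x; rewrite -fiber_actM mulVg fiber_act1.
have fVK h : cancel (fiber_act h^-1) (fiber_act h).
  by move=> x; rewrite -fiber_actM mulgV fiber_act1.
have PM : {morph (fun h => Perm (fK h) (fVK h)) : x y / x * y}.
  by move=> h1 h2; apply: perm_ext => x; rewrite permM /= fiber_actM.
have [F [Fj Fs]] : exists F : {multiplicative G -> perm_of britton_state},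
    (forall h, F (j h) = Perm (fK h) (fVK h)) /\
    F s = Perm (@stable_actK true) (@stable_actK false).
  apply: (hnn_lift hnn (f := hom_of PM)).
  apply: perm_ext => -[w k]; rewrite !permM /=; congr pair; first apply: val_inj.
    by rewrite /= push_pass ?(valP w).
  by rewrite /= push_pass ?(valP w).
have Fev u x : ev (F u x) = u * ev x.
  elim/(hnn_ind hnn): u x => [|h u IHu|u IHu|u IHu] x; rewrite ?hom1 ?mul1g // homM permM -mulgA.
  - by rewrite Fj /= ev_fiber IHu.
  - by rewrite Fs /= ev_stable IHu.
  by rewrite homV Fs permVE /= ev_stable IHu.
(* Right multiplication by [H], which commutes with the action of [G] and touches the last factor
   only. *)
pose shift k (x : britton_state) : britton_state := (x.1, x.2 * k).
have Fshift k u x : F u (shift k x) = shift k (F u x).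
  elim/(hnn_ind hnn): u x => [|h u IHu|u IHu|u IHu] x; rewrite ?hom1 ?perm1 // homM !permM IHu.
  - by rewrite Fj /= /shift /fiber_act /= mulgA.
  - by rewrite Fs.
  by rewrite homV Fs !permVE.
pose x0 : britton_state := (exist _ [::] isT, 1).
have Fzj h : F z (F (j h) x0) = fiber_act h (F z x0).
  by rewrite -permM -homM zC homM permM Fj.
have Fjx h : F (j h) x0 = shift h x0.
  by rewrite Fj; congr pair; [apply: val_inj | rewrite /= mulg1 mul1g].
have zE : z = ev (F z x0) by rewrite Fev /ev /= hom1 mulg1.
case E: (F z x0) => [[[|[g b] w] wP] k]; last first.
  have key h : rep b (h * g) = g.
    have := Fzj h; rewrite Fjx Fshift E => /(congr1 (fun x : britton_state => val x.1)).
    move=> e; have : (g, b) :: w = (pass h ((g, b) :: w)).1 := e.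
    by rewrite pass_head => -[/esym].
  (* Apply [key] to [g h g^-1]: from [g h] having representative [g], the element [h] is a power of
     [base b]. *)
  have gen h : exists i, h = expgz (base b) i.
    exists (ex b (g * h * g^-1 * g)); apply: (mulgI g).
    by rewrite -{2}(key (g * h * g^-1)) -repE mulgVK.
  by case: (b) gen => gen; [apply: Or32 | apply: Or33].
(* Now [z = j k], and the normal forms of [z s] and [s z] show that [k] is a power of [c] and equals
   the same power of [d]. *)
apply: Or31; rewrite E /ev /= in zE.
have := Fev s x0; have : F z (F s x0) = F s (F z x0) by rewrite -!permM -!homM zC.
have -> : F s x0 = (exist _ [:: (1, true)] (push_nf true (valP x0.1)), 1).
  by rewrite Fs; congr pair; apply: val_inj.
set x1 := (_, 1); have x1E : x1 = F s x0.
  by rewrite Fs; congr pair; apply: val_inj.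
have -> : F z x1 = fiber_act k x1.
  have -> : F z = F (j k) by rewrite -zE.
  by rewrite Fj.
rewrite E Fs /= => e _.
have e1 := congr1 (fun x : britton_state => val x.1) e.
have e2 := congr1 (fun x : britton_state => x.2) e.
move: e1 e2; rewrite /= !mulg1 => -[rk] kE.
exists (ex true k); split; rewrite zE; congr (j _); last by rewrite kE.
by rewrite {1}(repE true k) rk mul1g.
Qed.

End Britton.

Theorem hnn_center (H : groupType) (c d : H) (G : groupType)
    (j : {multiplicative H -> G}) (s z : G) :
  (forall m, expgz c m = 1 -> m = 0%R) -> (forall m, expgz d m = 1 -> m = 0%R) ->
  hnn_group c d j s -> in_center z ->
  [\/ exists i, z = j (expgz c i) /\ z = j (expgz d i),
      forall h, exists i, h = expgz c i | forall h, exists i, h = expgz d i].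
Proof.
move=> c_inf d_inf hnn zC.
have [repc [exc [c1 c2 c3 c4]]] := cyclic_coset_rep c_inf.
have [repd [exd [d1 d2 d3 d4]]] := cyclic_coset_rep d_inf.
apply: (@britton_center H c d c_inf d_inf (fun b => if b then repc else repd)
  (fun b => if b then exc else exd) _ _ _ _ G j s hnn z zC) => -[] //.
Qed.

(** * The modulus *)

Local Open Scope int_scope.
Local Open Scope group_scope.

Section RatPermutations.
Implicit Types (b m x : rat).

Lemma exists_translation b : exists f : perm_of rat, forall x, f x = (x + b)%R.
Proof.
have bK : cancel (fun x => x + b)%R (fun x => x - b)%R by move=> x; rewrite addrK.
have bVK : cancel (fun x => x - b)%R (fun x => x + b)%R by move=> x; rewrite subrK.
by exists (Perm bK bVK).
Qed.

Lemma exists_scaling m : m != 0%R -> exists f : perm_of rat, forall x, f x = (m * x)%R.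
Proof.
move=> m0; have mK : cancel ( *%R m) ( *%R m^-1) by move=> x; rewrite mulKf.
have mVK : cancel ( *%R m^-1) ( *%R m) by move=> x; rewrite mulVKf.
by exists (Perm mK mVK).
Qed.

Lemma translationX (f : perm_of rat) b k : (forall x, f x = (x + b)%R) ->
  forall x, expgz f k x = (x + k%:~R * b)%R.
Proof.
move=> fb; have fV x : f^-1 x = (x - b)%R.
  by apply: (can_inj (permVK f)); rewrite permKV fb subrK.
elim: k => [|k IHk|k IHk] x; first by rewrite mul0r addr0 perm1.
  by rewrite PoszSr expgz_succ permM fb IHk intrD mulrDl mul1r -addrA [(b + _)%R]addrC.
rewrite PoszSr opprD expgz_pred permM fV IHk intrD mulrDl mulN1r -addrA.
by rewrite [(- b + _)%R]addrC.
Qed.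

Lemma scalingXn (f : perm_of rat) m k : (forall x, f x = (m * x)%R) ->
  forall x, (f ^+ k) x = (m ^+ k * x)%R.
Proof.
move=> fm; elim: k => [|k IHk] x; first by rewrite mul1r.
by rewrite expgS permM IHk fm exprS mulrA.
Qed.

Lemma scalingV (f : perm_of rat) m : (forall x, f x = (m * x)%R) -> m != 0%R ->
  forall x, f^-1 x = (m^-1 * x)%R.
Proof.
by move=> fm m0 x; apply: (can_inj (permVK f)); rewrite permKV fm mulVKf.
Qed.

End RatPermutations.

Lemma gbs_hom_ext (V E : finType) (src tgt : E -> V) p q T D (G L : groupType)
    (a : V -> G) (t : E -> G) (f g : {multiplicative G -> L}) :
  gbs_group src tgt p q T D a t -> (forall v, f (a v) = g (a v)) ->
  (forall e, f (t e) = g (t e)) -> f =1 g.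
Proof.
move=> [_ _ ind] fa ft; elim/ind => [|v u IHu|v u IHu|e u IHu|e u IHu];
by rewrite ?hom1 // !homM ?homV IHu ?fa ?ft.
Qed.

(** Restoring the letter of [e0] to the presentation without this edge has the universal property of
    an HNN extension. *)
Lemma gbs_hnn (V E : finType) (src tgt : E -> V) p q (T : {set E}) (G : groupType)
    (a : V -> G) (t : E -> G) e0 :
  gbs_group src tgt p q T setT a t -> e0 \notin T ->
  exists (H : groupType) (c d : H) (j : {multiplicative H -> G}),
    [/\ hnn_group c d j (t e0), j c = expgz (a (src e0)) (p e0)
      & j d = expgz (a (tgt e0)) (q e0)].
Proof.
move=> gG e0T; have [[r1 r2 _] lift ind] := gG.
have [H [aH [tH gH]]] := gbs_group_ex src tgt p q T (setT :\ e0).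
have [[rH1 rH2 rH3] liftH _] := gH.
have tH0 : tH e0 = 1 by apply: rH3; rewrite !inE eqxx.
have [j [ja jt]] : exists f : {multiplicative H -> G}, (forall v, f (aH v) = a v) /\
    forall e, f (tH e) = if e == e0 then 1 else t e.
  apply: liftH; split=> e.
  - by rewrite !inE andbT => /negPf->; apply: r1; rewrite inE.
  - by move=> eT; case: ifP => // _; apply: r2.
  by rewrite !inE andbT negbK => ->.
exists H, (expgz (aH (src e0)) (p e0)), (expgz (aH (tgt e0)) (q e0)), j.
split; rewrite ?homXz ?ja //; split.
- by rewrite !homXz !ja; apply: r1; rewrite inE.
- move=> L f y yfd.
  have [F [Fa Ft]] : exists F : {multiplicative G -> L}, (forall v, F (a v) = f (aH v)) /\
      forall e, F (t e) = if e == e0 then y else f (tH e).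
    apply: lift; split=> e; last by rewrite inE.
      move=> _; case: eqP => [->|/eqP ne]; first by rewrite -!homXz.
      by rewrite -!homXz -!homM rH1 // !inE ne.
    by move=> eT; case: eqP => [e_e0|_]; [rewrite -e_e0 eT in e0T | rewrite rH2 ?hom1].
  exists F; split; last by rewrite Ft eqxx.
  apply: (gbs_hom_ext (f := [the {multiplicative _ -> _} of F \o j]) gH) => [v|e] /=.
    by rewrite ja Fa.
  by rewrite jt; case: eqP => [->|/eqP ne]; rewrite ?hom1 ?tH0 ?hom1 // Ft (negPf ne).
move=> P P1 Pj Ps PsV; apply: ind => // [v u|v u|e u|e u].
- by rewrite -ja; apply: Pj.
- by rewrite -ja -homV; apply: Pj.
- case: (eqVneq e e0) => [->|ne]; first exact: Ps.
  by have := jt e; rewrite (negPf ne) => <-; apply: Pj.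
case: (eqVneq e e0) => [->|ne]; first exact: PsV.
by have := jt e; rewrite (negPf ne) => <-; rewrite -homV; apply: Pj.
Qed.

Section Affine.
Variables (V E : finType) (src tgt : E -> V) (p q : E -> int) (T : {set E}).
Variables (G : groupType) (a : V -> G) (t : E -> G).
Hypothesis gG : gbs_group src tgt p q T setT a t.
Hypothesis pq0 : forall e, p e <> 0%R /\ q e <> 0%R.

Lemma rational_potential v0 : tree_on src tgt v0 setT T ->
  exists r : V -> rat, (forall v, r v != 0%R) /\
    forall e, e \in T -> ((p e)%:~R * r (src e) = (q e)%:~R * r (tgt e))%R.
Proof.
move=> TP; have pr0 e : ((p e)%:~R != 0 :> rat)%R by rewrite intr_eq0; apply/eqP; have [] := pq0 e.
have qr0 e : ((q e)%:~R != 0 :> rat)%R by rewrite intr_eq0; apply/eqP; have [] := pq0 e.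
have [|r [r0 rT]] := @tree_potential _ _ src tgt v0 rat
  (fun e y => y * (p e)%:~R / (q e)%:~R)%R (fun e y => y * (q e)%:~R / (p e)%:~R)%R 1%R _ _ _ TP.
  by move=> e y; rewrite mulfVK // mulfK.
exists r; split=> [v|e eT]; last by rewrite rT // mulrC [RHS]mulrC mulfVK.
apply: (tree_prop TP (P := fun v => r v != 0%R)); rewrite ?r0 ?inE // => e eT.
by rewrite rT // !mulf_eq0 invr_eq0 (negPf (pr0 e)) (negPf (qr0 e)) !orbF.
Qed.

Variable r : V -> rat.
Hypothesis r0 : forall v, r v != 0%R.
Hypothesis rT : forall e, e \in T -> ((p e)%:~R * r (src e) = (q e)%:~R * r (tgt e))%R.

(** Vertex generators translate by their potential and stable letters scale by the modulus of their
    edge, equal to 1 on the tree. The action shows that vertex generators have infinite order and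
    makes the modulus computable. *)
Lemma affine_rep : exists rho : {multiplicative G -> perm_of rat},
  (forall v x, rho (a v) x = (x + r v)%R) /\
  (forall e x, rho (t e) x = (((p e)%:~R * r (src e)) / ((q e)%:~R * r (tgt e)) * x)%R).
Proof.
have pr0 e : ((p e)%:~R != 0 :> rat)%R by rewrite intr_eq0; apply/eqP; have [] := pq0 e.
have qr0 e : ((q e)%:~R != 0 :> rat)%R by rewrite intr_eq0; apply/eqP; have [] := pq0 e.
have [ta taE] := choice (fun v => exists_translation (r v)).
pose Delta e : rat := (((p e)%:~R * r (src e)) / ((q e)%:~R * r (tgt e)))%R.
have D0 e : Delta e != 0%R by rewrite mulf_neq0 ?invr_eq0 ?mulf_neq0.
have [ts tsE] := choice (fun e => exists_scaling (D0 e)).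
have [f [fa ft]] : exists f : {multiplicative G -> perm_of rat},
    (forall v, f (a v) = ta v) /\ forall e, f (t e) = ts e.
  apply: (gbs_lift gG); split=> e; last by rewrite inE.
    move=> _; apply: perm_ext => x; rewrite !permM (translationX _ (taE _)).
    rewrite (translationX _ (taE _)) !tsE mulrDr; congr (_ + _)%R.
    by rewrite mulfVK // mulf_neq0.
  move=> eT; apply: perm_ext => x; rewrite perm1 tsE /Delta rT // mulfV ?mul1r //.
  by rewrite mulf_neq0.
by exists f; split=> [v|e] x; rewrite ?fa ?ft.
Qed.

End Affine.

(* G = < C, s | s^-1 C s = C^m >, embedded in the affine group by rho. *)
Lemma solvable_BS_center (G : groupType) (C s z : G) (m : int) (gamma : rat)
    (rho : {multiplicative G -> perm_of rat}) (h : G -> int) :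
  (forall P : G -> Prop, P 1 -> (forall i u, P u -> P (expgz C i * u)) ->
    (forall u, P u -> P (s * u)) -> (forall u, P u -> P (s^-1 * u)) -> forall u, P u) ->
  C ^ s = expgz C m -> m != 1%R -> m != 0%R -> gamma != 0%R ->
  (forall x, rho C x = (x + gamma)%R) -> (forall x, rho s x = (m%:~R^-1 * x)%R) ->
  zhom h -> h C = 0%R -> h s = 1%R ->
  in_center z -> z <> 1 -> elementary G.
Proof.
move=> ind Cs m1 m0 g0 rC rs hM hC hs zC z1.
have mr0 : (m%:~R != 0 :> rat)%R by rewrite intr_eq0.
have Cinf i : expgz C i = 1 -> i = 0%R.
  move=> Ci; have := translationX i rC 0%R; rewrite -homXz Ci hom1 perm1 add0r.
  by move=> /esym/eqP; rewrite mulf_eq0 (negPf g0) orbF intr_eq0 => /eqP.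
(* For [m = -1] the powers of [C] form the kernel of [h], a fibre of rank one. *)
have [mN1 | mN1] := eqVneq m (-1)%R.
  have [psi psiE] := free_lift (fun _ : 'I_1 => C).
  have Cs' : C ^ s^-1 = C^-1.
    by apply: (conjg_inj s); rewrite conjgKV conjVg Cs mN1 invgK.
  have sE (u : G) : exists i k, u = expgz C i * expgz s k.
    elim/ind: u => [|i u [i' [k ->]]|u [i [k ->]]|u [i [k ->]]].
    - by exists 0%R, 0%R; rewrite mulg1.
    - by exists (i + i')%R, k; rewrite expgzD mulgA.
    - exists (- i)%R, (1 + k)%R; rewrite expgzD !mulgA expgz1; congr (_ * _).
      by rewrite conjgCV -expgzJ Cs' -[C^-1]/(expgz C (-1)) -expgzM mulN1r.
    exists (- i)%R, (-1 + k)%R; rewrite expgzD !mulgA; congr (_ * _).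
    by rewrite conjgCV invgK -expgzJ Cs mN1 -expgzM mulN1r.
  have fib : fibered h psi.
    split=> //; first by exists s.
      apply: hom_inj => w; have [i ->] := free_rank1 w.
      by rewrite homXz psiE => /Cinf->.
    move=> x; split=> [x0|[w <-]].
      have [i [k xE]] := sE x; exists (expgz (free_gen ord0) i); rewrite homXz psiE xE.
      move: x0; rewrite xE hM !zhomXz // hC hs mulr0 add0r mulr1 => ->.
      by rewrite mulg1.
    by have [i ->] := free_rank1 w; rewrite homXz psiE zhomXz // hC mulr0.
  exact: fibered1_elementary fib hs.
have form (u : G) : exists (i k : nat) j, u = s ^+ i * expgz C j * s ^- k.
  elim/ind: u => [|i u [i' [k [j ->]]]|u [i [k [j ->]]]|u [i [k [j ->]]]].
  - by exists 0%N, 0%N, 0%R; rewrite !expg0 expgz0 invg1 !mulg1.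
  - have [i2 e] : exists i2, expgz C i ^ (s ^+ i') = expgz C i2.
      elim: i' => [|i' [i2 IH]]; first by exists i; rewrite conjg1.
      by exists (m * i2)%R; rewrite expgSr conjgM IH -expgzJ Cs expgzM.
    by exists i', k, (i2 + j)%R; rewrite !mulgA [_ * s ^+ i']conjgC e -(mulgA (s ^+ i')) -expgzD.
  - by exists i.+1, k, j; rewrite expgS !mulgA.
  case: i => [|i]; last by exists i, k, j; rewrite expgS -!mulgA mulKg.
  exists 0%N, k.+1, (m * j)%R; rewrite !expg0 !mul1g expgzM -Cs expgzJ expgSr invgM.
  by rewrite /conjg -!mulgA mulVKg.
have [i [k [j zE]]] := form z.
have rz x : rho z x = (m%:~R^-1 ^+ i * (m%:~R ^+ k * x + j%:~R * gamma))%R.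
  rewrite zE !homM homXz homV !homXn !permM (scalingXn _ rs) (translationX _ rC).
  congr (_ * (_ + _))%R; have e0 : (m%:~R^-1 != 0 :> rat)%R by rewrite invr_eq0.
  by rewrite (scalingV (scalingXn k rs)) ?expf_neq0 // exprVn invrK.
have mi0 : (m%:~R^-1 ^+ i != 0 :> rat)%R by rewrite expf_neq0 ?invr_eq0.
(* Commuting with a non-trivial translation forces the slope [m^(k - i)] to be 1, and [m] has
   absolute value at least 2. *)
have ki : k = i.
  have := congr1 (fun f : perm_of rat => f 0%R) (congr1 rho (zC C)).
  rewrite !homM !permM rC !rz rC add0r mulr0 add0r !mulrDr => /eqP.
  rewrite [eqbRHS]addrC (inj_eq (addIr _)).
  rewrite mulrA -[eqbRHS]mul1r (inj_eq (mulIf g0)).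
  rewrite exprVn mulrC -(inj_eq (mulIf (expf_neq0 i mr0))) mul1r mulfVK ?expf_neq0 //.
  rewrite -!rmorphXn /= eqr_int => /eqP mki.
  have /eqP := congr1 absz mki; rewrite !abszX eqn_exp2l; first by move/eqP.
  by case: (m) m0 m1 mN1 => [[|[|?]]|[|?]].
(* An affine map commuting with a scaling by a factor other than 1 fixes 0, so its translation part
   vanishes. *)
have j0 : j = 0%R.
  have := congr1 (fun f : perm_of rat => f 0%R) (congr1 rho (zC s)).
  rewrite !homM !permM rs !rz rs !mulr0 !add0r; set c := (_ * _)%R => /eqP.
  rewrite -subr_eq0 -{1}[c]mul1r -mulrBl mulf_eq0 subr_eq0 => /orP[/eqP e|].
    by case/eqP: m1; apply/eqP; rewrite -(eqr_int rat) -[(m%:~R)%R]invrK -e invr1.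
  by rewrite !mulf_eq0 (negPf mi0) (negPf g0) orbF intr_eq0 => /eqP.
by case: z1; rewrite zE ki j0 expgz0 mulg1 mulgV.
Qed.

(* The centre of an HNN extension along infinite cyclic subgroups with
   non-trivial modulus can only survive when the base is itself cyclic, and
   then the group is a solvable Baumslag-Solitar group. *)
Theorem modular_trivial (V E : finType) (src tgt : E -> V) (p q : E -> int)
    (T : {set E}) v0 (G : groupType) (a : V -> G) (t : E -> G) :
  gbs_group src tgt p q T setT a t -> tree_on src tgt v0 setT T ->
  (forall e, p e <> 0%R /\ q e <> 0%R) ->
  ~ elementary G -> (exists z : G, in_center z /\ z <> 1) ->
  exists r : V -> rat, (forall v, r v != 0%R) /\
    forall e, ((p e)%:~R * r (src e) = (q e)%:~R * r (tgt e))%R.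
Proof.
move=> gG TP pq0 nel [z [zC z1]].
have [r [r0 rT]] := rational_potential pq0 TP; exists r; split=> // e.
apply: contrapT => /eqP De; apply: nel.
have eT : e \notin T by apply: contraNN De => /rT->.
have pr0 : ((p e)%:~R != 0 :> rat)%R by rewrite intr_eq0; apply/eqP; have [] := pq0 e.
have qr0 : ((q e)%:~R != 0 :> rat)%R by rewrite intr_eq0; apply/eqP; have [] := pq0 e.
have [rho [rhoa rhot]] := affine_rep gG pq0 r0 rT.
have [H [c [d [j [hnn jc jd]]]]] := gbs_hnn gG eT.
set s := t e in hnn; set gc := (_ * _)%R in De; set gd := (_ * _)%R in De.
have gc0 : gc != 0%R by rewrite mulf_neq0.
have gd0 : gd != 0%R by rewrite mulf_neq0.
have rc x : rho (j c) x = (x + gc)%R by rewrite jc homXz (translationX _ (rhoa _)).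
have rd x : rho (j d) x = (x + gd)%R by rewrite jd homXz (translationX _ (rhoa _)).
have rs x : rho s x = (gc / gd * x)%R by rewrite rhot.
(* Britton's lemma needs [c] and [d] of infinite order in [H]; the affine action provides it. *)
have inf u g m : g != 0%R -> (forall x, rho (j u) x = (x + g)%R) ->
    expgz u m = 1 -> m = 0%R.
  move=> g0 ru um; have := translationX m ru 0%R.
  rewrite -!homXz um !hom1 perm1 add0r => /esym/eqP.
  by rewrite mulf_eq0 (negPf g0) orbF intr_eq0 => /eqP.
have [h [hj hs]] : exists h : {multiplicative G -> Zgroup},
    (forall u, h (j u) = 1) /\ h s = (1%R : int).
  have cM : {morph (fun _ : H => 1 : Zgroup) : x y / x * y} by move=> x y; rewrite mulg1.
  by have [//|h [hj hs]] := hnn_lift hnn (f := hom_of cM) (y := 1%R : Zgroup); exists h.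
have hM : zhom (h : G -> int) by move=> x y; apply: (homM h x y).
have hsc : s * j d = j c * s := hnnP hnn.
(* In the first case [z] translates both by [i * gc] and by [i * gd]; these constants differ, so
   [i = 0]. Otherwise the base is generated by [c] or by [d]. *)
have [[i [zc zd]]|gen|gen] := hnn_center (fun m => inf c gc m gc0 rc) (fun m => inf d gd m gd0 rd) hnn zC.
- case: z1; rewrite zc; suff -> : i = 0%R by rewrite hom1.
  have := congr1 (fun u => rho u 0%R) (etrans (esym zc) zd).
  rewrite !homXz (translationX _ rc) (translationX _ rd) !add0r => /eqP.
  rewrite -subr_eq0 -mulrBr mulf_eq0 subr_eq0 (negPf De) orbF intr_eq0.
  by move/eqP.
- have [m dE] := gen d.
  have gdE : gd = (m%:~R * gc)%R.
    by have := rd 0%R; rewrite dE homXz homXz (translationX _ rc) !add0r.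
  have m0 : m != 0%R by apply: contraNneq gd0 => m0; rewrite gdE m0 mul0r.
  apply: (@solvable_BS_center G (j c) s z m gc rho h) => //.
  + move=> P P1 Pc Ps PsV; apply: (hnn_ind hnn) => // u w Pw.
    by have [i ->] := gen u; rewrite homXz; apply: Pc.
  + by rewrite -homXz -dE /conjg -hsc mulKg.
  + by apply: contraNneq De => m1; rewrite gdE m1 mul1r.
  by move=> x; rewrite rs gdE invfM mulrCA mulfV // mulr1.
(* A base generated by [d] is treated like the previous case, with the stable letter inverted and
   the sign of the height changed. *)
have [m cE] := gen c.
have gcE : gc = (m%:~R * gd)%R.
  by have := rc 0%R; rewrite cE homXz homXz (translationX _ rd) !add0r.
have m0 : m != 0%R by apply: contraNneq gc0 => m0; rewrite gcE m0 mul0r.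
have mr0 : (m%:~R != 0 :> rat)%R by rewrite intr_eq0.
apply: (@solvable_BS_center G (j d) s^-1 z m gd rho (fun x => - h x)%R) => //.
- move=> P P1 Pd Ps PsV; apply: (hnn_ind hnn) => // [u w Pw | u Pu].
    by have [i ->] := gen u; rewrite homXz; apply: Pd.
  by rewrite -[s]invgK; apply: PsV.
- by rewrite -homXz -cE /conjg invgK mulgA hsc mulgK.
- by apply: contraNneq De => m1; rewrite gcE m1 mul1r.
- move=> x; rewrite homV (scalingV rs); last by rewrite mulf_neq0 ?invr_eq0.
  by rewrite gcE mulfK.
- by move=> x y; rewrite hM opprD.
- by rewrite [h _](hj d) oppr0.
by rewrite [h _](zhomV hM) opprK [h s]hs.
Qed.

(** * Kernels of homomorphisms to Z *)

Section IntegerResidues.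
Variables (d : int) (d0 : d <> 0%R).

Lemma residue_subproof i : `|(i %% d)%Z|%N < `|d|%N.
Proof.
have d0' : d != 0%R by apply/eqP.
by rewrite -ltz_nat !abszE (ger0_norm (modz_ge0 i d0')) ltz_mod.
Qed.

Definition residue i : 'I_(`|d|%N) := Ordinal (residue_subproof i).

Lemma residueE i : (residue i)%:Z = (i %% d)%Z.
Proof.
have d0' : d != 0%R by apply/eqP.
by rewrite /= abszE ger0_norm // modz_ge0.
Qed.

Lemma residueP i j : residue i = residue j <-> exists m, j = (i + m * d)%R.
Proof.
split=> [/(congr1 (fun x : 'I__ => x%:Z)) | [m ->]].
  rewrite !residueE => e; exists ((j %/ d)%Z - (i %/ d)%Z)%R.
  by rewrite {1}(divz_eq j d) {1}(divz_eq i d) e; ring.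
by apply/val_inj; rewrite /= addrC modzMDl.
Qed.

Lemma residueK (x : 'I_(`|d|%N)) : residue x%:Z = x.
Proof.
apply/val_inj/eqP; rewrite -eqz_nat residueE; apply/eqP.
by rewrite -modz_abs modz_small // ltz_nat ltn_ord.
Qed.

End IntegerResidues.

Lemma mulgVeq (G : groupType) (x y z : G) : x * y / z = z^-1 <-> x = y^-1.
Proof.
split=> [e|->]; last by rewrite mulVg mul1g.
by apply: (mulIg y); apply: (mulIg z^-1); rewrite e mulVg mul1g.
Qed.

Section KernelFree.
Variables (V E : finType) (src tgt : E -> V) (p q : E -> int) (T : {set E}) (v0 : V).
Variables (G : groupType) (a : V -> G) (t : E -> G) (lam : G -> int).
Hypotheses (gG : gbs_group src tgt p q T setT a t) (TP : tree_on src tgt v0 setT T).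
Hypothesis pq0 : forall e, p e <> 0%R /\ q e <> 0%R.
Hypotheses (lamM : zhom lam) (lam_surj : exists x, lam x = 1%R).
Hypothesis lam0 : forall v, lam (a v) <> 0%R.

(** Height of the generator of the edge group; [mu_tgt] computes it from the other end. *)
Let mu e : int := (lam (a (src e)) * p e)%R.

Let rel e : t e * expgz (a (tgt e)) (q e) = expgz (a (src e)) (p e) * t e.
Proof. by have [r1 _ _] := gbsP gG; apply: r1; rewrite inE. Qed.

Let mu_tgt e : mu e = (lam (a (tgt e)) * q e)%R.
Proof.
have := congr1 lam (rel e); rewrite !lamM !zhomXz // [RHS]addrC => /addrI e1.
by rewrite /mu [LHS]mulrC -e1 mulrC.
Qed.

Let mu0 e : mu e <> 0%R.
Proof.
move=> /eqP; rewrite mulf_eq0 => /orP[] /eqP; first exact: lam0.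
by have [] := pq0 e.
Qed.

Let relX e m : t e * expgz (a (tgt e)) (q e * m) = expgz (a (src e)) (p e * m) * t e.
Proof.
have cj : expgz (a (src e)) (p e) ^ t e = expgz (a (tgt e)) (q e).
  by rewrite /conjg -rel mulKg.
by rewrite !expgzM -cj expgzJ -conjgC.
Qed.

Let tT e : e \in T -> t e = 1. Proof. by have [_ r2 _] := gbsP gG; apply: r2. Qed.
Let lamT e : e \in T -> lam (t e) = 0%R. Proof. by move/tT->; rewrite zhom1. Qed.

(* The quotient graph of the Bass-Serre tree by the kernel of lam: its vertices
   over v are the residues modulo lam (a v), its edges over e those modulo
   mu e. *)
Let VG : finType := {v : V & 'I_(`|lam (a v)|%N)}.
Let EG : finType := {e : E & 'I_(`|mu e|%N)}.
Let vcls v i : VG := Tagged (fun v => 'I_(`|lam (a v)|%N)) (residue (@lam0 v) i).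
Let ecls e i : EG := Tagged (fun e => 'I_(`|mu e|%N)) (residue (@mu0 e) i).
Let vrep (x : VG) : int := (tagged x : nat)%:Z.
Let erep (x : EG) : int := (tagged x : nat)%:Z.
(** The basic edge over [e] joins the coset of 1 at [src e] to the coset of [t e] at [tgt e], whence
    the shift by [lam (t e)] at the target. *)
Let gsrc (x : EG) := vcls (src (tag x)) (erep x).
Let gtgt (x : EG) := vcls (tgt (tag x)) (erep x + lam (t (tag x)))%R.

Let vclsD v i m : vcls v (i + m * lam (a v))%R = vcls v i.
Proof. by congr Tagged; apply/esym/residueP; exists m. Qed.

Let eclsD e i m : ecls e (i + m * mu e)%R = ecls e i.
Proof. by congr Tagged; apply/esym/residueP; exists m. Qed.

Let vrepK x : vcls (tag x) (vrep x) = x.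
Proof. by case: x => v i; rewrite /vcls /vrep /= residueK. Qed.

Let erepK x : ecls (tag x) (erep x) = x.
Proof. by case: x => e i; rewrite /ecls /erep /= residueK. Qed.

Let vrepE v i : vrep (vcls v i) = (i %% lam (a v))%Z.
Proof. exact: residueE. Qed.

Let erepE e i : exists m, i = (erep (ecls e i) + m * mu e)%R.
Proof.
exists (i %/ mu e)%Z; rewrite /erep /= -[X in (X + _)%R]/((residue (@mu0 e) i)%:Z) residueE.
by rewrite addrC -divz_eq.
Qed.

Let gsrcE e i : gsrc (ecls e i) = vcls (src e) i.
Proof.
have [m {2}->] := erepE e i; rewrite /gsrc /= /mu.
by rewrite [(lam _ * _)%R]mulrC mulrA vclsD.
Qed.

Let gtgtE e i : gtgt (ecls e i) = vcls (tgt e) (i + lam (t e))%R.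
Proof.
have [m {2}->] := erepE e i; rewrite /gtgt /= mu_tgt.
by rewrite [(lam _ * _)%R]mulrC mulrA addrAC vclsD.
Qed.

Let root : VG := vcls v0 0%R.

(** For a set crossed by no edge, moving along copies of [T] keeps the residue index, so membership
    is decided over [v0]; there it is unchanged by adding the height of a generator, hence of any
    element, and [lam] is onto. *)
Lemma quotient_graph_connected (S : {set VG}) :
  root \in S -> S != setT -> exists2 x, x \in [set: EG] & crosses gsrc gtgt S x.
Proof.
move=> rS /eqP S_T; apply: contrapT => ncr; apply: S_T.
have hE e i : (vcls (src e) i \in S) = (vcls (tgt e) (i + lam (t e))%R \in S).
  apply/eqP/negPn/negP => cr; apply: ncr; exists (ecls e i); rewrite ?inE //.
  by rewrite /crosses gsrcE gtgtE.
have h0 v i : (vcls v i \in S) = (vcls v0 i \in S).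
  move: v (in_setT v) i.
  apply: (tree_prop TP (P := fun v => forall i, (vcls v i \in S) = (vcls v0 i \in S))) => // e eT.
  have hT i : (vcls (src e) i \in S) = (vcls (tgt e) i \in S).
    by rewrite hE lamT // addr0.
  by split=> h i; rewrite -h hT.
have hg g i : (vcls v0 (i + lam g)%R \in S) = (vcls v0 i \in S).
  have hv v j : (vcls v0 (j + lam (a v))%R \in S) = (vcls v0 j \in S).
    by rewrite -!(h0 v) -[lam (a v)]mul1r vclsD.
  have he e j : (vcls v0 (j + lam (t e))%R \in S) = (vcls v0 j \in S).
    by rewrite -(h0 (src e) j) hE h0.
  elim/(gbs_ind gG): g i => [|v u IHu|v u IHu|e u IHu|e u IHu] i.
  - by rewrite zhom1 // addr0.
  - by rewrite lamM addrCA addrC hv IHu.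
  - by rewrite lamM zhomV // addrCA addrC -[LHS](hv v) subrK IHu.
  - by rewrite lamM addrCA addrC he IHu.
  by rewrite lamM zhomV // addrCA addrC -[LHS](he e) subrK IHu.
apply/setP => x; rewrite inE -(vrepK x) h0; have [g1 lg1] := lam_surj.
have := hg (expgz g1 (vrep x)) 0%R; rewrite zhomXz // lg1 mulr1 add0r => ->.
by rewrite -/root rS.
Qed.

Section QuotientTree.
Variables (TG : {set EG}).
Hypothesis TGP : tree_on gsrc gtgt root setT TG.

(** A property of [v] and [i] periodic modulo [lam (a v)] is one of vertices of the quotient graph,
    so it propagates along the spanning tree. *)
Lemma tree_residue_ind (P : V -> int -> Prop) :
  (forall v i m, P v (i + m * lam (a v))%R <-> P v i) -> P v0 0%R ->
  (forall e i, ecls e i \in TG -> P (src e) i <-> P (tgt e) (i + lam (t e))%R) ->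
  forall v i, P v i.
Proof.
move=> PD P0 PT; have PE v i : P v (vrep (vcls v i)) <-> P v i.
  by rewrite vrepE -(PD v _ (i %/ lam (a v))%Z) addrC -divz_eq.
suff Px x : P (tag x) (vrep x) by move=> v i; apply/PE/(Px (vcls v i)).
move: x (in_setT x); apply: (tree_prop TGP (P := fun x => P (tag x) (vrep x))) => [|x xT].
  exact/PE.
rewrite (PE (src (tag x)) (erep x)) (PE (tgt (tag x)) (erep x + lam (t (tag x)))%R).
by apply: PT; rewrite erepK.
Qed.

Let B : finType := {x : EG | x \notin TG}.
Let L : groupType := free_group B.
Let fG (x : EG) : L := if insub x is Some b then free_gen (b : B) else 1.
Let f e i : L := fG (ecls e i).

Let fT e i : ecls e i \in TG -> f e i = 1.
Proof. by move=> xT; rewrite /f /fG insubF ?xT. Qed.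

Let fD e i m : f e (i + m * mu e)%R = f e i.
Proof. by rewrite /f eclsD. Qed.

(** [g i v] is the word read from [v0] to [v] along the copy of [T] at height [i]; edges of that
    copy may lie outside [TG]. *)
Variable g : int -> V -> L.
Hypothesis g_root : forall i, g i v0 = 1.
Hypothesis gT : forall i e, e \in T -> g i (tgt e) = g i (src e) * f e i.

Let theta_map v (x : int * L) : int * L := (x.1, g x.1 v * x.2).
Let thetaV_map v (x : int * L) : int * L := (x.1, (g x.1 v)^-1 * x.2).
Let edge_map e (x : int * L) : int * L :=
  ((x.1 - lam (t e))%R, f e (x.1 - lam (t e))%R * x.2).
Let edgeV_map e (x : int * L) : int * L :=
  ((x.1 + lam (t e))%R, (f e x.1)^-1 * x.2).
Let shift_map m (x : int * L) : int * L := ((x.1 + m)%R, x.2).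

(* A left action of G on Z x L commuting with right translations of L: its
   second component is an L-valued cocycle, whose restriction to the kernel of
   lam inverts the map from L that sends an edge of the quotient graph to the
   corresponding loop. *)
Lemma kernel_action : exists R : {multiplicative G -> perm_of (int * L)},
  (forall v j l, R (a v) (j, l) =
     ((j - lam (a v))%R, g (j - lam (a v))%R v * (g j v)^-1 * l)) /\
  (forall e j l, R (t e) (j, l) =
     ((j - lam (t e))%R,
      g (j - lam (t e))%R (src e) * f e (j - lam (t e))%R * (g j (tgt e))^-1 * l)).
Proof.
have thK v : cancel (theta_map v) (thetaV_map v).
  by case=> j l; rewrite /theta_map /thetaV_map /= mulKg.
have thVK v : cancel (thetaV_map v) (theta_map v).
  by case=> j l; rewrite /theta_map /thetaV_map /= mulVKg.
have edK e : cancel (edge_map e) (edgeV_map e).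
  by case=> j l; rewrite /edge_map /edgeV_map /= subrK mulKg.
have edVK e : cancel (edgeV_map e) (edge_map e).
  by case=> j l; rewrite /edge_map /edgeV_map /= addrK mulVKg.
have shK m : cancel (shift_map m) (shift_map (- m)%R).
  by case=> j l; rewrite /shift_map /= addrK.
have shVK m : cancel (shift_map (- m)%R) (shift_map m).
  by case=> j l; rewrite /shift_map /= subrK.
pose th v := Perm (thK v) (thVK v); pose ed e := Perm (edK e) (edVK e).
pose sh m := Perm (shK m) (shVK m).
have shX m k x : expgz (sh m) k x = shift_map (k * m)%R x.
  elim: k x => [|k IHk|k IHk] x; first by case: x => j l; rewrite /shift_map /= mul0r addr0.
    by rewrite PoszSr expgz_succ permM IHk /shift_map /= mulrDl mul1r -addrA [(m + _)%R]addrC.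
  rewrite PoszSr opprD expgz_pred permM IHk /shift_map /= mulrDl mulN1r -addrA.
  by rewrite [(- m + _)%R]addrC.
(* The maps [th] are a change of gauge: they make the edges of [T] act trivially, and they cancel
   inside the edge relations, which reduce to the periodicity of [f e] modulo [mu e]. *)
pose A v := sh (- lam (a v))%R ^ (th v)^-1.
pose Te e := th (src e) * ed e * (th (tgt e))^-1.
have [R [Ra Rt]] : exists R : {multiplicative G -> perm_of (int * L)},
    (forall v, R (a v) = A v) /\ forall e, R (t e) = Te e.
  apply: (gbs_lift gG); split=> e; last by rewrite inE.
    move=> _; rewrite /A !expgzJ /Te /conjg !invgK !mulgA mulgVK mulgK.
    congr (_ * _); rewrite -!mulgA; congr (_ * _).
    apply: perm_ext => -[j l]; rewrite !permM !shX /= /shift_map /edge_map /=.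
    rewrite !mulrN -[in LHS](mulrC (lam _)) -mu_tgt -[in RHS](mulrC (lam _)) -/(mu e).
    rewrite addrAC; congr pair; congr (_ * _).
    by rewrite -[in LHS](mulN1r (mu e)) fD.
  move=> eT; apply: perm_ext => -[j l].
  rewrite /Te !permM permVE perm1 /= /theta_map /edge_map /thetaV_map /=.
  by rewrite lamT // subr0 mulgA -gT // mulVKg.
exists R; split=> z j l; rewrite ?Ra ?Rt.
  rewrite /A /conjg invgK !permM permVE /= /theta_map /shift_map /thetaV_map /=.
  by rewrite mulgA.
by rewrite /Te !permM permVE /= /theta_map /edge_map /thetaV_map /= !mulgA.
Qed.

Variable R : {multiplicative G -> perm_of (int * L)}.
Hypothesis Ra : forall v j l, R (a v) (j, l) =
  ((j - lam (a v))%R, g (j - lam (a v))%R v * (g j v)^-1 * l).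
Hypothesis Rt : forall e j l, R (t e) (j, l) =
  ((j - lam (t e))%R,
   g (j - lam (t e))%R (src e) * f e (j - lam (t e))%R * (g j (tgt e))^-1 * l).

Let cc x j : L := (R x (j, 1)).2.

Let RE x j l : R x (j, l) = ((j - lam x)%R, cc x j * l).
Proof.
pose P x := forall j l, R x (j, l) = ((j - lam x)%R, cc x j * l).
have PM x1 x2 : P x1 -> P x2 -> P (x1 * x2).
  move=> P1 P2 {}j {}l; rewrite /cc homM !permM P2 P1 P2 P1 /= lamM mulg1 mulgA.
  by rewrite opprD addrA addrAC.
have PV x1 : P x1 -> P x1^-1.
  move=> P1 {}j {}l; rewrite homV; apply: (can_inj (permVK (R x1))).
  rewrite permKV P1 zhomV // opprK addrK; congr pair.
  have : R x1 ((R x1)^-1 (j, 1)) = (j, 1) by rewrite permKV.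
  rewrite [cc x1^-1 j]/cc homV; case: ((R x1)^-1 (j, 1)) => j' l' /=; rewrite P1 => -[e1 e2].
  by rewrite -e1 subrK mulgA e2 mul1g.
have Pa v : P (a v) by move=> j1 l1; rewrite /cc !Ra mulg1.
have Pt e : P (t e) by move=> j1 l1; rewrite /cc !Rt mulg1.
suff : P x by apply.
elim/(gbs_ind gG): x => [|v u IHu|v u IHu|e u IHu|e u IHu]; try by auto.
by move=> j1 l1; rewrite /cc hom1 !perm1 mul1g zhom1 // subr0.
Qed.

Let ccM x y j : cc (x * y) j = cc x (j - lam y)%R * cc y j.
Proof. by rewrite /cc homM permM [R y _]RE RE /= mulg1. Qed.

Let cc1 j : cc 1 j = 1. Proof. by rewrite /cc hom1. Qed.

Let ccV x j : cc x^-1 (j - lam x)%R = (cc x j)^-1.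
Proof. by apply: (mulIg (cc x j)); rewrite -ccM !mulVg cc1. Qed.

Let cc_a v j : cc (a v) j = g (j - lam (a v))%R v * (g j v)^-1.
Proof. by rewrite /cc Ra mulg1. Qed.

Let cc_t e j : cc (t e) j =
  g (j - lam (t e))%R (src e) * f e (j - lam (t e))%R * (g j (tgt e))^-1.
Proof. by rewrite /cc Rt mulg1. Qed.

(** A lift of the spanning tree to [G]: [U v i] has height [i] and carries the base coset at [v] to
    the lifted vertex of residue [i]. *)
Variable U : V -> int -> G.
Hypothesis UD : forall v i m, U v (i + m * lam (a v))%R = U v i * expgz (a v) m.
Hypothesis U_root : U v0 0%R = 1.
Hypothesis uT : forall x, x \in TG ->
  U (tgt (tag x)) (erep x + lam (t (tag x)))%R = U (src (tag x)) (erep x) * t (tag x).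

Let Uend e i m : U (src e) (i + m * mu e)%R * t e * (U (tgt e) (i + m * mu e + lam (t e))%R)^-1 =
  U (src e) i * t e * (U (tgt e) (i + lam (t e))%R)^-1.
Proof.
have -> : (i + m * mu e = i + (p e * m) * lam (a (src e)))%R by rewrite /mu; ring.
have -> : (i + (p e * m) * lam (a (src e)) + lam (t e) =
    i + lam (t e) + (q e * m) * lam (a (tgt e)))%R.
  have := mu_tgt e; rewrite /mu => h.
  have -> : (p e * m * lam (a (src e)) = m * (lam (a (src e)) * p e))%R by ring.
  by rewrite h; ring.
by rewrite !UD invgM -!mulgA [expgz _ _ * (t e * _)]mulgA -relX -!mulgA mulVKg.
Qed.

Let UT e i : ecls e i \in TG -> U (tgt e) (i + lam (t e))%R = U (src e) i * t e.
Proof.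
move=> xT; have [m iE] := erepE e i; have := uT xT; rewrite /=; set j := erep _ in iE * => h.
have := Uend e j m; rewrite -iE h mulgV => /divg1_eq //.
Qed.

Let lamU v i : lam (U v i) = i.
Proof.
apply: (tree_residue_ind (P := fun v i => lam (U v i) = i)) => [w k m||e k kT].
- by rewrite UD lamM zhomXz //; split=> [/addIr //|->].
- by rewrite U_root zhom1.
by rewrite UT // lamM; split=> [->|/addIr].
Qed.

Variable psi : {multiplicative L -> G}.
Hypothesis psi_gen : forall b : B, psi (free_gen b) =
  U (src (tag (val b))) (erep (val b)) * t (tag (val b)) *
  (U (tgt (tag (val b))) (erep (val b) + lam (t (tag (val b))))%R)^-1.

Let psi_f e i : psi (f e i) = U (src e) i * t e * (U (tgt e) (i + lam (t e))%R)^-1.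
Proof.
case: (boolP (ecls e i \in TG)) => [xT | xT]; first by rewrite fT // hom1 UT // mulgV.
rewrite /f /fG insubT psi_gen /=; have [m iE] := erepE e i.
by rewrite [in RHS]iE Uend.
Qed.

Let psi_g v i : psi (g i v) = U v0 i * (U v i)^-1.
Proof.
move: v (in_setT v); apply: (tree_prop TP (P := fun v => psi (g i v) = U v0 i * (U v i)^-1)).
  by rewrite g_root hom1 mulgV.
move=> e eT; rewrite gT // homM psi_f lamT // tT // mulg1 addr0.
by split=> [->|]; rewrite mulgA ?mulgVK // => /mulIg e1; apply: (mulIg (U (src e) i));
   rewrite mulgVK.
Qed.

(** At [j = 0] and for [x] of height 0 this reads [psi (cc x 0) = x], so [psi] maps onto the
    kernel. *)
Let psi_cc x j : psi (cc x j) = U v0 (j - lam x)%R * x * (U v0 j)^-1.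
Proof.
pose P x := forall j, psi (cc x j) = U v0 (j - lam x)%R * x * (U v0 j)^-1.
have PM x1 x2 : P x1 -> P x2 -> P (x1 * x2).
  move=> P1 P2 {}j; rewrite ccM homM P1 P2 lamM.
  have -> : (j - (lam x1 + lam x2) = j - lam x2 - lam x1)%R by ring.
  by rewrite !mulgA mulgVK.
have PV x1 : P x1 -> P x1^-1.
  move=> P1 {}j; rewrite -{1}[j](addrK (lam x1)) ccV homV P1 !invgM invgK addrK.
  by rewrite zhomV // opprK mulgA.
have Pa v : P (a v).
  move=> i; rewrite cc_a homM homV !psi_g invgM invgK !mulgA; congr (_ * _).
  rewrite -!mulgA; congr (_ * _); apply: (mulgI (U v (i - lam (a v))%R)).
  by rewrite mulVKg -[in LHS](subrK (lam (a v)) i) -{2}[lam (a v)]mul1r UD.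
have Pt e : P (t e).
  move=> i; rewrite cc_t !homM homV !psi_g psi_f subrK invgM invgK !mulgA.
  by rewrite !mulgVK.
suff : P x by apply.
elim/(gbs_ind gG): x => [|v w IHw|v w IHw|e w IHw|e w IHw]; try by auto.
by move=> i; rewrite cc1 hom1 zhom1 // subr0 mulg1 mulgV.
Qed.

Let cc_U v i : cc (U v i) i = (g i v)^-1.
Proof.
have step w k : cc (U w (k + lam (a w))%R) (k + lam (a w))%R = (g (k + lam (a w))%R w)^-1 <->
    cc (U w k) k = (g k w)^-1.
  rewrite -{1}[lam (a w)]mul1r UD expgz1 ccM addrK cc_a addrK mulgA.
  exact: mulgVeq.
apply: (tree_residue_ind (P := fun v i => cc (U v i) i = (g i v)^-1)) => [w k m||e k kT].
- elim: m => [|m IHm|m IHm]; first by rewrite mul0r addr0.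
    by rewrite PoszSr mulrDl mul1r addrA step.
  by rewrite PoszSr opprD mulrDl mulN1r addrA -step subrK.
- by rewrite U_root cc1 g_root invg1.
rewrite UT // ccM addrK cc_t addrK fT // mulg1 mulgA.
by split=> /mulgVeq.
Qed.

Let lam_psi w : lam (psi w) = 0%R.
Proof.
elim/free_ind: w => [|b w IHw|b w IHw]; first by rewrite hom1 zhom1.
  rewrite homM lamM IHw addr0 psi_gen !lamM zhomV // !lamU.
  by rewrite [(_ + lam _)%R]addrC subrr.
by rewrite homM lamM homV zhomV // IHw addr0 psi_gen !lamM zhomV // !lamU subrr oppr0.
Qed.

(** On a loop, the cocycle values of the two factors [U] cancel the gauge factors of the edge, and
    only the letter remains. This makes [psi] injective. *)
Let cc_psi w : cc (psi w) 0%R = w.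
Proof.
have ccpM : {morph (fun w => cc (psi w) 0%R) : x y / x * y}.
  by move=> x y; rewrite homM ccM lam_psi subr0.
apply: (free_hom_ext (f := hom_of ccpM) (g := idfun)) => b; rewrite hom_ofE /= psi_gen.
set x := val b; set e := tag x; set k := erep x.
have lU := lamU (tgt e) (k + lam (t e))%R.
rewrite !ccM zhomV // lU !sub0r opprK addrK.
have := ccV (U (tgt e) (k + lam (t e))%R) (k + lam (t e))%R; rewrite lU subrr => ->.
rewrite !cc_U invgK cc_t addrK -!mulgA mulKg mulVg mulg1.
rewrite /f erepK /fG; case: insubP => [b' _ /val_inj-> //|].
by rewrite (valP b).
Qed.

Lemma kernel_free_explicit : exists r (psi' : {multiplicative free_of_rank r -> G}),
  fibered lam psi'.
Proof.
have [h [h' hK h'K]] := free_group_rank B.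
exists #|B|, [the {multiplicative _ -> _} of psi \o h]; split=> //.
  move=> x y /= e; apply: (can_inj hK).
  by rewrite -(cc_psi (h x)) -(cc_psi (h y)) e.
move=> x; split=> [x0|[w <-]]; last exact: lam_psi.
exists (h' (cc x 0%R)); rewrite /= h'K psi_cc x0 subr0 U_root mul1g.
by rewrite divg1.
Qed.

End QuotientTree.

Theorem kernel_free : exists r (psi : {multiplicative free_of_rank r -> G}), fibered lam psi.
Proof.
have [TG _ TGP] := tree_exists quotient_graph_connected.
pose B : finType := {x : EG | x \notin TG}.
pose fG (x : EG) : free_group B := if insub x is Some b then free_gen (b : B) else 1.
have gex i : exists g : V -> free_group B, g v0 = 1 /\
    forall e, e \in T -> g (tgt e) = g (src e) * fG (ecls e i).
  apply: (tree_potential (f := fun e y => y * fG (ecls e i)) (f' := fun e y => y / fG (ecls e i)) 1 _ TP).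
  by move=> e y; rewrite mulgVK.
have [g gP] := choice gex.
have g_root i : g i v0 = 1 by have [] := gP i.
have gT i e : e \in T -> g i (tgt e) = g i (src e) * fG (ecls e i) by have [_] := gP i; apply.
have [R [Ra Rt]] := kernel_action gT.
(* The potential [u] depends on residues only; the power [s v i] restores the multiple of
   [lam (a v)] lost in the reduction, and [w] corrects the edges accordingly. *)
pose s v i := expgz (a v) (i %/ lam (a v))%Z.
pose w x := s (src (tag x)) (erep x) * t (tag x) / s (tgt (tag x)) (erep x + lam (t (tag x)))%R.
have [u [u_root uT]] : exists u : VG -> G, u root = 1 /\
    forall x, x \in TG -> u (gtgt x) = u (gsrc x) * w x.
  apply: (tree_potential (f := fun x y => y * w x) (f' := fun x y => y / w x) 1 _ TGP).
  by move=> x y; rewrite mulgVK.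
pose U v i := u (vcls v i) * s v i.
have UD v i m : U v (i + m * lam (a v))%R = U v i * expgz (a v) m.
  have l0 : lam (a v) != 0%R by apply/eqP.
  by rewrite /U /s vclsD addrC divzMDl // addrC expgzD mulgA.
have U_root : U v0 0%R = 1 by rewrite /U /s -/root u_root mul1g div0z.
have UT x : x \in TG ->
    U (tgt (tag x)) (erep x + lam (t (tag x)))%R = U (src (tag x)) (erep x) * t (tag x).
  by move=> xT; rewrite /U -/(gsrc x) -/(gtgt x) uT // /w !mulgA mulgVK.
have [psi psiE] := free_lift (fun b : B =>
  U (src (tag (val b))) (erep (val b)) * t (tag (val b)) *
  (U (tgt (tag (val b))) (erep (val b) + lam (t (tag (val b))))%R)^-1).
exact: (kernel_free_explicit TGP g_root gT Ra Rt UD U_root UT psiE).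
Qed.

End KernelFree.

(** The image of [lam] is generated by its least positive element [l], by which the map is
    divided. *)
Lemma zhom_normalize (G : groupType) (lam : G -> int) :
  zhom lam -> (exists x, lam x <> 0%R) ->
  exists (l : nat) (lam' : G -> int),
    [/\ (0 < l)%N, zhom lam', exists x, lam' x = 1%R & forall x, lam x = (l%:Z * lam' x)%R].
Proof.
move=> lamM [x0 x00].
pose P k := (0 < k)%N && `[< exists z, lam z = k%:Z >].
have exP : exists k, P k.
  exists `|lam x0|%N; rewrite /P absz_gt0; apply/andP; split; first exact/eqP.
  apply/asboolP; case E: (lam x0) => [n|n]; first by exists x0.
  by exists x0^-1; rewrite zhomV // E NegzE opprK.
have [l /andP[l_gt0 /asboolP[z zl]] lmin] := ex_minnP exP.
have l0 : l%:Z != 0%R by rewrite -lt0n.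
have dvd x : (l %| lam x)%Z.
  have := modz_ge0 (lam x) l0; have := ltz_pmod (lam x) (d := l%:Z).
  case E: (lam x %% l)%Z => [[|j]|] // /(_ l_gt0) lt_jl _; first exact/dvdz_mod0P.
  suff : (l <= j.+1)%N by rewrite leqNgt -ltz_nat lt_jl.
  apply: lmin; apply/asboolP; exists (x * expgz z (- (lam x %/ l)%Z)%R).
  rewrite lamM zhomXz // zl mulNr -E; apply/eqP; rewrite subr_eq addrC.
  by rewrite -divz_eq.
have lE x : lam x = (l%:Z * (lam x %/ l)%Z)%R by rewrite mulrC divzK.
exists l, (fun x => lam x %/ l)%Z; split=> // [x y|].
  by apply: (mulfI l0); rewrite mulrDr -!lE lamM.
by exists z; rewrite zl divzz l0.
Qed.

Lemma zhom_abelianization (G : groupType) (lam : G -> int) x :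
  zhom lam -> coset (commutator_subgroup G) x = 1 -> lam x = 0%R.
Proof.
move=> lamM /coset1P Nx.
have K1 : lam 1 = 0%R by rewrite zhom1.
have KF y w : lam y = 0%R -> lam w = 0%R -> lam (y / w) = 0%R.
  by move=> y0 w0; rewrite lamM zhomV // y0 w0 subrr.
have KJ y w : lam y = 0%R -> lam (y ^ w) = 0%R by rewrite zhomJ.
apply: (Nx (NormalSubgroup K1 KF KJ)) => _ [y [w ->]] /=.
by rewrite commgEl lamM zhomV // zhomJ // addNr.
Qed.

Lemma abelianization_commute (G : groupType) (x y : abelianization G) : commute x y.
Proof.
have [u ->] := coset_surj x; have [v ->] := coset_surj y.
rewrite /commute -!(homM (coset (commutator_subgroup G))); apply/coset_eqP => N SN.
by apply: SN; exists v, u; rewrite invgM -mulgA.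
Qed.

Lemma independent_pair (A : groupType) b (g : 'I_b.+2 -> A) m0 m1 :
  independent g -> expgz (g ord0) m0 * expgz (g (lift ord0 ord0)) m1 = 1 ->
  m0 = 0%R /\ m1 = 0%R.
Proof.
move=> gi e; pose m (i : 'I_b.+2) : int :=
  if i == ord0 then m0 else if i == lift ord0 ord0 then m1 else 0%R.
have me : forall i, m i = 0%R.
  apply: gi; rewrite !big_ord_recl big1 => [|i _]; last by rewrite /m.
  by rewrite mulg1 /m.
by split; [rewrite -(me ord0) | rewrite -(me (lift ord0 ord0))].
Qed.

(** * Torsion and free subgroups of the quotient by the centre *)

Section CentralQuotient.
Variables (G : groupType) (r : nat) (lam : G -> int).
Variable psi : {multiplicative free_of_rank r -> G}.
Variables (z : G) (k : nat).
Hypotheses (fib : fibered lam psi) (zC : in_center z) (k_gt0 : (0 < k)%N).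
Hypotheses (zk : lam z = k%:Z) (zgen : forall y, in_center y -> exists i, y = expgz z i).

Let lamM : zhom lam. Proof. by case: fib. Qed.

(** Let [y^o = z^i] and [d = gcd(i, o)]. Then [y^(o/d) z^(-i/d)] is torsion, hence 1, so [y^(o/d)]
    is central and minimality gives [d = 1]. Heights give [o * lam y = i * k], and [o] divides
    [k]. *)
Lemma central_torsion_dvd (x : quotient_group (center G)) o : has_order x o -> (o %| k)%N.
Proof.
have [y ->] := coset_surj x; move=> [o_gt0 xo xmin].
have [i yi] : exists i, y ^+ o = expgz z i.
  by apply: zgen; apply/(coset1P (center G)); rewrite homXn.
pose d := gcdn `|i| o.
have d_gt0 : (0 < d)%N by rewrite gcdn_gt0 o_gt0 orbT.
have do_ : (d %| o)%N := dvdn_gcdr _ _.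
have di : (d %| i)%Z := dvdn_gcdl _ _.
have od_gt0 : (0 < o %/ d)%N by rewrite divn_gt0 // dvdn_leq.
pose w := y ^+ (o %/ d) * expgz z (- (i %/ d)%Z)%R.
have w1 : w = 1.
  apply: (fibered_torsion_free fib d_gt0); rewrite expgMn; last first.
    exact/commuteXz/commute_sym/zC.
  rewrite -expgnA divnK // -[expgz z _ ^+ d]/(expgz (expgz z _) d) -expgzM mulNr divzK //.
  by rewrite expgzN yi mulgV.
have xod : coset (center G) y ^+ (o %/ d) = 1.
  rewrite -homXn; apply/(coset1P (center G)).
  have -> : y ^+ (o %/ d) = expgz z (i %/ d)%Z.
    by apply: divg1_eq; rewrite -expgzN.
  exact: centerXz.
have d1 : d = 1%N.
  apply/eqP; rewrite eqn_leq d_gt0 andbT leqNgt; apply/negP => d_gt1.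
  by apply: (xmin (o %/ d)%N) => //; rewrite od_gt0 ltn_Pdiv.
have := congr1 lam yi; rewrite zhomXn // zhomXz // zk => e.
have : (o %| (i * k)%R)%Z by rewrite -e dvdz_mulr.
rewrite dvdzE abszM mulnC Gauss_dvdl //=.
by rewrite coprime_sym /coprime; apply/eqP.
Qed.

(** The fibre meets the centre trivially, and central heights are the multiples of [k], so the
    cosets are told apart by the height modulo [k], with representatives [t^0, ..., t^(k-1)]. *)
Lemma fibered_free_of_index : free_of_index (quotient_group (center G)) r k.
Proof.
have [_ [t lt] psi_inj ker] := fib.
have lpsi w : lam (psi w) = 0%R by apply/ker; exists w.
have central_dvd y : in_center y -> exists i, lam y = (i * k%:Z)%R.
  by move=> /zgen[i ->]; exists i; rewrite zhomXz // zk.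
exists [the {multiplicative _ -> _} of coset (center G) \o psi], (fun i => coset (center G) (t ^+ i)).
split=> [|]; last split.
- apply: hom_inj => w /= /(coset1P (center G)) wC.
  apply: psi_inj; rewrite hom1; have [i wi] := zgen wC.
  have := lpsi w; rewrite wi zhomXz // zk => /eqP; rewrite mulf_eq0 => /orP[/eqP->//|].
  by rewrite eqz_nat -leqn0 leqNgt k_gt0.
- move=> x; have [y ->] := coset_surj x.
  have k0 : k%:Z != 0%R by rewrite -lt0n.
  have lt_ik : (`|(lam y %% k)%Z|%N < k)%N by have := residue_subproof (elimN eqP k0) (lam y).
  have iE : (`|(lam y %% k)%Z|%N)%:Z = (lam y %% k)%Z by rewrite abszE ger0_norm ?modz_ge0.
  have /ker[w wE] : lam (t ^- `|(lam y %% k)%Z|%N * y * expgz z (- (lam y %/ k)%Z)%R) = 0%R.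
    rewrite !lamM zhomV // zhomXn // lt mulr1 zhomXz // zk iE mulNr.
    move: (divz_eq (lam y) k); set q := (_ %/ _)%Z; set m := (_ %% _)%Z => ->; ring.
  exists (Ordinal lt_ik), w; rewrite /= wE -homM; apply/coset_eqP.
  rewrite -[t ^- _ * _ * _]mulgA mulVKg mulKg.
  exact: centerXz.
move=> i j w; rewrite /= -homM => /coset_eqP /central_dvd[m].
rewrite lamM zhomV // lamM lpsi addr0 !zhomXn // lt !mulr1 => e.
apply/val_inj => /=; have := ltn_ord i; have := ltn_ord j.
move: (nat_of_ord i) (nat_of_ord j) e => {}i {}j e lt_jk lt_ik.
have [m0|m0|m0] := ltrgtP m 0%R; [nia | nia |].
by move: e; rewrite m0; lia.
Qed.

End CentralQuotient.

Lemma free_of_index_finite (Q : groupType) r d :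
  free_of_index Q r d -> has_free_finite_index Q r.
Proof.
move=> [f [s [f_inj [s_all _]]]]; exists f; split=> //.
exists [seq s i | i : 'I_d] => x; have [i [w ->]] := s_all x.
by exists (s i); [apply: image_f | exists w; rewrite mulKg].
Qed.

(** * Heights on a GBS group *)

Lemma common_denominator (V : finType) (r : V -> rat) :
  exists (D : int) (m : V -> int), D != 0%R /\ forall v, (D%:~R * r v = (m v)%:~R)%R.
Proof.
exists (\prod_v denq (r v))%R, (fun v => numq (r v) * \prod_(w | w != v) denq (r w))%R.
split=> [|v]; first by apply/prodf_neq0 => v _; apply: denq_neq0.
rewrite (bigD1 v) //= !rmorphM /= mulrAC; congr (_ * _)%R.
by rewrite -{2}[r v]divq_num_den mulrC mulfVK // intr_eq0 denq_neq0.
Qed.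

Section GBSHeight.
Variables (V E : finType) (src tgt : E -> V) (p q : E -> int) (T : {set E}) (v0 : V).
Variables (G : groupType) (a : V -> G) (t : E -> G).
Hypotheses (gG : gbs_group src tgt p q T setT a t) (TP : tree_on src tgt v0 setT T).
Hypothesis pq0 : forall e, p e <> 0%R /\ q e <> 0%R.

Let rel e : t e * expgz (a (tgt e)) (q e) = expgz (a (src e)) (p e) * t e.
Proof. by have [r1 _ _] := gbsP gG; apply: r1; rewrite inE. Qed.

Let tT e : e \in T -> t e = 1. Proof. by have [_ r2 _] := gbsP gG; apply: r2. Qed.

Lemma gbs_height (r : V -> int) (tau : E -> int) :
  (forall e, p e * r (src e) = q e * r (tgt e))%R -> (forall e, e \in T -> tau e = 0%R) ->
  exists lam : G -> int, [/\ zhom lam, forall v, lam (a v) = r v & forall e, lam (t e) = tau e].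
Proof.
move=> pqr tau0; have idM : zhom (id : Zgroup -> int) by [].
have [|f [fa ft]] := gbs_lift gG (L := Zgroup) (x := r) (y := tau).
  split=> e; last by rewrite inE.
    move=> _; rewrite -[LHS]/(id _) -[RHS]/(id _) !idM !(zhomXz idM).
    by rewrite pqr addrC.
  by move=> /tau0 ->.
by exists f; split=> // x y; apply: (homM f).
Qed.

Lemma height_relation (lam : G -> int) e : zhom lam ->
  (p e * lam (a (src e)) = q e * lam (a (tgt e)))%R.
Proof.
by move=> lamM; have := congr1 lam (rel e); rewrite !lamM !zhomXz // [LHS]addrC => /addIr.
Qed.

(** All the powers [a_v^(N v)] have the same height [P1 * P2], and [N] is divisible by the edge
    exponents at both ends. The edge relations identify these powers along [T], and make them
    commute with the stable letters. *)
Lemma gbs_central_power (lam : G -> int) :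
  zhom lam -> (forall v, lam (a v) <> 0%R) ->
  exists (x : G) (N : V -> int), [/\ in_center x, forall v, N v <> 0%R
    & forall v, x = expgz (a v) (N v)].
Proof.
move=> lamM lam0.
pose P1 := (\prod_v lam (a v))%R; pose P2 := (\prod_e (p e * lam (a (src e))))%R.
pose N v := ((\prod_(w | w != v) lam (a w)) * P2)%R.
pose M e := (P1 * \prod_(e' | e' != e) (p e' * lam (a (src e'))))%R.
have lam0' v : lam (a v) != 0%R by apply/eqP.
have plam0 e : (p e * lam (a (src e)))%R != 0%R.
  by rewrite mulf_neq0 //; apply/eqP; have [] := pq0 e.
have NE v : (N v * lam (a v) = P1 * P2)%R by rewrite /P1 (bigD1 v) //= /N; ring.
have ME e : (M e * (p e * lam (a (src e))) = P1 * P2)%R.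
  by rewrite [P2](bigD1 e) //= /M; ring.
have Nsrc e : N (src e) = (p e * M e)%R.
  by apply: (mulIf (lam0' (src e))); rewrite NE -(ME e); ring.
have Ntgt e : N (tgt e) = (q e * M e)%R.
  apply: (mulIf (lam0' (tgt e))); rewrite NE -(ME e) height_relation //; ring.
pose X v := expgz (a v) (N v).
have relX e : t e * X (tgt e) = X (src e) * t e.
  rewrite /X Nsrc Ntgt; move: (M e) => m; rewrite !expgzM.
  have cj : expgz (a (src e)) (p e) ^ t e = expgz (a (tgt e)) (q e).
    by rewrite /conjg -rel mulKg.
  by rewrite -cj expgzJ -conjgC.
have XE v : X v = X v0.
  move: v (in_setT v); apply: (tree_prop TP (P := fun v => X v = X v0)) => // e eT.
  by have := relX e; rewrite tT // mul1g mulg1 => ->.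
exists (X v0), N; split=> [|v|v]; last by rewrite -(XE v).
  have comm_t e : commute (X v0) (t e) by have := relX e; rewrite !XE => /esym.
  have comm_a v : commute (X v0) (a v).
    by rewrite -(XE v); apply/commute_sym/commuteXz/commute_refl.
  elim/(gbs_ind gG) => [|v u IHu|v u IHu|e u IHu|e u IHu]; first exact: commute1.
  - exact: commuteM.
  - by apply: commuteM => //; apply: commuteV.
  - exact: commuteM.
  by apply: commuteM => //; apply: commuteV.
apply/eqP; rewrite mulf_neq0 //.
  by apply/prodf_neq0 => w _; apply: lam0'.
by apply/prodf_neq0 => e _; apply: plam0.
Qed.

(** Without stable letters the group is generated by roots of one central [x], so a fixed power [M]
    sends every class of the abelianization into the powers of [x]. *)
Lemma gbs_tree_abelianization (lam : G -> int) b :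
  zhom lam -> (forall v, lam (a v) <> 0%R) -> T = setT ->
  forall g : 'I_b.+2 -> abelianization G, ~ independent g.
Proof.
move=> lamM lam0 TT g gi.
have [x [N [xC N0 xE]]] := gbs_central_power lamM lam0.
pose M := (\prod_v N v)%R.
have M0 : M != 0%R by apply/prodf_neq0 => v _; apply/eqP.
pose c (u : G) : abelianization G := coset _ u.
have cM : {morph c : u v / u * v} := @cosetM _ _.
have cXz u m : c (expgz u m) = expgz (c u) m by apply: (homXz (coset _)).
have gen u : exists i, expgz (c u) M = expgz (c x) i.
  pose P u := exists i, expgz (c u) M = expgz (c x) i.
  have PM u1 u2 : P u1 -> P u2 -> P (u1 * u2).
    move=> [i1 e1] [i2 e2]; exists (i1 + i2)%R.
    by rewrite cM expgzMn ?e1 ?e2 ?expgzD //; apply: abelianization_commute.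
  have PV u1 : P u1 -> P u1^-1.
    move=> [i1 e1]; exists (- i1)%R; rewrite -[u1^-1]/(expgz u1 (-1)) cXz -expgzM mulrC.
    by rewrite expgzM e1 -expgzM mulrN1.
  have Pa v : P (a v).
    exists (\prod_(w | w != v) N w)%R; rewrite /M (bigD1 v) //= expgzM -cXz -xE.
    by [].
  have Pt e : P (t e).
    exists 0%R; rewrite tT ?TT ?inE // -cXz expgz1n [c 1](hom1 (coset _)).
    by [].
  rewrite -/(P u); elim/(gbs_ind gG): u => [|v u IHu|v u IHu|e u IHu|e u IHu]; try by auto.
  by exists 0%R; rewrite -cXz expgz1n [c 1](hom1 (coset _)).
have [u0 u0E] := coset_surj (g ord0); have [i0 e0] := gen u0.
have [u1 u1E] := coset_surj (g (lift ord0 ord0)); have [i1 e1] := gen u1.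
rewrite /c -u0E in e0; rewrite /c -u1E in e1.
(* The exponents are crossed so that the two powers of [x] cancel; then [i0 = 0], and the [M]-th
   power of the first class is already trivial. *)
have [] := independent_pair (m0 := (M * i1)%R) (m1 := (M * - i0)%R) gi.
  by rewrite !expgzM e0 e1 -!expgzM -expgzD mulrN mulrC subrr.
move=> _ /eqP; rewrite mulf_eq0 (negPf M0) oppr_eq0 /= => /eqP i00.
have [] := independent_pair (m0 := M) (m1 := 0%R) gi.
  by rewrite e0 i00 mulg1.
by move=> M00; rewrite M00 eqxx in M0.
Qed.

Hypotheses (nel : ~ elementary G) (Znt : exists z : G, in_center z /\ z <> 1).

(* kappa is the lcm of the indices of the centre in the vertex groups. *)
Lemma gbs_central_data : exists (z : G) (kap : nat) (r : V -> int),
  [/\ in_center z, forall y, in_center y -> exists i, y = expgz z i, (0 < kap)%N,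
      forall K, is_kappa G K -> K = kap
   & [/\ forall r1 d, free_of_index (quotient_group (center G)) r1 d -> (kap %| d)%N,
      forall v, r v <> 0%R,
      forall e, (p e * r (src e) = q e * r (tgt e))%R,
      forall lam m, zhom lam -> (forall v, lam (a v) = (m * r v)%R) ->
        lam z = (m * kap%:Z)%R
    & forall lam, zhom lam -> (forall v, lam (a v) = r v) -> exists x, lam x = 1%R]].
Proof.
have [rr [rr0 rrE]] := modular_trivial gG TP pq0 nel Znt.
(* A provisional onto height, proportional to the potential: it makes [G] torsion-free with cyclic
   centre, before kappa is known. *)
have [D [m [D0 mE]]] := common_denominator rr.
have m0 v : m v <> 0%R.
  by apply/eqP; rewrite -(intr_eq0 rat) -mE mulf_neq0 ?intr_eq0.
have mpq e : (p e * m (src e) = q e * m (tgt e))%R.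
  apply: (@intr_inj rat); rewrite !rmorphM /= -!mE mulrCA rrE; ring.
have [lam1 [lam1M lam1a _]] := gbs_height mpq (fun e _ => erefl : (fun _ => 0%R) e = 0%R).
have [|l [lam [l_gt0 lamM lam_surj lamE]]] := zhom_normalize lam1M.
  by exists (a v0); rewrite lam1a.
have lam0 v : lam (a v) <> 0%R by move=> e; case: (m0 v); rewrite -lam1a lamE e mulr0.
have [r0 [psi fib]] := kernel_free gG TP pq0 lamM lam_surj lam0.
have r_gt1 := fibered_rank_gt1 fib nel.
have [z [k0 [zC k0_gt0 zk zgen]]] := fibered_center_cyclic fib r_gt1 Znt.
have [x [N [xC N0 xE]]] := gbs_central_power lamM lam0.
have k00 : k0%:Z != 0%R by rewrite -lt0n.
(* The ratio [lam (a v) / lam z] in lowest terms, with denominator [nv.1] and numerator [nv.2]. *)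
have nv_ex v : exists nv : nat * int, [/\ (0 < nv.1)%N, (lam (a v) * nv.1%:Z = k0%:Z * nv.2)%R,
    coprimez nv.1%:Z nv.2 & a v ^+ nv.1 = expgz z nv.2].
  pose g := gcdn `|lam (a v)| k0.
  have g_gt0 : (0 < g)%N by rewrite gcdn_gt0 k0_gt0 orbT.
  have gk : (g %| k0)%N := dvdn_gcdr _ _.
  have gl : (g%:Z %| lam (a v))%Z := dvdn_gcdl _ _.
  have g0 : g%:Z != 0%R by rewrite -lt0n.
  have kE : k0%:Z = ((k0 %/ g)%N%:Z * g%:Z)%R by rewrite -PoszM divnK.
  have lE : lam (a v) = ((lam (a v) %/ g)%Z * g%:Z)%R by rewrite divzK.
  have main : (lam (a v) * (k0 %/ g)%N%:Z = k0%:Z * (lam (a v) %/ g)%Z)%R.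
    by rewrite {1}lE kE; ring.
  exists ((k0 %/ g)%N, (lam (a v) %/ g)%Z); split=> //=.
  - by rewrite divn_gt0 // dvdn_leq.
  - rewrite /coprimez; apply/eqP; apply: (mulIf g0); rewrite mul1r.
    have := mulz_gcdl (k0 %/ g)%N%:Z (lam (a v) %/ g)%Z g%:Z; rewrite -kE -lE => ->.
    by rewrite /gcdz /= gcdnC.
  set n := (k0 %/ g)%N in main *; set pv := (_ %/ _)%Z in main *.
  have zcomm i u : commute (expgz z i) u by apply: centerXz.
  (* [w] has height 0 and a non-zero power of it is central, hence trivial; torsion-freeness gives
     [w = 1]. *)
  apply: divg1_eq; rewrite -expgzN; set w := _ * _.
  have lw : lam w = 0%R by rewrite /w lamM zhomXn // zhomXz // zk mulNr mulrC main mulrC subrr.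
  have wN : expgz w (N v) = 1.
    apply: (fibered_center_inj fib r_gt1); last by rewrite zhomXz // lw mulr0.
    rewrite /w expgzMn; last exact/commute_sym/zcomm.
    apply: centerM; last by rewrite -expgzM; apply: centerXz.
    rewrite -[a v ^+ n]/(expgz (a v) n) -expgzM mulrC expgzM -xE.
    exact: (@centerXz _ _ n xC).
  have tf k : (0 < k)%N -> w ^+ k = 1 -> w = 1 by apply: fibered_torsion_free fib.
  by have [Nv|] := torsion_free_expgz tf wN; first by case: (N0 v).
have [nv nvP] := choice nv_ex.
pose kap := \big[lcmn/1%N]_v (nv v).1.
have kap_gt0 : (0 < kap)%N.
  rewrite /kap; elim/big_ind: _ => // [n1 n2|v _]; first by rewrite lcmn_gt0 => -> ->.
  by have [] := nvP v.
have nv_kap v : ((nv v).1 %| kap)%N by apply: (biglcmn_sup v).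
have kapE v : kap%:Z = ((kap %/ (nv v).1)%N%:Z * (nv v).1%:Z)%R by rewrite -PoszM divnK.
(* The heights rescaled so that [z] has height [kap]; they are integers because the denominators
   divide [kap]. *)
pose r v := ((kap %/ (nv v).1)%N%:Z * (nv v).2)%R.
have rE v : (k0%:Z * r v = kap%:Z * lam (a v))%R.
  by have [_ e _ _] := nvP v; rewrite (kapE v) /r mulrCA -e; ring.
have r00 v : r v <> 0%R.
  move=> e; have := rE v; rewrite e mulr0 => /esym/eqP; rewrite mulf_eq0 => /orP[].
    by rewrite eqz_nat -leqn0 leqNgt kap_gt0.
  by apply/negP/eqP.
have rpq e : (p e * r (src e) = q e * r (tgt e))%R.
  apply: (mulfI k00); rewrite mulrCA rE [RHS]mulrCA rE mulrCA [RHS]mulrCA.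
  by rewrite height_relation.
have p0 v : (nv v).2 != 0%R.
  by apply/eqP => e; case: (r00 v); rewrite /r e mulr0.
have lamz lam' c : zhom lam' -> (forall v, lam' (a v) = (c * r v)%R) ->
    lam' z = (c * kap%:Z)%R.
  move=> lM la; have [_ _ _ e] := nvP v0; have := congr1 lam' e.
  rewrite zhomXn // zhomXz // la => e1; apply: (mulfI (p0 v0)); rewrite -e1.
  by rewrite (kapE v0) /r; ring.
have surj lam' : zhom lam' -> (forall v, lam' (a v) = r v) -> exists x, lam' x = 1%R.
  move=> lM la; have [|l' [lam'' [l'_gt0 _ [y y1] l'E]]] := zhom_normalize lM.
    by exists (a v0); rewrite la.
  (* The divisor [l'] of all heights divides [kap / n] times both coprime numbers [n] and [i] of a
     vertex, hence [kap / n]. So every [n] divides [kap / l'], and so does their lcm [kap]. *)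
  suff l1 : l' = 1%N by exists y; rewrite l'E y1 l1.
  have dk : (l' %| kap)%N.
    have := l'E z; rewrite (lamz _ 1%R) // => [|v]; last by rewrite la mul1r.
    by rewrite mul1r => e; have : (l'%:Z %| kap%:Z)%Z by rewrite e dvdz_mulr.
  have dl v : (l' %| kap %/ (nv v).1)%N.
    have [nv_gt0 _ cop _] := nvP v.
    have d1 : (l'%:Z %| ((kap %/ (nv v).1)%N%:Z * (nv v).1%:Z)%R)%Z by rewrite -kapE.
    have d2 : (l'%:Z %| ((kap %/ (nv v).1)%N%:Z * (nv v).2)%R)%Z.
      by rewrite -/(r v) -la l'E dvdz_mulr.
    move: cop d1 d2 => /coprimezP[[u1 u2] /= u12] /dvdzP[x1 e1] /dvdzP[x2 e2].
    have /dvdzP : exists x3, (kap %/ (nv v).1)%N%:Z = (x3 * l'%:Z)%R; last by [].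
    exists (u1 * x1 + u2 * x2)%R; rewrite -[LHS]mulr1 -u12.
    transitivity (u1 * ((kap %/ (nv v).1)%N%:Z * (nv v).1%:Z) +
      u2 * ((kap %/ (nv v).1)%N%:Z * (nv v).2))%R; first ring.
    by rewrite e1 e2; ring.
  have : (kap %| kap %/ l')%N.
    apply/dvdn_biglcmP => v _; have /dvdnP[c cE] := dl v.
    by rewrite -(divnK (nv_kap v)) cE -mulnA mulnCA mulKn // dvdn_mull.
  move=> /dvdn_leq; rewrite divn_gt0 // (dvdn_leq kap_gt0 dk) => /(_ isT).
  by rewrite leq_divRL //; case: (l') l'_gt0 => [|[|n]] // _; lia.
(* Coprimality makes [n] the exact order of the class of [a v], so [kap] is a lcm of orders that do
   occur. *)
have nv_order v : has_order (coset (center G) (a v)) (nv v).1.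
  have [n_gt0 e cop ae] := nvP v; split=> // [|j /andP[j_gt0 lt_j]].
    by rewrite -homXn; apply/(coset1P (center G)); rewrite ae; apply: centerXz.
  rewrite -homXn => /(coset1P (center G))/zgen[i ji].
  have ej := congr1 lam ji; rewrite zhomXn // zhomXz // zk in ej.
  have : ((nv v).1%:Z %| ((nv v).2 * j%:Z)%R)%Z.
    apply/dvdzP; exists i; apply: (mulfI k00); rewrite mulrA -e mulrAC.
    by rewrite [(_ * j%:Z)%R]mulrC ej; ring.
  rewrite Gauss_dvdzr // => /(dvdn_leq j_gt0); rewrite /= leqNgt lt_j.
  by [].
(* Conversely, a fibration giving [z] height [kap] shows that every torsion order divides [kap]. *)
have [lamr [lrM lra _]] := gbs_height rpq (fun e _ => erefl : (fun _ => 0%R) e = 0%R).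
have [||r1 [psi1 fib1]] := kernel_free gG TP pq0 lrM.
- exact: surj.
- by move=> v; rewrite lra.
have lrz : lamr z = kap%:Z by rewrite (lamz _ 1%R) ?mul1r // => v; rewrite lra mul1r.
have orders o (y : quotient_group (center G)) : has_order y o -> (o %| kap)%N.
  exact: (central_torsion_dvd fib1 zC lrz zgen).
exists z, kap, r; split=> // [K KP|].
  apply/eqP; rewrite eqn_dvd; apply/andP; split.
    by apply/KP => y o; apply: orders.
  apply/dvdn_biglcmP => v _; have /KP KK := dvdnn K; exact: KK (nv_order v).
split=> // r2 d [f [s [f_inj sP]]].
apply/dvdn_biglcmP => v _; exact: (torsion_order_dvd_index f_inj sP (nv_order v)).
Qed.

End GBSHeight.

(** * Orders and ranks realized by a GBS group *)

Section CentralGBS.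
Variables (G : groupType) (kappa epsilon : nat).
Hypotheses (hGBS : is_GBS G) (hne : ~ elementary G).
Hypothesis hZ : exists z : G, in_center z /\ z <> 1.
Hypotheses (hkappa : is_kappa G kappa) (hepsilon : is_epsilon G epsilon).

Lemma central_gbs_fibrations : exists (z : G) (lam1 : G -> int),
  [/\ in_center z, forall y, in_center y -> exists i, y = expgz z i,
      lam1 z = kappa%:Z, zhom lam1 &
  [/\ (0 < kappa)%N,
      (exists psi : {multiplicative free_of_rank epsilon.+1 -> G}, fibered lam1 psi),
      (forall n k lam (psi : {multiplicative free_of_rank n -> G}) y, fibered lam psi ->
         (0 < k)%N -> in_center y -> lam y = k%:Z ->
         (forall y', in_center y' -> exists i, y' = expgz y i) ->
         (kappa %| k)%N /\ (n * kappa + k = epsilon.+1 * k + kappa)%N)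
    & forall b (g : 'I_b.+2 -> abelianization G) (m : nat), independent g -> (0 < m)%N ->
        exists n lam (psi : {multiplicative free_of_rank n -> G}),
          fibered lam psi /\ lam z = (m * kappa)%N%:Z]].
Proof.
have [V [E [src [tgt [p [q [T [v0 [a [t [gG TP pq0]]]]]]]]]]] := GBS_presentation hGBS.
have [z [kap [r [zC zgen kap_gt0 kapP [kap_dvd r0 rpq lamz surj]]]]] :=
  gbs_central_data gG TP pq0 hne hZ.
have kE := kapP _ hkappa; rewrite -{}kE {kapP} in kap_gt0 kap_dvd lamz.
have [lam1 [lam1M lam1a _]] := gbs_height gG rpq (fun e _ => erefl : (fun _ => 0%R) e = 0%R).
have [||r1 [psi1 fib1]] := kernel_free gG TP pq0 lam1M.
- exact: surj.
- by move=> v; rewrite lam1a.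
have lam1z : lam1 z = kappa%:Z by rewrite (lamz _ 1%R) ?mul1r // => v; rewrite lam1a mul1r.
have idx1 := fibered_free_of_index fib1 zC kap_gt0 lam1z zgen.
have [/free_of_index_ex[d idx] eps_min] := hepsilon.
(* A free subgroup of smallest rank has index [d] at least kappa, and
   [epsilon * kappa = (r1 - 1) * d] bounds [r1] by [epsilon + 1]. *)
have r1E : r1 = epsilon.+1.
  have le_r1 := eps_min _ (free_of_index_finite idx1).
  have [d' [dE _]] := free_of_index_normalized idx.
  have le_d : (kappa <= d)%N by apply: dvdn_leq; [rewrite dE | apply: kap_dvd idx].
  by have := free_index_rank idx idx1; nia.
rewrite r1E in psi1 fib1 idx1.
exists z, lam1; split=> //; split=> //; first by exists psi1.
- move=> n k lam psi y fib k_gt0 yC yk ygen.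
  have idk := fibered_free_of_index fib yC k_gt0 yk ygen.
  by split; [apply: kap_dvd idk | rewrite (free_index_rank idk idx1)].
move=> b g m gi m_gt0.
(* Two independent classes exclude a tree; the letter of [e0] will have height 1. *)
have [e0 e0T] : exists e, e \notin T.
  apply: contrapT => nT; apply: (gbs_tree_abelianization gG TP pq0 lam1M _ _ gi).
    by move=> v; rewrite lam1a.
  apply/setP => e; rewrite inE; apply: contrapT => eT; apply: nT; exists e.
  exact/negP.
pose rm v := (m%:Z * r v)%R; pose tau e : int := if e == e0 then 1%R else 0%R.
have rmpq e : (p e * rm (src e) = q e * rm (tgt e))%R by rewrite /rm !(mulrCA _ m%:Z) rpq.
have tau0 e : e \in T -> tau e = 0%R.
  by rewrite /tau; case: eqP => // ->; rewrite (negPf e0T).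
have [lam [lamM lama lamt]] := gbs_height gG rmpq tau0.
have [||n [psi fib]] := kernel_free gG TP pq0 lamM.
- by exists (t e0); rewrite lamt /tau eqxx.
- move=> v; rewrite lama /rm => /eqP; rewrite mulf_eq0 => /orP[|/eqP/r0//].
  by rewrite eqz_nat -leqn0 leqNgt m_gt0.
by exists n, lam, psi; split=> //; rewrite PoszM (lamz _ m%:Z).
Qed.

Variables (k n : nat).
Hypotheses (hk : (0 < k)%N) (hn : (0 < n)%N).

Let realized := exists Phi : outer_automorphism (free_of_rank n),
  has_order Phi k /\ isomorphic G (outer_mapping_torus Phi).

Lemma realized_multiple : realized -> exists m : nat, (k, n - 1)%N = (m * kappa, m * epsilon)%N.
Proof.
have [z [lam1 [zC zgen lam1z lam1M [kap_gt0 [psi1 fib1] multP _]]]] := central_gbs_fibrations.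
move=> [Phi [Phik GPhi]].
have [lam [psi [fib [y yC yk] kdvd]]] := outer_torus_fibered hne Phik GPhi.
have n_gt1 := fibered_rank_gt1 fib hne; have [lamM _ _ _] := fib.
have ygen y' : in_center y' -> exists i, y' = expgz y i.
  move=> y'C; have /dvdzP[i iE] := kdvd _ y'C; exists i; apply: divg1_eq.
  apply: (fibered_center_inj fib n_gt1).
    by rewrite -expgzN; apply: centerM => //; apply: centerXz.
  by rewrite lamM zhomV // zhomXz // yk iE subrr.
have [/dvdnP[m kE] e] := multP _ _ _ _ _ fib hk yC yk ygen.
exists m; congr pair => //; apply/eqP; rewrite -(eqn_pmul2r kap_gt0); apply/eqP.
by move: e; rewrite kE; case: (n) hn => // n' _; rewrite subn1 /=; nia.
Qed.

(** With [lam w = 1] and [y] central of height [k], the element [h = w^k y^-1] has height 0. If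
    [lam1 h] were not 0, [h] and [w] would be independent in the abelianization. So
    [lam1 y = k * lam1 w]; as [z] is a power of [y], [k] divides [lam1 z], which is kappa, and the
    multiple is 1. *)
Lemma realized_betti1 : first_betti G 1 -> realized -> (k, n - 1)%N = (kappa, epsilon).
Proof.
move=> [_ b1] real; have [m [kE nE]] := realized_multiple real.
have [z [lam1 [zC zgen lam1z lam1M [kap_gt0 _ _ _]]]] := central_gbs_fibrations.
have [Phi [Phik GPhi]] := real.
have [lam [psi [fib [y yC yk] kdvd]]] := outer_torus_fibered hne Phik GPhi.
have [lamM [w w1] _ _] := fib.
pose h := expgz w k%:Z * y^-1.
have lh : lam h = 0%R by rewrite /h lamM zhomXz // w1 mulr1 zhomV // yk subrr.
have l1h : lam1 h = 0%R.
  apply: contrapT => l1h.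
  suff : (2 <= 1)%N by [].
  apply: (b1 2%N (fun i : 'I_2 => if i == ord0 then coset _ h else coset _ w)) => mm.
  rewrite !big_ord_recl big_ord0 /= mulg1.
  rewrite -!(homXz (coset _)) -homM => ab1.
  have e0 := zhom_abelianization lamM ab1; have e1 := zhom_abelianization lam1M ab1.
  move: e0 e1; rewrite !lamM !lam1M !zhomXz // lh w1 mulr0 add0r mulr1 => m1.
  rewrite m1 mul0r addr0 => /eqP; rewrite mulf_eq0 => /orP[/eqP m0|/eqP//].
  by move=> i; case: (unliftP ord0 i) => [j ->|->] //; rewrite (ord1 j).
have : (k%:Z %| kappa%:Z)%Z.
  have [i iE] : exists i, z = expgz y i.
    have n_gt1 := fibered_rank_gt1 fib hne.
    have /dvdzP[i iE] := kdvd _ zC; exists i; apply: divg1_eq.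
    apply: (fibered_center_inj fib n_gt1).
      by rewrite -expgzN; apply: centerM => //; apply: centerXz.
    by rewrite lamM zhomV // zhomXz // yk iE subrr.
  rewrite -lam1z iE zhomXz //; apply: dvdz_mull.
  move: l1h; rewrite /h lam1M zhomXz // zhomV // => /eqP; rewrite subr_eq0 => /eqP <-.
  exact: dvdz_mulr.
move=> /(dvdn_leq kap_gt0) /=; rewrite kE => le_k.
have m1 : m = 1%N by move: hk; rewrite kE; nia.
by rewrite nE m1 !mul1n.
Qed.

Lemma realized_base : (k, n - 1)%N = (kappa, epsilon) -> realized.
Proof.
have [z [lam1 [zC zgen lam1z lam1M [kap_gt0 [psi1 fib1] multP _]]]] := central_gbs_fibrations.
move=> [kE nE]; have nE' : n = epsilon.+1 by rewrite -nE subn1 prednK.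
rewrite /realized nE'; apply: (fibered_outer_torus fib1 _ zC hk) => //.
  exact: fibered_rank_gt1 fib1 hne.
by rewrite kE.
Qed.

(** The construction controls only the height [m * kappa] of [z]; that the fibre has rank [n] is
    then forced by the comparison of ranks and indices. *)
Lemma realized_of_multiple b : first_betti G b -> (1 < b)%N ->
  (exists m : nat, (k, n - 1)%N = (m * kappa, m * epsilon)%N) -> realized.
Proof.
move=> [[g gi] _]; case: b g gi => [|[|b]] // g gi _ [m [kE nE]].
have [z [lam1 [zC zgen lam1z lam1M [kap_gt0 [psi1 fib1] multP multE]]]] := central_gbs_fibrations.
have m_gt0 : (0 < m)%N by case: (m) kE hk => // ->.
have [n' [lam [psi [fib lz]]]] := multE b g m gi m_gt0; rewrite -kE in lz.
have [_ e] := multP _ _ _ _ _ fib hk zC lz zgen.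
have n_gt1 := fibered_rank_gt1 fib hne.
have nn : n' = n by move: e; rewrite kE; nia.
rewrite /realized -nn; exact: (fibered_outer_torus fib n_gt1 zC hk lz zgen).
Qed.

End CentralGBS.

Local Close Scope group_scope.
Local Close Scope int_scope.

Theorem theorem7p4 (G : groupType) (kappa epsilon k n : nat)
    (hGBS : is_GBS G) (hne : ~ elementary G)
    (hZ : exists z : G, in_center z /\ z <> 1%g)
    (hkappa : is_kappa G kappa) (hepsilon : is_epsilon G epsilon)
    (hk : 0 < k) (hn : 0 < n) :
  (first_betti G 1 ->
     (exists Phi : outer_automorphism (free_of_rank n),
        has_order Phi k /\ isomorphic G (outer_mapping_torus Phi))
     <-> (k, n - 1) = (kappa, epsilon))
  /\
  (forall b : nat, first_betti G b -> 2 <= b ->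
     (exists Phi : outer_automorphism (free_of_rank n),
        has_order Phi k /\ isomorphic G (outer_mapping_torus Phi))
     <-> exists m : nat, (k, n - 1) = (m * kappa, m * epsilon)).
Proof.
split=> [b1|b bP b_gt1]; split.
- exact: realized_betti1.
- exact: realized_base.
- exact: realized_multiple.
exact: realized_of_multiple bP b_gt1.
Qed.
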